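(* Consider the weak stochastic control problem and the policy improvement algorithm (PIA) described in the context. Assume: (1) there exists a non-empty subset $I^*$ of the set $I$ of improvable Markov policies such that $\pi_0\in I^*$ implies that, for each $n\in\mathbb{N}$, the Markov policy $\pi_n$ produced by the PIA started at $\pi_0$ is a continuous function $S\to A$ belonging to $I^*$; (2) for any Markov policy $\pi_0\in I^*$, with $(\pi_n)_{n\in\mathbb{N}}$ the sequence produced by the PIA started at $\pi_0$, for each $n\in\mathbb{N}$ and each $x\in D$ there is a random variable $Z_x$ with $Z_x\ge 0$ a.s. such that (where $X^{\pi_{n+1}}_0=x$ and $\tau$ is the first exit time of $X^{\pi_{n+1}}$ from $D$) $$V^{\pi_{n+1}}(X^{\pi_{n+1}}_{t\wedge\tau})-V^{\pi_n}(X^{\pi_{n+1}}_{t\wedge\tau})\longrightarrow Z_x\quad\text{in } L^1 \text{ as } t\uparrow\infty .$$ Fix $\pi_0\in I^*$ and let $(\pi_n)_{n\in\mathbb{N}}$ be the sequence produced by the PIA started at $\pi_0$. Assume further: (3) the value function $V$ is finite on $D$; (4) there is a subsequence $(n_k)_{k\in\mathbb{N}}$ such that $$\lim_{k\to\infty}\left[\mathcal{L}^{\pi_{n_k+1}}V^{\pi_{n_k}}(x)+f(x,\pi_{n_k+1}(x))\right]=0\quad\text{uniformly in } x\in D;$$ (5) for each $x\in S$, each $\Pi\in\mathcal{A}_x$ and each $n\in\mathbb{N}$, $$V^{\pi_n}(X^\Pi_{t\wedge\tau})\longrightarrow g(X^\Pi_\tau)1_{(\tau<\infty)}\quad\text{in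 } L^1 \text{ as } t\to\infty .$$ Then $V^{\pi_n}(x)\uparrow V(x)$ as $n\to\infty$ for all $x\in S$ (i.e. the sequence $(V^{\pi_n}(x))_{n\in\mathbb{N}}$ is non-decreasing and converges to $V(x)$).
   Context: Setting. $S$ is a topological space (state space), $A$ is a compact metric space (control set), and $D\subseteq S$ is a domain (open and connected subset) with $D=\bigcup_{n\ge1}K_n$, where $(K_n)$ is an increasing family of compact sets in $S$ with $K_n$ contained in the interior of $K_{n+1}$ for all $n$. The functions $f:S\times A\to\mathbb{R}_+$ and $g:S\to\mathbb{R}_+$ are continuous. For each $a\in A$, $X^a$ is a strong Markov process with state space $S$ and given (martingale) infinitesimal generator $\mathcal{L}^a$ with domain $\mathbf{D}^a$ (a set of real functions on $S$). There is a fixed nonempty subset $\mathbf{C}\subseteq\bigcap_{a\in A}\mathbf{D}^a$ such that $(x,a)\mapsto\mathcal{L}^a\phi(x)$ is jointly continuous on $D\times A$ for each $\phi\in\mathbf{C}$. For a function $\pi:S\to A$ and $\phi\in\mathbf{C}$, $\mathcal{L}^{\pi}\phi(x):=\mathcal{L}^{\pi(x)}\phi(x)$. Controls. A control process $\Pi$ is an $A$-valued $(\mathcal{F}_t)$-adapted process on some filtered probability space $(\Omega,(\mathcal{F}_t)_{t\ge0},\mathcal{F},\mathbb{P})$, which may depend on $\Pi$. For $x\in S$, $\mathcal{A}_x$ is the set of all control processes $\Pi$ for which there exists an $(\mathcal{F}_t)$-adapted right-continuous $S$-valued process $X^\Pi$ such that: (i) $X^\Pi_0=x$; (ii) the law of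 $(X^\Pi,\Pi)$ is unique; (iii) for each $\phi\in\mathbf{C}$, the process $\phi(X^\Pi_{t\wedge\tau})-\int_0^{t\wedge\tau}\mathcal{L}^{\Pi_s}\phi(X^\Pi_s)\,ds$, $t\ge0$, is a martingale, where the stopping time $\tau$ is the first exit time of $X^\Pi$ from $D$; (iv) with $J(x,\Pi):=\int_0^\tau f(X^\Pi_t,\Pi_t)\,dt+g(X^\Pi_\tau)1_{(\tau<\infty)}$, we have $\int_0^{t\wedge\tau}f(X^\Pi_s,\Pi_s)\,ds+g(X^\Pi_\tau)1_{(\tau<\infty)}\to J(x,\Pi)$ in $L^1$ as $t\to\infty$. Markov policies. A Markov policy is a function $\pi:S\to A$ such that for each $x\in D$ there exists an adapted process $X$ on a stochastic basis with: $X_0=x$; $\Pi:=\pi(X)$ (i.e. $\Pi_t:=\pi(X_t)$, $t\ge0$) is in $\mathcal{A}_x$; and $(X^\Pi,\Pi)$ and $(X,\pi(X))$ have the same law. Such an $X$ is denoted $X^\pi$. Payoffs and value function. $V^\Pi(x):=\mathbb{E}[J(x,\Pi)]$ for $\Pi\in\mathcal{A}_x$, $V^\pi(x):=\mathbb{E}[J(x,\pi(X^\pi))]$ for a Markov policy $\pi$, and $V(x):=\sup_{\Pi\in\mathcal{A}_x}V^\Pi(x)$ for $x\in S$. For $x\in S\setminus D$ one has $\tau=0$ and $V(x)=V^\pi(x)=g(x)$ for every Markov policy $\pi$. Improvement and PIA. A Markov policy $\pi$ is improvable if $V^\pi\in\mathbf{C}$; $I$ denotes the set of improvable Markov policies.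 A Markov policy $\pi'$ is an improvement of $\pi\in I$ if for each $x\in D$ $$\mathcal{L}^{\pi'(x)}V^\pi(x)+f(x,\pi'(x))=\sup_{a\in A}\left[\mathcal{L}^aV^\pi(x)+f(x,a)\right].$$ The PIA started at $\pi_0$ produces a sequence $(\pi_n)_{n\in\mathbb{N}}$ in which $\pi_{n+1}$ is a (chosen) improvement of the improvable Markov policy $\pi_n$ for each $n$. Policies are indexed by $\mathbb{N}=\{0,1,2,\dots\}$.
   Formalization: The processes X^π of a Markov policy, stopped at exit from D, are also required to be Markov with a Borel transition function (otherwise V^π depends on the choice of X^π and the claim fails); equality and uniqueness of laws are taken up to the exit time τ. *)

(* Defs.v *)
From HB Require Import structures.
From mathcomp Require Import all_boot all_order all_algebra.
From mathcomp Require Import all_classical all_reals all_analysis.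
From mathcomp Require Import measurable_realfun.

Set Implicit Arguments.
Unset Strict Implicit.
Unset Printing Implicit Defensive.
Import Order.TTheory GRing.Theory Num.Theory.
Import numFieldNormedType.Exports.

Local Open Scope classical_set_scope.
Local Open Scope ring_scope.

(* Processes are total functions of t : R, of which only the values at times
   t >= 0 matter. *)

Definition borel (T : topologicalType) : set (set T) :=
  <<s [set U : set T | open U] >>.

Record stochastic_basis (R : realType) := StochasticBasis {
  sb_display : measure_display ;
  Omega : measurableType sb_display ;
  Prob : probability Omega R ;
  Filt : R -> set (set Omega) ;
  Filt_sigma : forall t, 0 <= t -> sigma_algebra setT (Filt t) ;
  Filt_measurable : forall t, 0 <= t -> Filt t `<=` measurable ;
  Filt_mono : forall s t, 0 <= s -> s <= t -> Filt s `<=` Filt t }.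

Section Processes.
Variables (R : realType) (b : stochastic_basis R).
Implicit Types (T : topologicalType) (tau : Omega b -> \bar R).

Definition adapted T (Y : R -> Omega b -> T) : Prop :=
  forall t, 0 <= t -> forall B, borel B -> Filt t (Y t @^-1` B).

(* Joint measurability on [0, +oo) x Omega: it makes time integrals along Y,
   and Y sampled at a random time, random variables.  It is automatic for
   right-continuous processes in a metrizable space. *)
Definition measurable_process T (Y : R -> Omega b -> T) : Prop :=
  forall B, borel B ->
    measurable [set p : R * Omega b | 0 <= p.1 /\ B (Y p.1 p.2)].

Definition adapted_process T (Y : R -> Omega b -> T) : Prop :=
  measurable_process Y /\ adapted Y.

Definition right_continuous T (Y : R -> Omega b -> T) : Prop :=
  forall w t, 0 <= t -> Y s w @[s --> t^'+] --> Y t w.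

Definition stopping_time tau : Prop :=
  (forall w, 0 <= tau w)%E /\
  forall t, 0 <= t -> Filt t [set w | (tau w <= t%:E)%E].

Definition before_stopping tau : set (set (Omega b)) :=
  [set E | measurable E /\
    forall t, 0 <= t -> Filt t (E `&` [set w | (tau w <= t%:E)%E])].

(* Extended real values allow for pathwise integrals that do not converge;
   integrability forces the values to be finite almost surely.  The last clause
   is E[M_t | F_s] = M_s, written without conditional expectations. *)
Definition martingale (M : R -> Omega b -> \bar R) : Prop :=
  [/\ forall t, 0 <= t -> forall B : set (\bar R), measurable B ->
        Filt t (M t @^-1` B),
      forall t, 0 <= t -> (Prob b).-integrable setT (M t) &
      forall s t E, 0 <= s -> s <= t -> Filt s E ->
        (\int[Prob b]_(w in E) M t w = \int[Prob b]_(w in E) M s w)%E].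

Definition cvg_L1 (Y : R -> Omega b -> \bar R) (Z : Omega b -> \bar R) : Prop :=
  [/\ \forall t \near +oo%R, (Prob b).-integrable setT (Y t),
      (Prob b).-integrable setT Z &
      (\int[Prob b]_w `|Y t w - Z w|)%E @[t --> +oo%R] --> 0%E].

Definition first_exit T (D : set T) (X : R -> Omega b -> T) (w : Omega b) :
    \bar R :=
  ereal_inf [set t%:E | t in [set t | 0 <= t /\ ~ D (X t w)]].

Definition stopped T (Y : R -> Omega b -> T) tau : R -> Omega b -> T :=
  fun t w => Y (fine (mine t%:E (tau w))) w.

Definition law T (Y : R -> Omega b -> T) (G : set (R -> T)) : \bar R :=
  Prob b [set w | G (Y ^~ w)].

Definition past T (Y : R -> Omega b -> T) (t : R) : set (set (Omega b)) :=
  <<s [set E | exists r B, [/\ 0 <= r, r <= t, borel B & E = Y r @^-1` B]] >>.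

Section MarkovProperty.
Variables (T : topologicalType) (X : R -> Omega b -> T).
Variable p : R -> T -> set T -> \bar R.

(* simple Markov property, in the filtration generated by X *)
Definition markov : Prop :=
  forall s t B E, 0 <= s -> 0 <= t -> borel B -> past X t E ->
    Prob b (E `&` X (t + s) @^-1` B) = (\int[Prob b]_(w in E) p s (X t w) B)%E.

Definition strong_markov : Prop :=
  forall s tau B E, 0 <= s -> stopping_time tau -> borel B ->
    before_stopping tau E ->
    let F := E `&` [set w | (tau w < +oo)%E] in
    Prob b (F `&` [set w | B (X (fine (tau w) + s) w)]) =
    (\int[Prob b]_(w in F) p s (X (fine (tau w)) w) B)%E.

End MarkovProperty.
End Processes.

(* Borel measurability in the starting point of a transition function *)
Definition measurable_transition (R : realType) (T : topologicalType)
    (p : R -> T -> set T -> \bar R) : Prop :=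
  forall s B, 0 <= s -> borel B -> forall V : set (\bar R), measurable V ->
    borel [set y | V (p s y B)].

(* sigma-algebra on (S x A)-valued paths generated by the coordinates at times
   t >= 0, each carrying the product of the Borel sigma-algebras *)
Definition path_sigma_algebra (R : realType) (S A : topologicalType) :
    set (set (R -> S * A)) :=
  <<s [set G | exists t B C, [/\ 0 <= t, borel B, borel C &
        G = [set w | B (w t).1 /\ C (w t).2]]] >>.

Record sprocess (R : realType) (T : Type) := SProcess {
  sp_basis : stochastic_basis R ;
  sp_path : R -> Omega sp_basis -> T }.

Arguments sp_basis {R T} _.
Arguments sp_path {R T} _ _ _.

Section StrongMarkovFamily.
Variables (R : realType) (T : topologicalType) (X : T -> sprocess R T).

Definition transition (s : R) (y : T) (B : set T) : \bar R :=
  Prob (sp_basis (X y)) (sp_path (X y) s @^-1` B).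

Definition strong_markov_family : Prop :=
  measurable_transition transition /\
  forall x, [/\ adapted_process (sp_path (X x)),
    forall w, sp_path (X x) 0 w = x &
    strong_markov (sp_path (X x)) transition].

End StrongMarkovFamily.

(* [0, T) as a set of times, for T in [0, +oo] *)
Definition time_before (R : realType) (T : \bar R) : set R :=
  [set s : R | 0 <= s /\ (s%:E < T)%E].

Record control_problem (R : realType) (S : topologicalType) (A : metricType R)
    := ControlProblem {
  A_compact : compact [set: A] ;
  domain : set S ;
  domain_open : open domain ;
  domain_connected : connected domain ;
  exhaustion : nat -> set S ;
  exhaustion_compact : forall n, compact (exhaustion n) ;
  exhaustion_interior : forall n, exhaustion n `<=` interior (exhaustion n.+1) ;
  domain_exhaustion : domain = \bigcup_n exhaustion n ;
  running : S -> A -> R ;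
  running_ge0 : forall x a, 0 <= running x a ;
  running_continuous : continuous (fun p : S * A => running p.1 p.2) ;
  terminal : S -> R ;
  terminal_ge0 : forall x, 0 <= terminal x ;
  terminal_continuous : continuous terminal ;
  (* const_process a x is the process X^a started at x *)
  const_process : A -> S -> sprocess R S ;
  const_strong_markov : forall a, strong_markov_family (const_process a) ;
  gen : A -> (S -> R) -> S -> R ;
  gen_domain : A -> set (S -> R) ;
  gen_martingale : forall a phi x, gen_domain a phi ->
    martingale (fun t w => (phi (sp_path (const_process a x) t w))%:E -
      \int[lebesgue_measure]_(s in time_before t%:E)
        (gen a phi (sp_path (const_process a x) s w))%:E)%E ;
  test : set (S -> R) ;
  test_nonempty : test !=set0 ;
  test_gen_domain : forall a, test `<=` gen_domain a ;
  test_gen_continuous : forall phi, test phi ->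
    {within domain `*` [set: A],
       continuous (fun p : S * A => gen p.2 phi p.1)} }.

Arguments domain {R S A} _.
Arguments running {R S A} _ _ _.
Arguments terminal {R S A} _ _.
Arguments gen {R S A} _ _ _ _.
Arguments test {R S A} _.

Section ControlProblem.
Variables (R : realType) (S : topologicalType) (A : metricType R).
Variable pb : control_problem S A.

Definition exit b (X : R -> Omega b -> S) : Omega b -> \bar R :=
  first_exit (domain pb) X.

Section Functionals.
Variables (b : stochastic_basis R) (Pi : R -> Omega b -> A).
Variable X : R -> Omega b -> S.

Definition running_payoff (T : \bar R) (w : Omega b) : \bar R :=
  (\int[lebesgue_measure]_(s in time_before T)
     (running pb (X s w) (Pi s w))%:E)%E.

Definition terminal_payoff (w : Omega b) : \bar R :=
  if (exit X w < +oo)%E then (terminal pb (X (fine (exit X w)) w))%:E else 0%E.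

Definition payoff (w : Omega b) : \bar R :=
  (running_payoff (exit X w) w + terminal_payoff w)%E.

Definition compensated (phi : S -> R) (t : R) (w : Omega b) : \bar R :=
  ((phi (stopped X (exit X) t w))%:E -
   \int[lebesgue_measure]_(s in time_before (mine t%:E (exit X w)))
     (gen pb (Pi s w) phi (X s w))%:E)%E.

Definition stopped_pair (t : R) (w : Omega b) : S * A :=
  (stopped X (exit X) t w, stopped Pi (exit X) t w).

End Functionals.

(* Equality of the laws of two controlled pairs, up to exit from D.  The
   dynamics below constrain a pair only up to that time, so that no law could
   be unique without stopping. *)
Definition same_law b (X : R -> Omega b -> S) (Pi : R -> Omega b -> A)
    b' (X' : R -> Omega b' -> S) (Pi' : R -> Omega b' -> A) : Prop :=
  forall G, path_sigma_algebra G ->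
    law (stopped_pair Pi X) G = law (stopped_pair Pi' X') G.

Record control := Control {
  ctl_basis : stochastic_basis R ;
  ctl_path : R -> Omega ctl_basis -> A }.
Arguments ctl_path : clear implicits.

Definition is_state (x : S) (c : control) (X : R -> Omega (ctl_basis c) -> S) :
    Prop :=
  [/\ [/\ adapted_process X, right_continuous X & stopping_time (exit X)],
      forall w, X 0 w = x,
      forall phi, test pb phi -> martingale (compensated (ctl_path c) X phi) &
      cvg_L1 (fun t w =>
          running_payoff (ctl_path c) X (mine t%:E (exit X w)) w
          + terminal_payoff X w)%E
        (payoff (ctl_path c) X)].

(* c belongs to the class A_x, which is too large to be a set control *)
Definition admissible (x : S) (c : control) : Prop :=
  adapted_process (ctl_path c) /\
  exists X, is_state x X /\
    forall X', is_state x X' -> same_law X' (ctl_path c) X (ctl_path c).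

(* X^Pi, for a control Pi in A_x; the choice is immaterial up to law *)
Definition state (x : S) (c : control) : R -> Omega (ctl_basis c) -> S :=
  xget (fun _ _ => x) [set X | is_state x X].
Arguments state : clear implicits.

(* V^Pi(x) *)
Definition control_value (x : S) (c : control) : \bar R :=
  (\int[Prob (ctl_basis c)]_w payoff (ctl_path c) (state x c) w)%E.

Definition value (x : S) : \bar R :=
  ereal_sup [set v | exists c, admissible x c /\ v = control_value x c].

Definition feedback (pi : S -> A) (X : sprocess R S) : control :=
  @Control (sp_basis X) (fun t w => pi (sp_path X t w)).

Definition stopped_path (X : sprocess R S) : R -> Omega (sp_basis X) -> S :=
  stopped (sp_path X) (exit (sp_path X)).
Arguments stopped_path : clear implicits.

(* Transition function of the controlled process stopped at its exit from D:
   the points outside D are absorbing. *)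
Definition stopped_transition (X : S -> sprocess R S) (s : R) (y : S)
    (B : set S) : \bar R :=
  if `[< domain pb y >]
  then Prob (sp_basis (X y)) (stopped_path (X y) s @^-1` B)
  else (\1_B y)%:E.

(* A function pi : S -> A, together with the processes X^pi started at the
   points of D (the values of pol_process outside D are irrelevant).  The last
   two fields say that X^pi, run until its exit from D, is a Markov process.
   This has to be required: uniqueness in the definition of A_x concerns the
   processes driven by one given control, and does not relate the processes
   X^pi started at different points. *)
Record markov_policy := MarkovPolicy {
  pol_fun :> S -> A ;
  pol_process : S -> sprocess R S ;
  pol_adapted : forall x, domain pb x ->
    adapted_process (sp_path (pol_process x)) /\
    stopping_time (exit (sp_path (pol_process x))) ;
  pol_start : forall x, domain pb x -> forall w, sp_path (pol_process x) 0 w = x ;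
  pol_admissible : forall x, domain pb x ->
    admissible x (feedback pol_fun (pol_process x)) ;
  pol_law : forall x, domain pb x ->
    let c := feedback pol_fun (pol_process x) in
    same_law (state x c) (ctl_path c) (sp_path (pol_process x)) (ctl_path c) ;
  pol_transition : measurable_transition (stopped_transition pol_process) ;
  pol_markov : forall x, domain pb x ->
    markov (stopped_path (pol_process x)) (stopped_transition pol_process) }.

Definition pol_control (pi : markov_policy) (x : S) : control :=
  feedback pi (pol_process pi x).

(* V^pi; the expectation is finite, the payoff being integrable for admissible controls *)
Definition policy_value (pi : markov_policy) (x : S) : R :=
  if `[< domain pb x >] then fine (control_value x (pol_control pi x))
  else terminal pb x.

Definition improvable (pi : markov_policy) : Prop := test pb (policy_value pi).

Definition improvement (pi pi' : markov_policy) : Prop :=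
  forall x, domain pb x ->
    (gen pb (pi' x) (policy_value pi) x + running pb x (pi' x))%:E =
    ereal_sup (range (fun a : A =>
      (gen pb a (policy_value pi) x + running pb x a)%:E)).

Definition pia_sequence (pi0 : markov_policy) (pi : nat -> markov_policy) :
    Prop :=
  pi 0%N = pi0 /\
  forall n, improvable (pi n) /\ improvement (pi n) (pi n.+1).

End ControlProblem.

Arguments ctl_path {R A} _ _ _.
Arguments state {R S A} _ _ _ _ _.
Arguments stopped_path {R S A} _ _ _ _.

(* Main.v *)
Require Import Defs.
From HB Require Import structures.
From mathcomp Require Import all_boot all_order all_algebra.
From mathcomp Require Import finmap.
From mathcomp Require Import all_classical all_reals all_analysis.
From mathcomp Require Import measurable_realfun.
From mathcomp Require Import ring lra.

Set Implicit Arguments.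
Unset Strict Implicit.
Unset Printing Implicit Defensive.
Import Order.TTheory GRing.Theory Num.Theory.
Import numFieldNormedType.Exports.

Local Open Scope classical_set_scope.
Local Open Scope ring_scope.

(* Let Z be the state process stopped at its exit from D.  By the Markov property
   of the policies and Fubini, V^pi satisfies dynamic programming:
   V^pi(Z_t) + int_0^t f is a martingale.  If V^pi is a test function, comparison with the
   martingale of the controlled dynamics shows that the time integral of the drift
   L^pi V^pi + f along Z is a martingale; its paths are absolutely continuous and
   start at slope (L^pi V^pi + f)(x), and a martingale cannot have paths that all
   start by decreasing linearly, so this drift is nonnegative on D.
   The drift of an improvement is at least as large, whence
   E V^pi(Z_t) + E int_0^t f >= V^pi(x) under pi', and letting t tend to infinity
   (the gap V^pi' - V^pi along Z has a nonnegative limit) gives V^pi' >= V^pi.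
   For an arbitrary control, the drift of V^{pi_{n_k}} is at most e_k -> 0, so that
   E V^{pi_0}(Z_t) + E int_0^t f <= V^{pi_{n_k}}(x) + e_k t.  Sending k, and only
   then t, to infinity bounds the payoff of the control by lim_n V^{pi_n}(x).
   Outside D every admissible control earns the terminal reward, and constant
   controls show that there is one. *)

(** Each policy comes with two processes: the given [pol_process], which has the Markov property,
    and the [state] selected by [xget], which has right-continuous paths and the martingale
    property, and along which the payoff is computed. Only the laws of their stopped pairs agree.
    Hence the semigroup is defined on the first and evaluated on the second, and even the identity
    Pi = pi(X) along the second has to be recovered from the law. Neither Borel measurability of
    V^pi nor its integrability along Z is given. All that leads to dynamic programming is therefore
    done with nonnegative extended functions, where Tonelli and monotone convergence need no
    integrability; the finiteness of V^pi(x) yields integrability afterwards. Hypothesis (5) gives a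
    limit in t for one fixed n, without uniformity in n. The terminal part of a control is therefore
    compared with V^{pi_0} alone, which lies below every V^{pi_{n_k}}, while k is free to vary with
    the error. *)

Section Filtration.
Context {T : Type} (Q : set (set T)).
Hypothesis sQ : sigma_algebra setT Q.

Lemma sigma_algebra_setC E : Q E -> Q (~` E).
Proof. by case: sQ => _ h _ /h; rewrite setTD. Qed.

Lemma sigma_algebra_setT : Q setT.
Proof. by case: sQ => h _ _; rewrite -setC0; exact: sigma_algebra_setC. Qed.

Lemma sigma_algebra_setU E F : Q E -> Q F -> Q (E `|` F).
Proof.
move=> QE QF; rewrite -bigcup2E; case: sQ => h0 _; apply => -[|[|n]] //=.
Qed.

Lemma sigma_algebra_setI E F : Q E -> Q F -> Q (E `&` F).
Proof.
move=> QE QF; rewrite -[X in Q X]setCK setCI; apply: sigma_algebra_setC.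
by apply: sigma_algebra_setU; exact: sigma_algebra_setC.
Qed.

End Filtration.

(** * Martingales whose paths start by decreasing *)

Section StoppedMartingale.
Context {R : realType} {d : measure_display} {T : measurableType d}.
Variable P : probability T R.
Variables (Q : nat -> set (set T)) (Y : nat -> T -> R) (r : nat -> R).

(** Index 0 is exempt: in the application [Y 0] and [r 0] are both 0, so the strict inequality would
    already fail at the start. *)
Fixpoint alive (k : nat) (w : T) : bool :=
  if k is j.+1 then alive j w && (Y k w < r k) else true.

(* Y frozen at the first index k >= 1 with r k <= Y k *)
Fixpoint stopped_value (k : nat) (w : T) : R :=
  if k is j.+1 then (if alive j w then Y k w else stopped_value j w)
  else Y 0%N w.

Lemma stopped_value_alive k w : alive k w -> stopped_value k w = Y k w.
Proof. by case: k => //= k /andP[->]. Qed.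

Lemma stopped_valueP k w : (alive k w /\ stopped_value k w = Y k w) \/
  exists j, [/\ (j < k)%N, alive j w, r j.+1 <= Y j.+1 w &
                stopped_value k w = Y j.+1 w].
Proof.
elim: k => [|k [[ak Sk]|[j [jk aj rj Sj]]]] /=; first by left.
- rewrite ak /=; case: (ltP (Y k.+1 w) (r k.+1)) => h; [by left|right].
  by exists k; split.
- right; exists j; split=> //; first exact: ltnW.
  case: ifPn => // ak; exfalso.
  have : forall i, alive (j.+1 + i) w -> alive j.+1 w.
    by elim=> [|i IH]; rewrite ?addn0 // addnS => /= /andP[/IH].
  by move=> /(_ (k - j.+1)%N); rewrite subnKC // => /(_ ak) /andP[_];
    rewrite ltNge rj.
Qed.

Hypothesis sQ : forall k, sigma_algebra setT (Q k).
Hypothesis mQ : forall k, Q k `<=` measurable.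
Hypothesis incrQ : forall k, Q k `<=` Q k.+1.
Hypothesis adQ : forall k B, measurable B -> Q k (Y k @^-1` B).
Hypothesis intY : forall k, P.-integrable setT (EFin \o Y k).
Hypothesis martY : forall k E, Q k E ->
  (\int[P]_(w in E) (Y k.+1 w)%:E = \int[P]_(w in E) (Y k w)%:E)%E.
Hypothesis Y0 : forall w, Y 0%N w = 0.
Hypothesis r_le0 : forall k, r k.+1 <= 0.

Let Qalive k : Q k [set w | alive k w].
Proof.
elim: k => [|k IH] /=.
  by rewrite (_ : [set _ | _] = setT) ?eqEsubset//; exact: sigma_algebra_setT.
rewrite (_ : [set _ | _] = [set w | alive k w] `&` Y k.+1 @^-1` `]-oo, r k.+1[).
  by apply: sigma_algebra_setI => //; [exact: incrQ|exact: adQ].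
apply/seteqP; split => w /=; rewrite in_itv /=; first by move/andP.
by case=> -> ->.
Qed.

Let Qstopped k B : measurable B -> Q k (stopped_value k @^-1` B).
Proof.
move=> mB; elim: k => [|k IH] /=; first exact: adQ.
rewrite (_ : _ @^-1` _ = ([set w | alive k w] `&` Y k.+1 @^-1` B) `|`
    (~` [set w | alive k w] `&` stopped_value k @^-1` B)).
  apply: sigma_algebra_setU => //; apply: sigma_algebra_setI => //.
  - by apply: incrQ; exact: Qalive.
  - exact: adQ.
  - by apply: sigma_algebra_setC => //; apply: incrQ; exact: Qalive.
  - exact: incrQ.
apply/seteqP; split => w /=; case: ifPn => h.
- by left.
- by right; split => //; apply/negP.
- by case=> -[].
- by case=> -[] //; rewrite (negbTE h).
Qed.

Let malive k : measurable [set w | alive k w].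
Proof. exact: mQ (Qalive k). Qed.

Let mY k : measurable_fun setT (Y k).
Proof. by move=> _ B mB; rewrite setTI; exact/mQ/adQ. Qed.

Lemma measurable_stopped_value k : measurable_fun setT (stopped_value k).
Proof. by move=> _ B mB; rewrite setTI; exact/mQ/Qstopped. Qed.

Lemma integrable_stopped_value k : P.-integrable setT (EFin \o stopped_value k).
Proof.
elim: k => [|k IH]; first exact: intY.
apply: (@le_integrable _ _ _ _ _ measurableT _
  (fun w => `|(stopped_value k w)%:E| + `|(Y k.+1 w)%:E|)%E).
- exact/measurable_EFinP/measurable_stopped_value.
- move=> w _ /=; rewrite lee_fin (ger0_norm (addr_ge0 _ _))//.
  by case: ifPn => _; [rewrite lerDr|rewrite lerDl].
- apply: integrableD => //.
    exact: (integrable_abse IH).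
  exact: (integrable_abse (intY _)).
Qed.

Let int_split k f : measurable_fun setT f -> forall A, measurable A ->
  (\int[P]_(w in A) f w = \int[P]_(w in A `&` [set w | alive k w]) f w +
     \int[P]_(w in A `&` ~` [set w | alive k w]) f w)%E.
Proof.
move=> mf A mA; rewrite -integral_setU //=.
- by rewrite -setIUr setUv setIT.
- exact: measurableI.
- by apply: measurableI => //; exact: measurableC.
- by rewrite -setIUr setUv setIT; exact: measurable_funTS.
- by apply/disj_setPS => w /= [[_ h] [_ h']]; exact: h'.
Qed.

Let int_stopped_alive k A :
  (\int[P]_(w in A `&` [set w | alive k w]) (stopped_value k.+1 w)%:E =
   \int[P]_(w in A `&` [set w | alive k w]) (Y k.+1 w)%:E)%E.
Proof. by apply: eq_integral => w; rewrite inE /= => -[_ ->]. Qed.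

Let int_stopped_dead k A :
  (\int[P]_(w in A `&` ~` [set w | alive k w]) (stopped_value k.+1 w)%:E =
   \int[P]_(w in A `&` ~` [set w | alive k w]) (stopped_value k w)%:E)%E.
Proof.
by apply: eq_integral => w; rewrite inE /= => -[_ /negP]; case: ifP.
Qed.

Let int_alive k A :
  (\int[P]_(w in A `&` [set w | alive k w]) (stopped_value k w)%:E =
   \int[P]_(w in A `&` [set w | alive k w]) (Y k w)%:E)%E.
Proof.
by apply: eq_integral => w; rewrite inE => -[_ /= /stopped_value_alive ->].
Qed.

(** Optional stopping, one step at a time: on the event [alive k], which belongs to [Q k], the step
    replaces [Y k] by [Y k.+1], with the same integral; off it nothing changes. *)
Lemma integral_stopped_value k : (\int[P]_w (stopped_value k w)%:E = 0)%E.
Proof.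
elim: k => [|k IH].
  by under eq_integral do rewrite /= Y0; rewrite integral0.
rewrite (@int_split k) //; last exact/measurable_EFinP/measurable_stopped_value.
rewrite int_stopped_alive int_stopped_dead martY ?setTI; last exact: Qalive.
rewrite -IH [RHS](@int_split k) //; last first.
  exact/measurable_EFinP/measurable_stopped_value.
by rewrite int_alive !setTI.
Qed.

(** As [r] is nonpositive, a path alive at an index k >= 1 has a negative value; a positive value is
    therefore frozen, its event lies in the past, and [Y] may run on without changing the integral.
    The gain is an integrand which, on a grid of [0, 1], is the last value of the martingale
    whatever the mesh. *)
Lemma integral_stopped_value_gt0 k :
  (\int[P]_(w in [set w | (0 < stopped_value k w)%R]) (stopped_value k w)%:E =
   \int[P]_(w in [set w | (0 < stopped_value k w)%R]) (Y k w)%:E)%E.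
Proof.
have QF j : Q j [set w | 0 < stopped_value j w].
  have := @Qstopped j `]0, +oo[ (measurable_itv _).
  by congr (Q j); apply/seteqP; split => w /=; rewrite in_itv /= andbT.
have mF j := mQ (QF j).
elim: k => [//|k IH].
have mS j := (measurable_EFinP _ _).2 (measurable_stopped_value j).
have mYE j := (measurable_EFinP _ _).2 (mY j).
rewrite (int_split k (mS k.+1) (mF _)) (int_split k (mYE k.+1) (mF _)).
congr (_ + _)%E.
  exact: int_stopped_alive.
have -> : [set w | 0 < stopped_value k.+1 w] `&` ~` [set w | alive k w] =
    [set w | 0 < stopped_value k w] `&` ~` [set w | alive k w].
  by apply/seteqP; split => w /= [] + /negP h; rewrite (negbTE h).
rewrite int_stopped_dead.
rewrite martY; last first.
  by apply: sigma_algebra_setI => //; apply: sigma_algebra_setC.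
(* At index 0 every path is alive, so the dead part is empty; from index 1 on, a positive value
   excludes being alive. *)
case: k IH => [|k] IH.
  by rewrite (_ : _ `&` _ = set0) ?integral_set0 // -subset0 => w /= [] _; apply.
have -> // : [set w | 0 < stopped_value k.+1 w] `&` ~` [set w | alive k.+1 w] =
    [set w | 0 < stopped_value k.+1 w].
apply/seteqP; split => w; first by case.
move=> h; split => // a; move: h; rewrite /= in a *.
move/andP: a => [-> h1]; rewrite ltNge => /negP; apply.
exact: (le_trans (ltW h1)).
Qed.

(** A variable of mean 0 has negative and positive parts with equal integrals; the positive part is
    then rewritten through [Y k]. *)
Lemma integral_stopped_value_neg k :
  (\int[P]_w (Num.max (- stopped_value k w) 0)%:E =
   \int[P]_(w in [set w | (0 < stopped_value k w)%R]) (Y k w)%:E)%E.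
Proof.
have mS := measurable_stopped_value k.
have mF : measurable [set w | 0 < stopped_value k w].
  have /mQ := @Qstopped k `]0, +oo[ (measurable_itv _).
  by congr measurable; apply/seteqP; split => w /=; rewrite in_itv /= andbT.
have intS := integrable_stopped_value k.
rewrite -integral_stopped_value_gt0.
pose f := (EFin \o stopped_value k) \_ [set w | 0 < stopped_value k w].
have intF : P.-integrable setT f.
  by apply/(integrable_mkcond _ mF).1; exact: integrableS intS.
transitivity (\int[P]_w (f \- (EFin \o stopped_value k)) w)%E; last first.
  rewrite integralB // integral_stopped_value sube0.
  by rewrite [RHS]integral_mkcond.
apply: eq_integral => w _; rewrite /= /f patchE; case: ifPn.
  rewrite inE /= => h; rewrite -EFinB subrr; congr (_%:E).
  by apply/max_idPr; rewrite oppr_le0 ltW.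
rewrite notin_setE /= => /negP; rewrite -leNgt => h.
by rewrite add0e; congr (_%:E); apply/max_idPl; rewrite oppr_ge0.
Qed.

End StoppedMartingale.

Section ContinuousMartingale.
Context {R : realType} {d : measure_display} {T : measurableType d}.
Variable P : probability T R.
Variables (Q : R -> set (set T)) (N : R -> T -> R) (e : R).
Hypothesis e_gt0 : 0 < e.
Hypothesis sQ : forall t, 0 <= t -> sigma_algebra setT (Q t).
Hypothesis mQ : forall t, 0 <= t -> Q t `<=` measurable.
Hypothesis incrQ : forall s t, 0 <= s -> s <= t -> Q s `<=` Q t.
Hypothesis adN : forall t, 0 <= t -> forall B, measurable B -> Q t (N t @^-1` B).
Hypothesis intN : forall t, 0 <= t -> P.-integrable setT (EFin \o N t).
Hypothesis martN : forall s t E, 0 <= s -> s <= t -> Q s E ->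
  (\int[P]_(w in E) (N t w)%:E = \int[P]_(w in E) (N s w)%:E)%E.
Hypothesis N0 : forall w, N 0 w = 0.

(** Continuity on [0, 1] is asked in uniform form because it has to control all the steps of a fine
    grid at once. *)
Definition initially_decreasing (w : T) : Prop :=
  (forall eta, 0 < eta -> exists2 del, 0 < del &
     forall s t, 0 <= s -> s <= t -> t <= 1 -> t - s < del ->
       `|N t w - N s w| < eta) /\
  exists2 del, 0 < del & forall t, 0 < t -> t < del -> N t w < - (e * t).

(** A path that stays below the line -e t ends below -e at time 1. Otherwise its first return to the
    line comes after [del]; with a mesh below [del / 2], the previous grid point lies beyond
    [del / 2], where the path is below -e del / 2, and one step raises it by less than e del / 4. *)
Lemma initially_decreasing_stopped w : initially_decreasing w ->
  exists2 c, 0 < c & \forall m \near \oo,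
    stopped_value (fun k => N (k%:R / m.+1%:R)) (fun k => - (e * (k%:R / m.+1%:R)))
      m.+1 w <= - c.
Proof.
move=> [ucN [del del0 Nlt]].
have ed0 : 0 < e * del by apply: mulr_gt0.
have [|del' del'0 uc] := ucN (e * del / 4); first by rewrite divr_gt0.
exists (Num.min e (e * del / 4)).
  by rewrite lt_min e_gt0 /= divr_gt0.
near=> m.
have m0 : 0 < (m.+1%:R : R) by rewrite ltr0n.
have mdel : m.+1%:R^-1 < del / 2 :> R.
  near: m; have h : 0 < del / 2 by rewrite divr_gt0.
  exact: (near_infty_natSinv_lt (PosNum h)).
have mdel' : m.+1%:R^-1 < del' :> R.
  near: m; exact: (near_infty_natSinv_lt (PosNum del'0)).
set Y := fun k => _; set r := fun k => _.
have [[al ->]|[j [jm aj rj ->]]] := stopped_valueP Y r m.+1 w.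
  move: al => /= /andP[_]; rewrite /Y /r divff ?gt_eqF// mulr1 => h.
  apply: (le_trans (ltW h)); rewrite lerN2.
  by rewrite ge_min lexx.
have tj0 : 0 < (j.+1%:R / m.+1%:R : R) by rewrite divr_gt0 ?ltr0n.
have tj : del <= j.+1%:R / m.+1%:R.
  by rewrite leNgt; apply/negP => /(Nlt _ tj0); rewrite ltNge => /negP; apply.
have tS : j.+1%:R / m.+1%:R = j%:R / m.+1%:R + m.+1%:R^-1 :> R.
  by rewrite -natr1 mulrDl mul1r.
have tjl : del / 2 < j%:R / m.+1%:R.
  have aux (a b c q : R) : q <= a -> a = b + c -> c < q / 2 -> q / 2 < b by lra.
  exact: aux tj tS mdel.
(* The previous grid point cannot be time 0, the one index at which [alive] says nothing, since it
   lies beyond [del / 2]. *)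
have jN : N (j%:R / m.+1%:R) w < - (e * (j%:R / m.+1%:R)).
  case: j aj tjl {rj jm tj tj0 tS} => [|j] /=.
    by rewrite mul0r => _ h; exfalso; lra.
  by move=> /andP[].
have := uc (j%:R / m.+1%:R) (j.+1%:R / m.+1%:R).
have /[swap] /[apply] : 0 <= (j%:R / m.+1%:R : R) by rewrite divr_ge0.
have /[swap] /[apply] : (j%:R / m.+1%:R : R) <= j.+1%:R / m.+1%:R.
  by rewrite tS lerDl invr_ge0 ltW.
have /[swap] /[apply] : j.+1%:R / m.+1%:R <= 1 :> R.
  by rewrite ler_pdivrMr // mul1r ler_nat.
have /[swap] /[apply] : j.+1%:R / m.+1%:R - j%:R / m.+1%:R < del'.
  by rewrite tS addrAC subrr add0r.
rewrite ltr_norml => /andP[_ h].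
have h2 : e * (del / 2) < e * (j%:R / m.+1%:R) by rewrite ltr_pM2l.
apply: (@le_trans _ _ (- (e * del / 4))).
  have aux (a b c q : R) : a - b < c / 4 -> b < - q -> c / 2 < q -> a <= - (c / 4).
    by lra.
  by apply: aux h jN _; rewrite -mulrA.
by rewrite lerN2 ge_min lexx orbT.
Unshelve. all: by end_near. Qed.

(* On a fine grid, N is frozen when it first comes back above the line -e t.  The
   frozen value has mean 0, so the mean of its negative part is that of its positive
   part, which vanishes in the limit, whereas its value becomes < 0 almost surely. *)
Lemma not_ae_initially_decreasing : ~ {ae P, forall w, initially_decreasing w}.
Proof.
move=> dec.
pose Y m k := N (k%:R / m.+1%:R).
pose r m k := - (e * (k%:R / m.+1%:R)).
pose S m := stopped_value (Y m) (r m) m.+1.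
have t0 m k : 0 <= (k%:R / m.+1%:R : R) by rewrite divr_ge0.
have tS m k : (k%:R / m.+1%:R : R) <= k.+1%:R / m.+1%:R.
  by rewrite ler_pM2r ?invr_gt0 ?ltr0n// ler_nat.
have SE m : (\int[P]_w (Num.max (- S m w) 0)%:E =
   \int[P]_(w in [set w | (0 < S m w)%R]) (N 1 w)%:E)%E.
  (* The grid of mesh 1/(m+1) has m+1 steps, so it ends at time 1 for every [m]; [|N 1|] will
     dominate all the restrictions. *)
  have -> : N 1 = Y m m.+1 by rewrite /Y divff // pnatr_eq0.
  apply: (@integral_stopped_value_neg _ _ _ P (fun k => Q (k%:R / m.+1%:R))).
  - by move=> k; exact: sQ.
  - by move=> k; exact: mQ.
  - by move=> k; exact: incrQ.
  - by move=> k; exact: adN.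
  - by move=> k; exact: intN.
  - by move=> k E QE; exact: martN.
  - by move=> w; rewrite /Y mul0r N0.
  - by move=> k; rewrite /r oppr_le0 mulr_ge0 // ltW.
have mS m : measurable_fun setT (S m).
  apply: (@measurable_stopped_value _ _ _ (fun k => Q (k%:R / m.+1%:R))).
  - by move=> k; exact: sQ.
  - by move=> k; exact: mQ.
  - by move=> k; exact: incrQ.
  - by move=> k; exact: adN.
have mF m : measurable [set w | 0 < S m w].
  rewrite -[X in measurable X]setTI; have := mS m measurableT `]0, +oo[%classic (measurable_itv _).
  by congr measurable; apply/seteqP; split => w /=; rewrite in_itv /= andbT.
have mN1 : measurable_fun setT (N 1).
  by move=> _ B mB; rewrite setTI; exact: (mQ ler01 (adN ler01 mB)).
pose g m : T -> \bar R := (EFin \o N 1) \_ [set w | 0 < S m w].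
have neg : {ae P, forall w, exists2 c, 0 < c & \forall m \near \oo, S m w <= - c}.
  by apply: filterS dec => w /initially_decreasing_stopped.
have cvg0 : (\int[P]_w g m w)%E @[m --> \oo] --> 0%E.
  have [|||||_ _] := @dominated_convergence _ _ _ P setT measurableT g (cst 0%E)
    (fun w => `|(N 1 w)%:E|%E).
  - move=> m; apply: (measurable_restrictT _ (mF m)).1.
    by apply: measurable_funTS; exact/measurable_EFinP.
  - exact: measurable_cst.
  - apply: filterS neg => w [c c0 [M _ hM]] _.
    apply: cvg_near_cst; exists M => // m /hM /= h.
    rewrite /g patchE ifF //; apply/negbTE; rewrite notin_setE /= => h'.
    by move: (lt_le_trans h' h); rewrite ltNge oppr_le0 ltW.
  - exact: (integrable_abse (intN ler01)).
  - apply: aeW => w m _; rewrite /g patchE; case: ifPn => _ //.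
    by rewrite abse0.
  - by rewrite integral_cst ?mul0e.
pose f m w := (Num.max (- S m w) 0)%:E.
have mf m : measurable_fun setT (f m).
  apply/measurable_EFinP; apply: measurable_maxr => //.
  exact: measurableT_comp.
have f_ge0 m w : (0 <= f m w)%E by rewrite lee_fin le_max lexx orbT.
have li_ge0 w : (0 <= limn_einf (f ^~ w))%E.
  rewrite limn_einf_lim; apply: lime_ge; first exact: is_cvg_einfs.
  by apply: nearW => n; apply: le_ereal_inf_tmp => _ [m _ <-].
(* By Fatou, the lower limit of the negative parts has integral at most 0, although almost surely it
   is at least some c > 0. *)
have fle : (\int[P]_w limn_einf (f ^~ w) <= 0)%E.
  apply: (le_trans (fatou _ measurableT mf (fun n x _ => f_ge0 n x))).
  rewrite (_ : (fun n => _) = (fun m => \int[P]_w g m w)%E); last first.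
    by apply/funext => m; rewrite SE [LHS]integral_mkcond.
  by rewrite (cvg_limn_einf_sup cvg0).1.
have mli : measurable_fun setT (fun w => limn_einf (f ^~ w)).
  rewrite /limn_einf; apply: measurableT_comp => //.
  apply: measurable_fun_limn_esup => m; exact: measurableT_comp.
have : (\int[P]_w `|limn_einf (f ^~ w)| = 0)%E.
  apply/le_anti/andP; split; last exact: integral_ge0.
  by apply: le_trans fle; rewrite le_eqVlt; apply/orP; left; apply/eqP;
    apply: eq_integral => w _; rewrite gee0_abs.
move=> /(ae_eq_integral_abs _ measurableT mli) h.
have : {ae P, forall w, False}.
  apply: filterS2 h neg => w /(_ I) h [c c0 [M _ hM]].
  have : (c%:E <= limn_einf (f ^~ w))%E.
    rewrite limn_einf_lim; apply: lime_ge; first exact: is_cvg_einfs.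
    exists M => // n Mn; apply: le_ereal_inf_tmp => _ [m /= nm <-].
    rewrite lee_fin le_max; apply/orP; left.
    by rewrite lerNr hM //= (leq_trans Mn).
  by rewrite h lee_fin leNgt c0.
(* An almost sure contradiction is absurd only because the total mass is 1, hence nonzero. *)
have PF : ProperFilter (almost_everywhere P).
  apply: ae_properfilter_algebraOfSetsType.
  apply: (@lt_le_trans _ _ (P setT)) => //; rewrite probability_setT.
  exact: lte01.
by move=> /(@filter_ex _ _ PF)[].
Qed.

End ContinuousMartingale.

(** * Measurability *)

Section RightContinuousMeasurable.
Context {R : realType} {d : measure_display} {T : measurableType d}.

(** The grid point strictly to the right of [s], even when [s] is on the grid, because the filter
    [s^'+] leaves out [s] itself. *)
Definition next_grid (n : nat) (s : R) : R :=
  (Num.truncn (n.+1%:R * s)).+1%:R / n.+1%:R.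

Lemma next_grid_gt n s : s < next_grid n s.
Proof. by rewrite ltr_pdivlMr ?ltr0n// mulrC truncnS_gt. Qed.

Lemma next_grid_le n s : 0 <= s -> next_grid n s <= s + n.+1%:R^-1.
Proof.
move=> s0; rewrite ler_pdivrMr ?ltr0n// mulrDl mulVf ?pnatr_eq0//.
by rewrite -natr1 lerD2r mulrC truncn_le mulr_ge0.
Qed.

Lemma cvg_next_grid s : 0 <= s -> next_grid n s @[n --> \oo] --> s^'+.
Proof.
move=> s0 A [e /= e0 eA]; change (\forall n \near \oo, A (next_grid n s)).
near=> n; apply: eA => /=; last exact: next_grid_gt.
rewrite ltr0_norm ?subr_lt0 ?next_grid_gt// opprB ltrBlDl.
apply: le_lt_trans (next_grid_le n s0) _; rewrite ltrD2l.
by near: n; exact: (near_infty_natSinv_lt (PosNum e0)).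
Unshelve. all: by end_near. Qed.

(** [f] is the pointwise limit of functions that are constant in time on the slabs of a grid.
    Convergence is asked only along [next_grid], a sequence, so that dominated convergence can
    supply it when [f] is itself an expectation. *)
Lemma measurable_right_continuous (f : R -> T -> \bar R) :
  (forall s, 0 <= s -> measurable_fun setT (f s)) ->
  (forall w s, 0 <= s -> f (next_grid n s) w @[n --> \oo] --> f s w) ->
  measurable_fun setT (fun p : R * T => if 0 <= p.1 then f p.1 p.2 else 0%E).
Proof.
move=> mf rf.
pose h n (p : R * T) := if 0 <= p.1 then f (next_grid n p.1) p.2 else 0%E.
apply: (@emeasurable_fun_cvg _ _ _ _ h); last first.
  move=> [s w] _; rewrite /h /=; case: ifPn => s0; last exact: cvg_cst.
  exact: rf.
move=> n.
have n0 : 0 < (n.+1%:R : R) by rewrite ltr0n.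
have mI k : measurable (`[k%:R / n.+1%:R : R, k.+1%:R / n.+1%:R[ `*` [set: T]).
  by apply: measurableX => //; exact: measurable_itv.
rewrite (_ : [set: R * T] = (`]-oo, 0%R[ `*` [set: T]) `|`
   \bigcup_k (`[k%:R / n.+1%:R : R, k.+1%:R / n.+1%:R[ `*` [set: T])); last first.
  apply/seteqP; split => // -[s w] _; have [s0|s0] := ltP s 0.
    by left; split => //=; rewrite in_itv.
  right; exists (Num.truncn (n.+1%:R * s)) => //; split => //=.
  rewrite in_itv /= ler_pdivrMr // ltr_pdivlMr // mulrC.
  by apply: truncn_itv; rewrite mulr_ge0.
apply/measurable_funU => //.
- by apply: measurableX => //; exact: measurable_itv.
- exact: bigcup_measurable.
split.
  apply: (eq_measurable_fun (cst 0%E : R * T -> \bar R)) => //.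
  by move=> [s w]; rewrite inE /= in_itv /= => -[s0 _]; rewrite /h leNgt s0.
apply/measurable_fun_bigcup => // k.
apply: (eq_measurable_fun (fun p : R * T => f (k.+1%:R / n.+1%:R) p.2)).
  move=> [s w]; rewrite inE /= in_itv /= => -[/andP[h1 h2] _].
  have s0 : 0 <= s by apply: le_trans h1; rewrite divr_ge0.
  rewrite /h /= s0 /next_grid; congr (f (_.+1%:R / _) _); apply/esym/truncn_def.
  by move: h1 h2; rewrite ler_pdivrMr // ltr_pdivlMr // mulrC => -> ->.
apply: measurable_funTS; apply: measurableT_comp => //.
by apply: mf; rewrite divr_ge0.
Qed.

End RightContinuousMeasurable.

Section Translation.
Context {R : realType}.
Local Open Scope ereal_scope.
Local Notation mu := (@lebesgue_measure R).

Lemma measurable_translation (t : R) : measurable_fun setT (fun s : R => (t + s)%R).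
Proof. exact: measurable_funD. Qed.

(** Lebesgue measure is determined by its values on the intervals ]a, b], whose lengths a
    translation preserves. *)
Lemma lebesgue_measure_translation (t : R) A : measurable A ->
  pushforward mu (fun s => (t + s)%R : measurableTypeR R) A = mu A.
Proof.
move=> mA; apply/esym/lebesgue_measure_unique => //.
  exact: measurable_translation.
move=> mt _ [[a b]] _ <-.
transitivity (mu `](a - t)%R, (b - t)%R]%classic); last first.
  congr (mu _).
  by apply/seteqP; split => s /=; rewrite !in_itv /= ltrBlDl lerBrDl.
by rewrite !lebesgue_measure_itv /= !lte_fin ltrD2r -!EFinB; congr (if _ then _%:E else _); ring.
Qed.

Lemma ge0_integral_translation (t : R) (f : R -> \bar R) :
  measurable_fun [set: R] f -> (forall r, 0 <= f r) ->
  \int[mu]_(s in `[0%R, +oo[) f (t + s)%R = \int[mu]_(s in `[t, +oo[) f s.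
Proof.
move=> mf f0.
have := @ge0_integral_pushforward _ _ (measurableTypeR R) (measurableTypeR R) R
  _ (measurable_translation t) mu
  `[t, +oo[%classic f (measurable_itv _) (measurable_funTS mf) (fun s _ => f0 s).
rewrite (_ : _ @^-1` _ = `[0%R, +oo[%classic); last first.
  by apply/seteqP; split => s /=; rewrite !in_itv /= !andbT lerDl.
move=> <-; apply: eq_measure_integral => [|m A mA _].
  exact: measurable_translation.
exact: lebesgue_measure_translation.
Qed.

End Translation.

(* Measurable types are pointed: x only witnesses that T is nonempty. *)
Definition pointed_space (T : Type) (x : T) : Type := T.

HB.instance Definition _ (T : topologicalType) (x : T) :=
  Topological.on (pointed_space x).
HB.instance Definition _ (T : topologicalType) (x : T) :=
  isPointed.Build (pointed_space x) x.

(** [borel] turned into a measurable type, so that the closure properties of measurable functions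
    apply to functions on S. *)
Definition borel_space (T : topologicalType) (x : T) : measurableType _ :=
  g_sigma_algebraType [set U : set (pointed_space x) | open U].

(** For each n, compactness gives finitely many centres for radius 1/(n+1); an index encodes n
    together with a position in the n-th list. Interiors of balls are used because they are open, as
    the cover requires, and hence Borel. *)
Lemma compact_dense_sequence (R : realType) (A : metricType R) (a0 : A) :
  compact [set: A] ->
  exists u : nat -> A, forall n a, exists i, (ball (u i) n.+1%:R^-1)° a.
Proof.
move=> cA; have cA' : compact [set: pointed_space a0] by exact: cA.
have fin n : finite_subset_cover [set: A]
    (fun z : A => (ball z n.+1%:R^-1)° : set (pointed_space a0)) [set: A].
  move: cA'; rewrite compact_cover; apply.
  - by move=> z _; exact: open_interior.
  - move=> z _; exists z => //; rewrite /interior /=.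
    by apply: (@nbhsx_ballx _ A z n.+1%:R^-1).
have fin' n : exists D : {fset A}, [set: A] `<=` \bigcup_(z in [set` D]) (ball z n.+1%:R^-1)°.
  by have [D _ cov] := fin n; exists D.
have [D hD] := choice fin'.
exists (fun k => let p := odflt (0%N, 0%N) (choice.unpickle k) in
                 nth a0 (enum_fset (D p.1)) p.2).
move=> n a; have [z zD az] := hD n a I.
exists (choice.pickle (n, index z (enum_fset (D n)))).
by rewrite choice.pickleK /= nth_index.
Qed.

Section Caratheodory.
Context {R : realType} {S : topologicalType} {A : metricType R}.
Variables (D : set S) (F : S -> A -> R).
Hypothesis D_open : open D.
Hypothesis F_cont : {within D `*` [set: A], continuous (fun p => F p.1 p.2)}.

Lemma continuous_at_domain y a : D y ->
  {for (y, a), continuous (fun p : S * A => F p.1 p.2)}.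
Proof.
move=> Dy; move: F_cont; rewrite continuous_open_subspace.
  by apply; rewrite inE.
rewrite openE => -[z b] [/= Dz _]; exists (D, setT) => //; split => //=.
  exact: open_nbhs_nbhs.
exact: filterT.
Qed.

Lemma measurable_preimage_domain d (T : measurableType d) (U : set T)
    (xi : T -> S) (h : S -> R) :
  (forall B, borel B -> measurable (U `&` xi @^-1` B)) ->
  (forall w, U w -> D (xi w)) -> {in D, continuous h} ->
  measurable_fun U (h \o xi).
Proof.
move=> mxi UD ch.
apply: (measurability _ (RGenOpens.measurableE R)) => _ [_ [a [b ->] <-]].
have -> : U `&` (h \o xi) @^-1` `]a, b[ = U `&` xi @^-1` (D `&` h @^-1` `]a, b[).
  by apply/seteqP; split => w [Uw] //= []; split => //; split => //; exact: UD.
apply: mxi; apply: sub_gen_smallest.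
rewrite openE => y [Dy hy].
have : nbhs y (h @^-1` `]a, b[).
  by apply: ch; [rewrite inE|apply: open_nbhs_nbhs; split].
by apply: (@filterS2 _ _ _ D) => //; exact: open_nbhs_nbhs.
Qed.

(** The control is replaced by the first point of the dense sequence within 1/(n+1) of it. On each
    of the countably many pieces so obtained, the integrand is a function of [xi] alone, continuous
    on D; continuity of F lets n tend to infinity. *)
Lemma measurable_caratheodory d (T : measurableType d) (U : set T)
    (xi : T -> S) (al : T -> A) : compact [set: A] -> measurable U ->
  (forall B, borel B -> measurable (U `&` xi @^-1` B)) ->
  (forall B, borel B -> measurable (U `&` al @^-1` B)) ->
  (forall w, U w -> D (xi w)) ->
  measurable_fun U (fun w => F (xi w) (al w)).
Proof.
move=> cA mU mxi mal UD.
have [->|/set0P [w0 _]] := eqVneq U set0; first exact: measurable_fun_set0.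
have [u uP] := compact_dense_sequence (al w0) cA.
pose near n i w := (ball (u i) n.+1%:R^-1)° (al w).
have near_ex n w : exists i, `[< near n i w >].
  by have [i] := uP n (al w); exists i; apply/asboolP.
pose ix n w := ex_minn (near_ex n w).
have mnear n i : measurable (U `&` [set w | near n i w]).
  apply: (mal (ball (u i) n.+1%:R^-1)°); apply: sub_gen_smallest.
  exact: open_interior.
apply: (@measurable_fun_cvg _ _ _ _ (fun n w => F (xi w) (u (ix n w)))).
- move=> n.
  pose E i := (U `&` [set w | near n i w]) `\`
    \big[setU/set0]_(j < i) (U `&` [set w | near n j w]).
  have mE i : measurable (E i).
    by apply: measurableD => //; exact: bigsetU_measurable.
  have EP i w : E i w -> U w /\ ix n w = i.
    move=> [[Uw nw] /= nE]; split => //.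
    rewrite /ix; case: ex_minnP => j /asboolP nj jmin.
    apply/eqP; rewrite eqn_leq jmin ?andTb; last exact/asboolP.
    rewrite leqNgt; apply/negP => ji; apply: nE.
    by rewrite -(bigcup_mkord _ (fun j => U `&` [set w | near n j w])); exists j.
  have -> : U = \bigcup_i E i.
    apply/seteqP; split => [w Uw|w [i _ /EP []//]].
    exists (ix n w) => //; rewrite /ix; case: ex_minnP => j /asboolP nj jmin.
    split => //=; rewrite -(bigcup_mkord _ (fun j => U `&` [set w | near n j w])) => -[i /= ij [_ ni]].
    by move: (jmin i (asboolT ni)); rewrite leqNgt ij.
  apply/measurable_fun_bigcup => // i.
  apply: (eq_measurable_fun ((fun y => F y (u i)) \o xi)).
    by move=> w; rewrite inE => /EP [_ ->].
  apply: (@measurable_preimage_domain _ _ (E i)).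
  + move=> B mB; have -> : E i `&` xi @^-1` B = E i `&` (U `&` xi @^-1` B).
      by apply/seteqP; split => w /= [Ew]; [move=> ?|case=> *]; split => //;
         split => //; have [] := EP _ _ Ew.
    by apply: measurableI => //; exact: mxi.
  + by move=> w /EP [/UD].
  + move=> y; rewrite inE => Dy.
    apply: (@continuous_comp _ _ _ (fun y => (y, u i)) (fun p => F p.1 p.2)).
      by apply: cvg_pair => //; exact: cvg_cst.
    exact: continuous_at_domain.
- move=> w Uw; have := @continuous_at_domain (xi w) (al w) (UD _ Uw).
  apply: (@cvg_comp _ _ _ (fun n => (xi w, u (ix n w)))).
  apply: cvg_pair; first exact: cvg_cst.
  apply/cvg_ballP => e e0; near=> n.
  have : ball (u (ix n w)) n.+1%:R^-1 (al w).
    apply: interior_subset; rewrite /ix; case: ex_minnP => j /asboolP nj _.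
    exact: nj.
  move=> /ball_sym; apply: le_ball; apply: ltW; near: n.
  exact: (near_infty_natSinv_lt (PosNum e0)).
Unshelve. all: by end_near. Qed.

End Caratheodory.

(** * Exit from an open set *)

Section StoppedProcess.
Context {R : realType} {b : stochastic_basis R} {T : topologicalType}.
Implicit Types (Y : R -> Omega b -> T) (tau : Omega b -> \bar R).

Lemma measurable_stopping_time tau : stopping_time tau -> measurable_fun setT tau.
Proof.
move=> [tau0 Ftau]; apply: (measurability _ (ErealGenOInfty.measurableE R)).
move=> _ [_ [r ->] <-]; rewrite setTI.
have -> : tau @^-1` `]r%:E, +oo[%classic = ~` [set w | (tau w <= r%:E)%E].
  apply/seteqP; split => w /=; rewrite in_itv /= ?andbT ltNge; first by move/negP.
  by move/negP.
apply: measurableC; have [r0|r0] := leP 0 r.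
  by apply: (@Filt_measurable _ b r) => //; exact: Ftau.
rewrite (_ : [set _ | _] = set0) //; apply/seteqP; split => w //= h.
by have := le_trans (tau0 w) h; rewrite lee_fin leNgt r0.
Qed.

Definition stop_at tau (t : R) (w : Omega b) : R := fine (mine t%:E (tau w)).

Lemma stop_at_ge0 tau t w : (forall w, 0 <= tau w)%E -> 0 <= t -> 0 <= stop_at tau t w.
Proof. by move=> tau0 t0; rewrite fine_ge0 // le_min lee_fin t0 tau0. Qed.

Lemma measurable_stop_at tau : stopping_time tau ->
  measurable_fun setT (fun p : R * Omega b => stop_at tau p.1 p.2).
Proof.
move=> /measurable_stopping_time mtau.
apply: (measurableT_comp (@fine_measurable R _ measurableT)).
apply: measurable_mine; first exact/measurable_EFinP.
exact: measurableT_comp.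
Qed.

(** Stopping is composition with the measurable time change sending (t, w) to (min(t, tau w), w);
    joint measurability of the process is what makes this composition legitimate. *)
Lemma measurable_process_stopped Y tau : stopping_time tau ->
  measurable_process Y -> measurable_process (stopped Y tau).
Proof.
move=> st mY B mB; have [tau0 _] := st.
have mphi : measurable_fun setT (fun p : R * Omega b => (stop_at tau p.1 p.2, p.2)).
  by apply: measurable_fun_pair => //; exact: measurable_stop_at.
have m0 : measurable [set p : R * Omega b | 0 <= p.1].
  rewrite (_ : [set _ | _] = `[0, +oo[%classic `*` setT).
    by apply: measurableX => //; exact: measurable_itv.
  by apply/seteqP; split => -[t w] /=; rewrite in_itv /= andbT; [|case].
rewrite (_ : [set _ | _] = [set p | 0 <= p.1] `&`
   (fun p : R * Omega b => (stop_at tau p.1 p.2, p.2)) @^-1`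
     [set p : R * Omega b | 0 <= p.1 /\ B (Y p.1 p.2)]).
  by apply: measurableI => //; rewrite -[X in measurable X]setTI; apply: mphi => //; exact: mY.
apply/seteqP; split => -[t w] /= [t0]; last by case.
by split=> //; split=> //; exact: stop_at_ge0.
Qed.

Lemma measurable_process_at Y t B : measurable_process Y -> 0 <= t -> borel B ->
  measurable (Y t @^-1` B).
Proof.
move=> mY t0 mB.
have := measurable_xsection t (mY B mB).
congr measurable; apply/seteqP; split => w; rewrite /xsection /= inE /=; first by case.
by split.
Qed.

Lemma measurable_process_path Y w B : measurable_process Y -> borel B ->
  measurable [set s | 0 <= s /\ B (Y s w)].
Proof.
move=> mY mB.
have := measurable_ysection w (mY B mB).
by congr measurable; apply/seteqP; split => s; rewrite /ysection /= inE.
Qed.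

End StoppedProcess.

Section ExitTime.
Context {R : realType} {b : stochastic_basis R} {T : topologicalType}.
Variables (D : set T) (X : R -> Omega b -> T).
Local Notation tau := (first_exit D X).
Local Notation Z := (stopped X tau).

Lemma first_exit_ge0 w : (0 <= tau w)%E.
Proof. by apply: le_ereal_inf_tmp => _ [t [t0 _] <-]; rewrite lee_fin. Qed.

Lemma before_exit s w : 0 <= s -> (s%:E < tau w)%E -> D (X s w).
Proof.
move=> s0 st; apply: contrapT => nD; move: st; rewrite ltNge => /negP; apply.
by apply: ereal_inf_lbound; exists s.
Qed.

Lemma first_exit0 w : ~ D (X 0 w) -> tau w = 0%E.
Proof.
move=> nD; apply/le_anti; rewrite first_exit_ge0 andbT.
by apply: ereal_inf_lbound; exists 0.
Qed.

Lemma stopped_before s w : (s%:E <= tau w)%E -> Z s w = X s w.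
Proof. by move=> h; rewrite /stopped min_l. Qed.

Lemma stopped_after s w : (tau w <= s%:E)%E -> Z s w = X (fine (tau w)) w.
Proof. by move=> h; rewrite /stopped min_r. Qed.

Hypothesis D_open : open D.
Hypothesis X_rc : Defs.right_continuous X.

(** If the path were in the open set D at its exit time, right-continuity would keep it there a
    little longer, against the infimum. *)
Lemma first_exit_notin w : (tau w < +oo)%E -> ~ D (X (fine (tau w)) w).
Proof.
move=> tauoo DX.
have tf : tau w \is a fin_num by rewrite ge0_fin_numE // first_exit_ge0.
have t0 : 0 <= fine (tau w) by rewrite fine_ge0 // first_exit_ge0.
have : nbhs (X (fine (tau w)) w) D by exact: open_nbhs_nbhs.
move=> /(@X_rc w _ t0) [e /= e0 eD].
have : ((fine (tau w) + e)%:E <= tau w)%E.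
  apply: le_ereal_inf_tmp => _ [t [tt nD] <-]; rewrite lee_fin leNgt; apply/negP => te.
  apply: nD; have [tlt|tgt|->//] := ltgtP t (fine (tau w)).
    by apply: before_exit => //; rewrite -(fineK tf) lte_fin.
  apply: eD => //=; rewrite ltr0_norm ?subr_lt0// opprB ltrBlDl //.
by rewrite -[in leRHS](fineK tf) lee_fin gerDl leNgt e0.
Qed.

(** This makes survival up to time [s] an event of the stopped process, hence an element of its
    past. *)
Lemma stopped_in s w : 0 <= s -> D (Z s w) <-> (s%:E < tau w)%E.
Proof.
move=> s0; split => [|st]; last by rewrite stopped_before ?ltW//; exact: before_exit.
move=> DZ; rewrite ltNge; apply/negP => ts; move: DZ; rewrite stopped_after //.
by apply: first_exit_notin; apply: (le_lt_trans ts); rewrite ltry.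
Qed.

(** Before the exit [Z] follows [X] inside the open set D, and from the exit on it is frozen; the
    jump created by the cut-off at the exit is therefore seen only from the left. *)
Lemma right_continuous_in_domain (h : T -> R) w s :
  {in D, continuous h} -> 0 <= s ->
  (h \_ D) (Z u w) @[u --> s^'+] --> (h \_ D) (Z s w).
Proof.
move=> hc s0; have [st|ts] := ltP s%:E (tau w).
  have DX : D (X s w) by exact: before_exit.
  rewrite [X in _ --> X](_ : _ = h (X s w)); last first.
    by rewrite stopped_before ?ltW // patchE mem_set.
  apply: cvg_trans (cvg_comp _ _ (@X_rc w _ s0) (hc _ (mem_set DX))).
  apply: near_eq_cvg; near=> u.
  have su : s < u by near: u; exact: nbhs_right_gt.
  have ut : (u%:E < tau w)%E.
    near: u; case: (tau w) st => [r| |] //=; rewrite ?lte_fin => st.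
      by apply: filterS (nbhs_right_lt st) => u; rewrite lte_fin.
    by apply: nearW => u; rewrite ltry.
  rewrite stopped_before ?ltW // patchE mem_set //.
  by apply: before_exit => //; apply: le_trans (ltW su).
rewrite [X in _ --> X](_ : _ = (h \_ D) (X (fine (tau w)) w)); last first.
  by rewrite stopped_after.
apply: cvg_near_cst; near=> u; rewrite stopped_after //.
by apply: (le_trans ts); rewrite lee_fin; apply: ltW; near: u; exact: nbhs_right_gt.
Unshelve. all: by end_near. Qed.

End ExitTime.

(** * Induction on nonnegative measurable functions, and Borel functions *)

Section MeasurableInduction.
Context {R : realType} {d : measure_display} {T : measurableType d}.
Local Open Scope ereal_scope.
Variable Q : (T -> \bar R) -> Prop.
Hypothesis Q_indic : forall A, measurable A -> Q (fun x => (\1_A x)%:E).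
Hypothesis Q_scale : forall (k : R) f, (0 <= k)%R -> (forall x, 0 <= f x) ->
  measurable_fun setT f -> Q f -> Q (fun x => k%:E * f x).
Hypothesis Q_add : forall f g, (forall x, 0 <= f x) -> measurable_fun setT f ->
  (forall x, 0 <= g x) -> measurable_fun setT g -> Q f -> Q g ->
  Q (fun x => f x + g x).
Hypothesis Q_lim : forall f_ : nat -> T -> \bar R, (forall n x, 0 <= f_ n x) ->
  (forall n, measurable_fun setT (f_ n)) ->
  (forall x, nondecreasing_seq (f_ ^~ x)) -> (forall n, Q (f_ n)) ->
  Q (fun x => limn (f_ ^~ x)).

Import HBNNSimple.

(** Approximation from below by simple functions. It reduces identities between integrals over
    different probability spaces to identities between probabilities. *)
Lemma ge0_measurable_ind f : (forall x, 0 <= f x) -> measurable_fun setT f -> Q f.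
Proof.
move=> f0 mf; pose f_ := nnsfun_approx measurableT mf.
have -> : f = (fun x => limn (fun n => (f_ n x)%:E)).
  by apply/funext => x; apply/esym/cvg_lim => //; exact: cvg_nnsfun_approx.
apply: Q_lim.
- by move=> n x; rewrite lee_fin; exact: fun_ge0.
- by move=> n; exact/measurable_EFinP.
- by move=> x a c ac; rewrite lee_fin; exact/lefP/nd_nnsfun_approx.
move=> n; set g := f_ n.
have Q0 : Q (fun _ => 0).
  rewrite (_ : (fun _ => 0) = (fun x => (\1_(@set0 T) x)%:E)); first exact: Q_indic.
  by apply/funext => x; rewrite indic0.
rewrite (_ : (fun x => (g x)%:E) = (fun x => \sum_(y <- fset_set (range g))
   (y%:E * (\1_(g @^-1` [set y]) x)%:E))); last first.
  apply/funext => x; rewrite fimfunE fsbig_finite//= sumEFin.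
  by congr (_%:E).
have mi y : measurable (g @^-1` [set y]) by [].
have : forall y, y \in enum_fset (fset_set (range g)) -> (0 <= y)%R.
  move=> y; rewrite -[y \in _]/(y \in fset_set (range g)) in_fset_set // inE => -[x _ <-]; exact: fun_ge0.
elim: (enum_fset _) => [|y s IH] s0; first by under eq_fun do rewrite big_nil.
under eq_fun do rewrite big_cons.
have y0 : (0 <= y)%R by apply: s0; rewrite mem_head.
have i0 z x : 0 <= (\1_(g @^-1` [set z]) x)%:E :> \bar R by rewrite lee_fin.
have mI z : measurable_fun setT (fun x => (\1_(g @^-1` [set z]) x)%:E : \bar R).
  exact/measurable_EFinP.
apply: Q_add.
- by move=> x; rewrite mule_ge0 // lee_fin.
- by apply: measurable_funeM.
- move=> x; rewrite big_seq sume_ge0 // => z zs; rewrite mule_ge0 // lee_fin s0 //.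
  by rewrite in_cons zs orbT.
- apply: emeasurable_sum => z; exact: measurable_funeM.
- by apply: Q_scale => //; exact: Q_indic.
- by apply: IH => z zs; apply: s0; rewrite in_cons zs orbT.
Qed.

End MeasurableInduction.

Lemma sigma_algebra_generated {T : Type} (G : set (set T)) :
  sigma_algebra setT <<s G >>.
Proof. exact: smallest_sigma_algebra. Qed.

Definition borel_fun {R : realType} {S : topologicalType} (u : S -> \bar R) : Prop :=
  forall V, measurable V -> borel (u @^-1` V).

Lemma borel_funP {R : realType} {S : topologicalType} (x : S) (u : S -> \bar R) :
  borel_fun u <-> measurable_fun (setT : set (borel_space x)) u.
Proof.
split=> [bu _ V mV|mu V mV]; first by rewrite setTI; exact: bu.
by have := mu measurableT V mV; rewrite setTI.
Qed.

Lemma borel_setT {S : topologicalType} : borel (setT : set S).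
Proof. apply: sigma_algebra_setT; exact: sigma_algebra_generated. Qed.

(** [borel_space] needs a point of S; if there is none, every preimage is the whole space. *)
Lemma borel_fun_pointed {R : realType} {S : topologicalType} (u : S -> \bar R) :
  (S -> borel_fun u) -> borel_fun u.
Proof.
move=> bu V mV; have [[x _]|noS] := pselect (exists x : S, True); first exact: bu.
rewrite (_ : _ @^-1` _ = setT); first exact: borel_setT.
by apply/seteqP; split => // y _; exfalso; apply: noS; exists y.
Qed.

Lemma open_borel {S : topologicalType} (U : set S) : open U -> borel U.
Proof. by move=> oU; exact: sub_gen_smallest. Qed.

Lemma measurable_fun_borel_comp {R : realType} {S : topologicalType} d
    (T : measurableType d) (Y : T -> S) (u : S -> \bar R) :
  (forall B, borel B -> measurable (Y @^-1` B)) -> borel_fun u ->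
  measurable_fun setT (fun w => u (Y w)).
Proof. by move=> mY bu _ V mV; rewrite setTI; apply: (mY (u @^-1` V)); exact: bu. Qed.

(** * Transfer along equality of laws *)

Section LawTransfer.
Context {R : realType} {S : topologicalType} {A : metricType R}.
Variables (pb : control_problem S A) (b b' : stochastic_basis R).
Variables (X : R -> Omega b -> S) (Pi : R -> Omega b -> A).
Variables (X' : R -> Omega b' -> S) (Pi' : R -> Omega b' -> A).
Hypothesis mX : measurable_process X.
Hypothesis sX : stopping_time (exit pb X).
Hypothesis mX' : measurable_process X'.
Hypothesis sX' : stopping_time (exit pb X').
Hypothesis lawXX' : same_law pb X Pi X' Pi'.
Local Notation Z := (stopped X (exit pb X)).
Local Notation Z' := (stopped X' (exit pb X')).
Local Notation pair := (stopped_pair pb Pi X).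
Local Notation pair' := (stopped_pair pb Pi' X').

(** One condition on the stopped path, read on two probability spaces. The path event G is kept as a
    witness so that intersections can be transferred, not just probabilities. *)
Definition same_event (E : set (Omega b)) (E' : set (Omega b')) : Prop :=
  exists G, [/\ path_sigma_algebra G, E = [set w | G (pair ^~ w)] &
                E' = [set w | G (pair' ^~ w)]].

Lemma same_event_prob E E' : same_event E E' -> Prob b E = Prob b' E'.
Proof. by move=> [G [/lawXX' + -> ->]]. Qed.

Lemma same_event_setT : same_event setT setT.
Proof.
exists setT; split; [|by apply/seteqP; split|by apply/seteqP; split].
exact: (sigma_algebra_setT (@sigma_algebra_generated _ _)).
Qed.

Lemma same_eventI E E' F F' : same_event E E' -> same_event F F' ->
  same_event (E `&` F) (E' `&` F').
Proof.
move=> [G [pG -> ->]] [H [pH -> ->]]; exists (G `&` H); split => //.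
exact: (sigma_algebra_setI (@sigma_algebra_generated _ _)).
Qed.

Lemma same_event_at t B : 0 <= t -> borel B -> same_event (Z t @^-1` B) (Z' t @^-1` B).
Proof.
move=> t0 bB; exists [set w | B (w t).1 /\ [set: A] (w t).2]; split => //.
- by apply: sub_gen_smallest; exists t, B, setT; split => //; exact: borel_setT.
- by apply/seteqP; split => w //= [].
- by apply/seteqP; split => w //= [].
Qed.

(** Checked on the generators of the past and on sigma-algebra operations. It carries a conditioning
    event for one process to a conditioning event for the other, as the transfer of the Markov
    property requires. *)
Lemma past_same_event t E : past Z t E -> exists2 E', past Z' t E' & same_event E E'.
Proof.
move: E; apply: smallest_sub.
  split.
  - exists set0; first by have [] := sigma_algebra_generated
      [set E | exists r B, [/\ 0 <= r, r <= t, borel B & E = Z' r @^-1` B]].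
    exists set0; split; [|by apply/seteqP; split|by apply/seteqP; split].
    by have [] := @sigma_algebra_generated (R -> S * A)
      [set G | exists t B C, [/\ 0 <= t, borel B, borel C &
        G = [set w | B (w t).1 /\ C (w t).2]]].
  - move=> E [E' pE' [G [pG -> eE']]]; rewrite setTD; exists (~` E').
      exact: (sigma_algebra_setC (@sigma_algebra_generated _ _)).
    exists (~` G); split => //; last by rewrite eE'.
    exact: (sigma_algebra_setC (@sigma_algebra_generated _ _)).
  - move=> F hF.
    have [F' hF'] := choice (fun n => let: ex_intro2 E' pE' sE' := hF n in
                               ex_intro (fun E' => past Z' t E' /\ same_event (F n) E') E' (conj pE' sE')).
    have [G hG] := choice (fun n => (hF' n).2).
    exists (\bigcup_n F' n).
      have [_ _] := sigma_algebra_generated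
        [set E | exists r B, [/\ 0 <= r, r <= t, borel B & E = Z' r @^-1` B]].
      by apply => n; exact: (hF' n).1.
    exists (\bigcup_n G n); split.
    + have [_ _] := @sigma_algebra_generated (R -> S * A)
        [set G | exists t B C, [/\ 0 <= t, borel B, borel C &
          G = [set w | B (w t).1 /\ C (w t).2]]].
      by apply => n; have [] := hG n.
    + by apply/seteqP; split => w [n _] h; exists n => //; move: h; have [_ -> _] := hG n.
    + by apply/seteqP; split => w [n _] h; exists n => //; move: h; have [_ _ ->] := hG n.
move=> _ [r [B [r0 rt bB ->]]]; exists (Z' r @^-1` B); last exact: same_event_at.
by apply: sub_gen_smallest; exists r, B; split.
Qed.

Lemma measurable_stopped_preimage t B : 0 <= t -> borel B -> measurable (Z t @^-1` B).
Proof.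
by move=> t0 bB; apply: measurable_process_at => //; exact: measurable_process_stopped.
Qed.

Lemma measurable_stopped_comp t (u : S -> \bar R) : 0 <= t -> borel_fun u ->
  measurable_fun setT (fun w => u (Z t w)).
Proof.
move=> t0; apply: measurable_fun_borel_comp => B; exact: measurable_stopped_preimage.
Qed.

End LawTransfer.

Section LawIntegral.
Context {R : realType} {S : topologicalType} {A : metricType R}.
Variables (pb : control_problem S A) (b b' : stochastic_basis R).
Variables (X : R -> Omega b -> S) (Pi : R -> Omega b -> A).
Variables (X' : R -> Omega b' -> S) (Pi' : R -> Omega b' -> A).
Hypothesis mX : measurable_process X.
Hypothesis sX : stopping_time (exit pb X).
Hypothesis mX' : measurable_process X'.
Hypothesis sX' : stopping_time (exit pb X').
Hypothesis lawXX' : same_law pb X Pi X' Pi'.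
Local Notation Z := (stopped X (exit pb X)).
Local Notation Z' := (stopped X' (exit pb X')).
Local Open Scope ereal_scope.

Lemma integral_same_event E E' t (u : S -> \bar R) :
  measurable E -> measurable E' -> same_event pb X Pi X' Pi' E E' ->
  (0 <= t)%R -> (forall y, 0 <= u y) -> borel_fun u ->
  \int[Prob b]_(w in E) u (Z t w) = \int[Prob b']_(w in E') u (Z' t w).
Proof.
move=> mE mE' sEE' t0 u0 bu.
(* Any point of S serves to form [borel_space]; one is read off the process. *)
have x : S := Z t point.
move/(borel_funP x): bu => bu.
pose Q (u : borel_space x -> \bar R) :=
  \int[Prob b]_(w in E) u (Z t w) = \int[Prob b']_(w in E') u (Z' t w).
have mZ (f : borel_space x -> \bar R) : measurable_fun setT f ->
    measurable_fun E (fun w => f (Z t w)).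
  by move/borel_funP => bf; apply: measurable_funTS; exact: measurable_stopped_comp.
have mZ' (f : borel_space x -> \bar R) : measurable_fun setT f ->
    measurable_fun E' (fun w => f (Z' t w)).
  by move/borel_funP => bf; apply: measurable_funTS; exact: measurable_stopped_comp.
apply: (@ge0_measurable_ind _ _ (borel_space x) Q) => //; rewrite {}/Q.
- move=> B mB.
  transitivity (\int[Prob b]_(w in E) (\1_(Z t @^-1` B) w)%:E).
    by apply: eq_integral => w _; rewrite !indicE.
  transitivity (\int[Prob b']_(w in E') (\1_(Z' t @^-1` B) w)%:E); last first.
    by apply: eq_integral => w _; rewrite !indicE.
  rewrite !integral_indic //; try exact: measurable_stopped_preimage.
  apply: same_event_prob lawXX' _ _ _; apply: same_eventI => //.
  exact: same_event_at.
- move=> k f k0 f0 mf IH; rewrite ge0_integralZl //; last exact: mZ.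
  by rewrite IH -ge0_integralZl //; exact: mZ'.
- move=> f g f0 mf g0 mg IHf IHg.
  rewrite ge0_integralD //; [|exact: mZ|exact: mZ].
  by rewrite IHf IHg -ge0_integralD //; exact: mZ'.
- move=> f_ f0 mf ndf IH.
  rewrite monotone_convergence //; [|by move=> n; exact: mZ].
  rewrite monotone_convergence //; [|by move=> n; exact: mZ'].
  by congr (limn _); apply/funext.
Qed.

End LawIntegral.

(** * The Markov semigroup of a policy *)

Section PolicySemigroup.
Context {R : realType} {S : topologicalType} {A : metricType R}.
Variables (pb : control_problem S A) (pi : markov_policy pb).
Local Open Scope ereal_scope.
Implicit Types (u v : S -> \bar R) (s t : R) (x y : S).

Local Notation bas y := (sp_basis (pol_process pi y)).
Local Notation Z' y := (stopped_path pb (pol_process pi y)).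
Local Notation X y := (state pb y (pol_control pi y)).
Local Notation Z y := (stopped (X y) (exit pb (X y))).

Lemma stateP (x : S) (c : control A) : admissible pb x c ->
  is_state pb x (state pb x c).
Proof. by move=> [_ [Y [sY _]]]; apply: (@xgetPex _ _ [set Y | is_state pb x Y]); exists Y. Qed.

Lemma policy_stateP x : domain pb x -> is_state pb x (X x).
Proof. by move=> Dx; apply: stateP; exact: pol_admissible. Qed.

(** Integration against [stopped_transition]: built on the given process, for which the Markov
    property is stated, with the points outside D absorbing. *)
Definition policy_semigroup (s : R) (u : S -> \bar R) (y : S) : \bar R :=
  if `[< domain pb y >] then \int[Prob (bas y)]_w u (Z' y s w) else u y.

Lemma policy_measurable y : domain pb y ->
  measurable_process (sp_path (pol_process pi y)) /\
  stopping_time (exit pb (sp_path (pol_process pi y))).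
Proof. by move=> /(@pol_adapted _ _ _ _ pi) [[]]. Qed.

Lemma state_measurable y : domain pb y ->
  measurable_process (X y) /\ stopping_time (exit pb (X y)).
Proof. by move=> /policy_stateP [[[]]]. Qed.

Lemma policy_semigroup_ge0 s u y : (forall y, 0 <= u y) -> 0 <= policy_semigroup s u y.
Proof.
by move=> u0; rewrite /policy_semigroup; case: ifPn => // _; exact: integral_ge0.
Qed.

Lemma policy_semigroup_indic s B y : (0 <= s)%R -> borel B ->
  policy_semigroup s (fun y => (\1_B y)%:E) y =
  stopped_transition pb (pol_process pi) s y B.
Proof.
move=> s0 bB; rewrite /policy_semigroup /stopped_transition; case: ifPn => // /asboolP Dy.
have [mX sX] := policy_measurable Dy.
transitivity (\int[Prob (bas y)]_w (\1_(Z' y s @^-1` B) w)%:E).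
  by apply: eq_integral => w _; rewrite !indicE.
rewrite integral_indic ?setIT //.
exact: (@measurable_stopped_preimage _ _ _ _ _ _ mX sX).
Qed.

Lemma policy_measurable_comp y t u : domain pb y -> (0 <= t)%R -> borel_fun u ->
  measurable_fun setT (fun w => u (Z' y t w)).
Proof.
move=> Dy t0 bu; have [mX sX] := policy_measurable Dy.
exact: (@measurable_stopped_comp _ _ _ _ _ _ mX sX).
Qed.

Lemma state_measurable_comp y t u : domain pb y -> (0 <= t)%R -> borel_fun u ->
  measurable_fun setT (fun w => u (Z y t w)).
Proof.
move=> Dy t0 bu; have [mX sX] := state_measurable Dy.
exact: (@measurable_stopped_comp _ _ _ _ _ _ mX sX).
Qed.

Lemma policy_semigroupZ s (k : R) u y : (0 <= s)%R -> (0 <= k)%R ->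
  (forall y, 0 <= u y) -> borel_fun u ->
  policy_semigroup s (fun y => k%:E * u y) y = k%:E * policy_semigroup s u y.
Proof.
move=> s0 k0 u0 bu; rewrite /policy_semigroup; case: ifPn => // /asboolP Dy.
by rewrite ge0_integralZl //; exact: policy_measurable_comp.
Qed.

Lemma policy_semigroupD s u v y : (0 <= s)%R ->
  (forall y, 0 <= u y) -> borel_fun u -> (forall y, 0 <= v y) -> borel_fun v ->
  policy_semigroup s (fun y => u y + v y) y =
  policy_semigroup s u y + policy_semigroup s v y.
Proof.
move=> s0 u0 bu v0 bv; rewrite /policy_semigroup; case: ifPn => // /asboolP Dy.
by rewrite ge0_integralD //; exact: policy_measurable_comp.
Qed.

Lemma policy_semigroup_lim s (u : nat -> S -> \bar R) y : (0 <= s)%R ->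
  (forall n y, 0 <= u n y) -> (forall n, borel_fun (u n)) ->
  (forall y, nondecreasing_seq (u ^~ y)) ->
  policy_semigroup s (fun y => limn (u ^~ y)) y =
  limn (fun n => policy_semigroup s (u n) y).
Proof.
move=> s0 u0 bu ndu; rewrite /policy_semigroup; case: ifPn => // /asboolP Dy.
rewrite monotone_convergence // => n; exact: policy_measurable_comp.
Qed.

Lemma le_policy_semigroup s u v y : (0 <= s)%R ->
  (forall y, 0 <= u y) -> borel_fun u -> borel_fun v ->
  (forall y, u y <= v y) -> policy_semigroup s u y <= policy_semigroup s v y.
Proof.
move=> s0 u0 bu bv uv; rewrite /policy_semigroup; case: ifPn => // /asboolP Dy.
apply: ge0_le_integral => //; exact: policy_measurable_comp.
Qed.

Lemma borel_policy_semigroup s u : (0 <= s)%R -> (forall y, 0 <= u y) ->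
  borel_fun u -> borel_fun (policy_semigroup s u).
Proof.
move=> s0 u0 bu; apply: borel_fun_pointed => x.
move/(borel_funP x) : bu => bu.
pose Q (u : borel_space x -> \bar R) := borel_fun (policy_semigroup s u).
apply: (@ge0_measurable_ind _ _ (borel_space x) Q) => //; rewrite {}/Q.
- move=> B bB; rewrite (_ : policy_semigroup _ _ = fun y =>
    stopped_transition pb (pol_process pi) s y B); last first.
    by apply/funext => y; exact: policy_semigroup_indic.
  by move=> V mV; exact: (pol_transition pi s0 bB).
- move=> k f k0 f0 /borel_funP mf IH.
  rewrite (_ : policy_semigroup _ _ = fun y => k%:E * policy_semigroup s f y).
    by apply/(borel_funP x); apply: measurable_funeM; exact/borel_funP.
  by apply/funext => y; rewrite policy_semigroupZ.
- move=> f g f0 /borel_funP mf g0 /borel_funP mg IHf IHg.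
  rewrite (_ : policy_semigroup _ _ = fun y =>
     policy_semigroup s f y + policy_semigroup s g y).
    by apply/(borel_funP x); apply: emeasurable_funD; exact/borel_funP.
  by apply/funext => y; rewrite policy_semigroupD.
- move=> f_ f0 mf ndf IH.
  have bf n : borel_fun (f_ n : S -> \bar R) by exact/borel_funP.
  apply/(borel_funP x); apply: (@emeasurable_fun_cvg _ (borel_space x) R setT (fun n => policy_semigroup s (f_ n))).
    by move=> n; exact/borel_funP.
  move=> y _; rewrite policy_semigroup_lim //; apply: ereal_nondecreasing_is_cvgn.
  move=> n m nm; apply: le_policy_semigroup => // z; exact: ndf.
Qed.

Lemma markov_integral x E s t u : domain pb x -> (0 <= s)%R -> (0 <= t)%R ->
  past (Z' x) t E -> measurable E -> (forall y, 0 <= u y) -> borel_fun u ->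
  \int[Prob (bas x)]_(w in E) u (Z' x (t + s)%R w) =
  \int[Prob (bas x)]_(w in E) policy_semigroup s u (Z' x t w).
Proof.
move=> Dx s0 t0 pE mE u0 bu.
have ts0 : (0 <= t + s)%R by exact: addr_ge0.
move/(borel_funP x) : bu => bu.
have mZ r (f : S -> \bar R) : (0 <= r)%R -> borel_fun f ->
    measurable_fun E (fun w => f (Z' x r w)).
  by move=> r0 bf; apply: measurable_funTS; exact: policy_measurable_comp.
pose Q (u : borel_space x -> \bar R) :=
  \int[Prob (bas x)]_(w in E) u (Z' x (t + s)%R w) =
  \int[Prob (bas x)]_(w in E) policy_semigroup s u (Z' x t w).
apply: (@ge0_measurable_ind _ _ (borel_space x) Q) => //; rewrite {}/Q.
- move=> B bB.
  transitivity (\int[Prob (bas x)]_(w in E) (\1_(Z' x (t + s)%R @^-1` B) w)%:E).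
    by apply: eq_integral => w _; rewrite !indicE.
  have [mX sX] := policy_measurable Dx.
  rewrite integral_indic //; last exact: (@measurable_stopped_preimage _ _ _ _ _ _ mX sX).
  transitivity (Prob (bas x) (E `&` Z' x (t + s)%R @^-1` B)).
    by congr (Prob _ _); rewrite setIC.
  rewrite (pol_markov Dx s0 t0 bB pE).
  by apply: eq_integral => w _; rewrite policy_semigroup_indic.
- move=> k f k0 f0 /borel_funP mf IH; rewrite ge0_integralZl //; last exact: mZ.
  under [RHS]eq_integral do rewrite policy_semigroupZ //.
  rewrite ge0_integralZl //; first by rewrite IH.
    by apply: mZ => //; exact: borel_policy_semigroup.
  by move=> w _; exact: policy_semigroup_ge0.
- move=> f g f0 /borel_funP mf g0 /borel_funP mg IHf IHg.
  rewrite ge0_integralD //; [|exact: mZ|exact: mZ].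
  under [RHS]eq_integral do rewrite policy_semigroupD //.
  rewrite ge0_integralD //; first by rewrite IHf IHg.
  + by move=> w _; exact: policy_semigroup_ge0.
  + by apply: mZ => //; exact: borel_policy_semigroup.
  + by move=> w _; exact: policy_semigroup_ge0.
  + by apply: mZ => //; exact: borel_policy_semigroup.
- move=> f_ f0 mf ndf IH.
  have bf n : borel_fun (f_ n : S -> \bar R) by exact/borel_funP.
  rewrite monotone_convergence //; [|by move=> n; exact: mZ].
  under [RHS]eq_integral do rewrite policy_semigroup_lim //.
  rewrite monotone_convergence //.
  + by congr (limn _); apply/funext.
  + by move=> n; apply: mZ => //; exact: borel_policy_semigroup.
  + by move=> n w _; exact: policy_semigroup_ge0.
  + move=> w _ n m nm; apply: le_policy_semigroup => // z; exact: ndf.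
Qed.

Lemma past_measurable b (Y : R -> Omega b -> S) t :
  (forall s B, (0 <= s)%R -> borel B -> measurable (Y s @^-1` B)) ->
  past Y t `<=` measurable.
Proof.
move=> mY; apply: smallest_sub; first exact: sigma_algebra_measurable.
by move=> _ [r [B [r0 _ bB ->]]]; exact: mY.
Qed.

Lemma state_past_measurable x t : domain pb x -> past (Z x) t `<=` measurable.
Proof.
move=> Dx; apply: past_measurable => s B s0 bB.
have [mX sX] := state_measurable Dx.
exact: (@measurable_stopped_preimage _ _ _ _ _ _ mX sX).
Qed.

Lemma policy_past_measurable x t : domain pb x -> past (Z' x) t `<=` measurable.
Proof.
move=> Dx; apply: past_measurable => s B s0 bB.
have [mX sX] := policy_measurable Dx.
exact: (@measurable_stopped_preimage _ _ _ _ _ _ mX sX).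
Qed.

(** The event and the integral are carried to the given process, the Markov property is applied
    there, and the result is carried back. *)
Lemma state_markov_integral x E s t u : domain pb x -> (0 <= s)%R -> (0 <= t)%R ->
  past (Z x) t E -> (forall y, 0 <= u y) -> borel_fun u ->
  \int[Prob (bas x)]_(w in E) u (Z x (t + s)%R w) =
  \int[Prob (bas x)]_(w in E) policy_semigroup s u (Z x t w).
Proof.
move=> Dx s0 t0 pE u0 bu.
have [mX sX] := state_measurable Dx; have [mX' sX'] := policy_measurable Dx.
have law : same_law pb (X x) (ctl_path (pol_control pi x))
    (sp_path (pol_process pi x)) (ctl_path (pol_control pi x)) := pol_law pi Dx.
have [E' pE' sE'] := past_same_event (ctl_path (pol_control pi x))
  (sp_path (pol_process pi x)) (ctl_path (pol_control pi x)) pE.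
have mE := state_past_measurable Dx pE.
have mE' := policy_past_measurable Dx pE'.
rewrite (integral_same_event mX sX mX' sX' law mE mE' sE') //; last exact: addr_ge0.
rewrite (markov_integral Dx s0 t0 pE' mE' u0 bu).
rewrite (integral_same_event mX sX mX' sX' law mE mE' sE') //.
- by move=> y; exact: policy_semigroup_ge0.
- exact: borel_policy_semigroup.
Qed.

(** The passage to the state process brings in the right-continuous paths that give regularity in
    time. *)
Lemma policy_semigroupE s u y : domain pb y -> (0 <= s)%R -> (forall y, 0 <= u y) ->
  borel_fun u -> policy_semigroup s u y = \int[Prob (bas y)]_w u (Z y s w).
Proof.
move=> Dy s0 u0 bu; rewrite /policy_semigroup asboolT //.
have [mX sX] := state_measurable Dy; have [mX' sX'] := policy_measurable Dy.
have law : same_law pb (X y) (ctl_path (pol_control pi y))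
    (sp_path (pol_process pi y)) (ctl_path (pol_control pi y)) := pol_law pi Dy.
by rewrite (integral_same_event mX sX mX' sX' law measurableT measurableT
  (same_event_setT _ _ _ _ _)).
Qed.

End PolicySemigroup.

(** * Separating opens, null sections and Tonelli *)

Lemma compact_separating_opens (R : realType) (A : metricType R) (a0 : A) :
  compact [set: A] -> exists U : nat -> set A, (forall k, open (U k)) /\
    forall a a', a <> a' -> exists k, U k a /\ ~ U k a'.
Proof.
move=> cA; have [u uP] := compact_dense_sequence a0 cA.
pose U k := let p := odflt (0%N, 0%N) (choice.unpickle k) in
            (ball (u p.2) p.1.+1%:R^-1)°.
exists U; split=> [k|a a' aa']; first exact: open_interior.
(* Two points in a common ball of radius at most half their distance would be closer to each other
   than they are. *)
have d0 : 0 < mdist a a' / 2 by rewrite divr_gt0 // mdist_gt0; apply/eqP.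
have [n _ /(_ n (leqnn _)) /= hn] := near_infty_natSinv_lt (PosNum d0).
have [i ai] := uP n a.
exists (choice.pickle (n, i)); rewrite /U choice.pickleK /=; split => // a'i.
have := ball_triangle (ball_sym (interior_subset ai)) (interior_subset a'i).
rewrite -metricType_numDomainType.ball_mdistE /= => h.
have : mdist a a' < mdist a a' / 2 + mdist a a' / 2.
  by apply: (lt_trans h); rewrite ltrD.
by rewrite -splitr ltxx.
Qed.

(** Tonelli for the indicator of N: the time integral of the probabilities of its sections is 0, and
    it equals the mean Lebesgue measure of the set of bad times. *)
Lemma null_sections {R : realType} (b : stochastic_basis R) (N : set (R * Omega b)) :
  measurable N -> (forall s, Prob b [set w | N (s, w)] = 0%E) ->
  {ae Prob b, forall w, {ae lebesgue_measure, forall s : R, ~ N (s, w)}}.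
Proof.
move=> mN N0.
have mI : measurable_fun setT (fun p : measurableTypeR R * Omega b => (\1_N p)%:E : \bar R).
  exact/measurable_EFinP.
have I0 (p : measurableTypeR R * Omega b) : (0 <= (\1_N p)%:E :> \bar R)%E by rewrite lee_fin.
have := @fubini_tonelli _ _ _ _ R (@lebesgue_measure R) (Prob b) _ mI I0.
have mN1 s : measurable [set w | N (s, w)].
  by have := measurable_xsection s mN; congr measurable; apply/seteqP; split => w;
    rewrite /xsection /= inE.
rewrite integral0_eq; last first.
  move=> s _; rewrite -[RHS](N0 s) -[in RHS](setIT [set w | N (s, w)]).
  by rewrite -integral_indic.
move=> /esym h.
have mG := @measurable_fun_fubini_tonelli_G _ _ _ _ R (@lebesgue_measure R) _ mI I0.
have hG : (\int[Prob b]_w `|fubini_G (@lebesgue_measure R) (fun p => (\1_N p)%:E) w| = 0)%E.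
  rewrite -[RHS]h; apply: eq_integral => w _.
  by rewrite gee0_abs //; exact: integral_ge0.
move/(ae_eq_integral_abs _ measurableT mG) : hG.
apply: filterS => w /(_ I) /= hw.
have mN2 : measurable_fun setT (fun s : measurableTypeR R => (\1_N (s, w))%:E : \bar R).
  exact: measurableT_comp mI _.
have : (\int[lebesgue_measure]_s `|(\1_N (s, w))%:E| = 0)%E.
  by rewrite -[RHS]hw; apply: eq_integral => s _; rewrite gee0_abs.
move/(ae_eq_integral_abs _ measurableT mN2).
apply: filterS => s /(_ I) /=; rewrite indicE => -[] + Ns.
by rewrite mem_set //= => /eqP; rewrite oner_eq0.
Qed.

Section FubiniRestrict.
Context {R : realType} {d : measure_display} {T : measurableType d}.
Variable P : probability T R.
Local Open Scope ereal_scope.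
Local Notation mu := (@lebesgue_measure R).

Lemma fubini_restrict (I : set R) (E : set T) (F : R -> T -> \bar R) :
  measurable I -> measurable E ->
  (forall s w, I s -> E w -> 0 <= F s w) ->
  measurable_fun (I `*` E) (fun p : R * T => F p.1 p.2) ->
  \int[P]_(w in E) \int[mu]_(s in I) F s w =
  \int[mu]_(s in I) \int[P]_(w in E) F s w.
Proof.
move=> mI mE F0 mF.
pose f := (fun p : measurableTypeR R * T => F p.1 p.2) \_ (I `*` E).
have mf : measurable_fun setT f.
  by apply/(measurable_restrictT _ _).1 => //; exact: measurableX.
have f0 p : 0 <= f p.
  by rewrite /f patchE; case: ifPn => //; rewrite inE => -[? ?]; exact: F0.
have memX s w : ((s, w) \in I `*` E) = (s \in I) && (w \in E).
  by apply/idP/andP; rewrite !inE.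
have := @fubini_tonelli _ _ _ _ R mu P _ mf f0.
rewrite [X in _ = X -> _](_ : _ = \int[P]_(w in E) \int[mu]_(s in I) F s w); last first.
  rewrite [RHS]integral_mkcond; apply: eq_integral => w _.
  rewrite patchE; case: ifPn => wE.
    rewrite [RHS]integral_mkcond; apply: eq_integral => s _.
    by rewrite /f !patchE memX wE andbT.
  by rewrite integral0_eq // => s _; rewrite /f patchE memX (negbTE wE) andbF.
move=> <-; rewrite [RHS]integral_mkcond; apply: eq_integral => s _.
rewrite patchE; case: ifPn => sI.
  rewrite [RHS]integral_mkcond; apply: eq_integral => w _.
  by rewrite /f !patchE memX sI.
by rewrite integral0_eq // => w _; rewrite /f patchE memX (negbTE sI).
Qed.

End FubiniRestrict.

Section TimeIntegral.
Context {R : realType}.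
Local Open Scope ereal_scope.

Lemma time_beforeE (t : R) : time_before t%:E = `[0%R, t[%classic.
Proof.
apply/seteqP; split => s; rewrite /time_before /= in_itv /=.
  by move=> [s0 st]; rewrite s0 -lte_fin.
by move=> /andP[s0 st]; split => //; rewrite lte_fin.
Qed.

Lemma time_beforey : time_before +oo = `[0%R, +oo[%classic :> set R.
Proof.
apply/seteqP; split => s /=; rewrite in_itv /= andbT; first by case.
by move=> s0; split => //; rewrite ltry.
Qed.

Lemma measurable_time_before (T : \bar R) : measurable (time_before T).
Proof.
case: T => [r||]; [by rewrite time_beforeE; exact: measurable_itv|
  by rewrite time_beforey; exact: measurable_itv|].
rewrite (_ : time_before _ = set0) //; apply/seteqP; split => // s /= [_].
by rewrite ltNge leNye.
Qed.

Lemma time_before_ge0 (T : \bar R) s : time_before T s -> (0 <= s)%R.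
Proof. by case. Qed.

End TimeIntegral.

Section ProcessMeasurable.
Context {R : realType} {b : stochastic_basis R} {S : topologicalType}.
Variable Y : R -> Omega b -> S.
Hypothesis mY : measurable_process Y.

Lemma measurable_fun_process (I : set R) (E : set (Omega b)) (u : S -> \bar R) :
  (I `<=` [set s | 0 <= s]) -> measurable I -> measurable E -> borel_fun u ->
  measurable_fun (I `*` E) (fun p : R * Omega b => u (Y p.1 p.2)).
Proof.
move=> I0 mI mE bu mIE V mV.
rewrite (_ : _ `&` _ = (I `*` E) `&` [set p : R * Omega b | 0 <= p.1 /\ (u @^-1` V) (Y p.1 p.2)]).
  by apply: measurableI => //; apply: mY; exact: bu.
apply/seteqP; split => -[s w] /= [[Is Ew]]; first by split => //; split => //; exact: I0.
by case.
Qed.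

Lemma measurable_fun_path (I : set R) w (u : S -> \bar R) :
  (I `<=` [set s | 0 <= s]) -> measurable I -> borel_fun u ->
  measurable_fun I (fun s => u (Y s w)).
Proof.
move=> I0 mI bu _ V mV.
rewrite (_ : _ `&` _ = I `&` [set s | 0 <= s /\ (u @^-1` V) (Y s w)]).
  by apply: measurableI => //; apply: measurable_process_path => //; exact: bu.
by apply/seteqP; split => s /= [Is]; [split => //; split => //; exact: I0|case].
Qed.

End ProcessMeasurable.

Lemma borel_domain_comp {R : realType} {S : topologicalType} (D : set S) (h : S -> R) :
  open D -> {in D, continuous h} -> borel_fun (EFin \o (h \_ D)).
Proof.
move=> oD ch; apply: borel_fun_pointed => x; apply/(borel_funP x); apply/measurable_EFinP.
have bD : measurable (D : set (borel_space x)) by exact: open_borel.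
apply: (@measurable_restrictT _ _ (borel_space x) _ D h bD).1.
have mB (B : set S) : borel B -> measurable (D `&` id @^-1` B : set (borel_space x)).
  by move=> bB; exact: measurableI.
exact: (@measurable_preimage_domain _ _ D oD _ (borel_space x) D id h mB (fun w => id) ch).
Qed.

Lemma borel_notin_domain {R : realType} {S : topologicalType} (D : set S) (h : S -> R) :
  open D -> continuous h -> borel_fun (EFin \o (h \_ (~` D))).
Proof.
move=> oD ch; apply: borel_fun_pointed => x; apply/(borel_funP x); apply/measurable_EFinP.
have bD : measurable (D : set (borel_space x)) by exact: open_borel.
apply: (@measurable_restrictT _ _ (borel_space x) _ _ h (measurableC bD)).1; apply: measurable_funTS.
have mB (B : set S) : borel B -> measurable (setT `&` id @^-1` B : set (borel_space x)).
  by rewrite setTI.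
exact: (@measurable_preimage_domain _ _ setT openT _ (borel_space x) setT id h mB
  (fun w => id) (fun y _ => ch y)).
Qed.

(** * Time integrals and terminal reward along a controlled pair *)

Section PathIntegral.
Context {R : realType} {S : topologicalType} {A : metricType R}.
Variables (pb : control_problem S A) (b : stochastic_basis R).
Variables (X : R -> Omega b -> S) (Pi : R -> Omega b -> A).
Hypothesis mX : measurable_process X.
Hypothesis rX : Defs.right_continuous X.
Hypothesis mPi : measurable_process Pi.
Local Notation D := (domain pb).
Local Notation tau := (exit pb X).
Local Notation Z := (stopped X tau).
Local Notation mu := (@lebesgue_measure R).

Lemma measurable_path_integrand (F : S -> A -> R) (T : \bar R) w :
  {within D `*` [set: A], continuous (fun p => F p.1 p.2)} ->
  (T <= tau w)%E ->
  measurable_fun (time_before T) (fun s => F (X s w) (Pi s w)).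
Proof.
move=> cF Ttau.
have mI (B : topologicalType) (Y : R -> Omega b -> B) (mY : measurable_process Y) C :
    borel C -> measurable (time_before T `&` (Y ^~ w) @^-1` C).
  move=> bC; rewrite (_ : _ `&` _ = time_before T `&` [set s | 0 <= s /\ C (Y s w)]).
    apply: measurableI; first exact: measurable_time_before.
    exact: (@measurable_process_path _ _ _ Y w C mY bC).
  apply/seteqP; split => s /= [Ts]; last by case.
  by split => //; split => //; exact: time_before_ge0 Ts.
apply: (@measurable_caratheodory _ _ _ D F (domain_open pb) cF _ _ _ (X ^~ w) (Pi ^~ w)).
- exact: A_compact pb.
- exact: measurable_time_before.
- exact: mI.
- exact: mI.
- move=> s [s0 sT]; apply: before_exit => //; exact: lt_le_trans Ttau.
Qed.

Variable pi : S -> A.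
Hypothesis cpi : continuous pi.

Lemma feedback_integrand_continuous (F : S -> A -> R) :
  {within D `*` [set: A], continuous (fun p => F p.1 p.2)} ->
  {in D, continuous (fun y => F y (pi y))}.
Proof.
move=> cF y; rewrite inE => Dy.
apply: (@continuous_comp _ _ _ (fun y => (y, pi y)) (fun p => F p.1 p.2)).
  apply: cvg_pair => //; exact: cpi.
exact: (continuous_at_domain (domain_open pb) cF).
Qed.

(* Vanishing outside D, it does not contribute to time integrals after the exit. *)
Definition feedback_fun (F : S -> A -> R) : S -> R := (fun y => F y (pi y)) \_ D.

Lemma borel_feedback_fun (F : S -> A -> R) :
  {within D `*` [set: A], continuous (fun p => F p.1 p.2)} ->
  borel_fun (EFin \o feedback_fun F).
Proof.
move=> cF; apply: borel_domain_comp; first exact: domain_open.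
exact: feedback_integrand_continuous.
Qed.

(** Almost every time is enough for time integrals, and it is what equality of laws at fixed times
    can deliver. *)
Definition follows (w : Omega b) : Prop :=
  {ae mu, forall s : R, 0 <= s -> (s%:E < tau w)%E -> Pi s w = pi (X s w)}.

Hypothesis sX : stopping_time tau.

Lemma feedback_integral (F : S -> A -> R) (T : \bar R) w :
  {within D `*` [set: A], continuous (fun p => F p.1 p.2)} ->
  (T <= tau w)%E -> follows w ->
  (\int[mu]_(s in time_before T) (F (X s w) (Pi s w))%:E =
   \int[mu]_(s in time_before T) (feedback_fun F (Z s w))%:E)%E.
Proof.
move=> cF Ttau fw; apply: ae_eq_integral.
- exact: measurable_time_before.
- by apply/measurable_EFinP; exact: measurable_path_integrand.
- have mZ := measurable_process_stopped sX mX.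
  apply: (@measurable_fun_path _ _ _ _ mZ _ w (EFin \o feedback_fun F)).
  + by move=> s /time_before_ge0.
  + exact: measurable_time_before.
  + exact: borel_feedback_fun.
apply: (@filterS _ _ (ae_filter_ringOfSetsType mu) _ _ _ fw) => s fs [s0 sT].
have st : (s%:E < tau w)%E by exact: lt_le_trans Ttau.
rewrite fs // stopped_before ?ltW // /feedback_fun patchE mem_set //.
exact: before_exit.
Qed.

Lemma feedback_fun_after (F : S -> A -> R) s w : 0 <= s -> (tau w <= s%:E)%E ->
  feedback_fun F (Z s w) = 0.
Proof.
move=> s0 ts; rewrite /feedback_fun patchE ifF //; apply/negbTE; rewrite notin_setE.
by move=> /(stopped_in (domain_open pb) rX w s0); rewrite ltNge ts.
Qed.

(** The integrand vanishes after the exit, so the random bound min(T, tau) may be replaced by T;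
    what remains is a functional of [Z] over a deterministic interval, to which Tonelli and the
    Markov property apply. *)
Lemma feedback_integral_stopped (F : S -> A -> R) (T : \bar R) w :
  (\int[mu]_(s in time_before (mine T (tau w))) (feedback_fun F (Z s w))%:E =
   \int[mu]_(s in time_before T) (feedback_fun F (Z s w))%:E)%E.
Proof.
rewrite integral_mkcond [RHS]integral_mkcond; apply: eq_integral => s _.
rewrite !patchE; have [|/negP] := boolP (s \in time_before T).
  rewrite inE => -[s0 sT]; case: ifPn => //.
  rewrite notin_setE => h; rewrite feedback_fun_after //.
  rewrite leNgt; apply/negP => st; apply: h; split => //.
  by rewrite lt_min sT.
rewrite inE => h; rewrite ifF //; apply/negbTE; rewrite notin_setE => -[s0].
by rewrite lt_min => /andP[sT _]; apply: h.
Qed.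

Local Notation g := (EFin \o (terminal pb \_ (~` D))).

Lemma exit_reward_after s w : (tau w <= s%:E)%E -> g (Z s w) = terminal_payoff pb X w.
Proof.
move=> ts; have toy : (tau w < +oo)%E by apply: (le_lt_trans ts); rewrite ltry.
rewrite /= /terminal_payoff toy stopped_after // patchE mem_set //=.
exact: (first_exit_notin (domain_open pb) rX).
Qed.

Lemma exit_reward_before s w : 0 <= s -> (s%:E < tau w)%E -> g (Z s w) = 0%E.
Proof.
move=> s0 st; rewrite /= patchE ifF //; apply/negbTE; rewrite notin_setE /= => /(_ _).
by apply; apply/stopped_in => //; exact: domain_open.
Qed.

(** The value is 0 before the exit and a constant nonnegative reward afterwards. Monotonicity
    presents the terminal payoff as an increasing limit of functions of [Z] at fixed times, which
    the semigroup can handle. *)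
Lemma exit_reward_homo s r w : 0 <= s -> s <= r -> (g (Z s w) <= g (Z r w))%E.
Proof.
move=> s0 sr; have [ts|st] := leP (tau w) s%:E.
  by rewrite !exit_reward_after //; apply: (le_trans ts); rewrite lee_fin.
rewrite exit_reward_before // lee_fin patchE; case: ifPn => // _.
exact: terminal_ge0.
Qed.

Lemma exit_reward_lim t w : 0 <= t ->
  limn (fun n : nat => g (Z (t + n%:R) w)) = terminal_payoff pb X w.
Proof.
move=> t0; apply/cvg_lim => //; have [toy|] := ltP (tau w) +oo%E.
  apply: cvg_near_cst; near=> n; apply: exit_reward_after.
  have tf : tau w \is a fin_num by rewrite ge0_fin_numE // first_exit_ge0.
  rewrite -(fineK tf) lee_fin; apply: ler_wpDl => //; near: n; exact: nbhs_infty_ger.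
rewrite leye_eq => /eqP tE; apply: cvg_near_cst; apply: nearW => n.
by rewrite exit_reward_before ?addr_ge0 ?tE ?ltry // /terminal_payoff tE ltxx.
Unshelve. all: by end_near. Qed.

End PathIntegral.

Section PolicyFollows.
Context {R : realType} {S : topologicalType} {A : metricType R}.
Variables (pb : control_problem S A) (pi : markov_policy pb).
Hypothesis cpi : continuous (pi : S -> A).
Local Notation bas y := (sp_basis (pol_process pi y)).
Local Notation Pi y := (ctl_path (pol_control pi y)).
Local Notation X y := (state pb y (pol_control pi y)).
Local Notation Z y := (stopped (X y) (exit pb (X y))).

Lemma policy_control_measurable x : domain pb x -> measurable_process (Pi x).
Proof. by move=> /(@pol_admissible _ _ _ _ pi) [[]]. Qed.

(* X is only some state process of the control Pi = pi(X^pi); that Pi = pi(X) almost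
   everywhere before the exit is read off the common law, through countably many opens
   separating the points of A. *)
Lemma policy_follows x : domain pb x ->
  {ae Prob (bas x), forall w, follows pb (X x) (Pi x) pi w}.
Proof.
move=> Dx.
have [mX sX] := state_measurable pi Dx; have [mX' sX'] := policy_measurable pi Dx.
have mPi := policy_control_measurable Dx.
have [U [oU sepU]] := compact_separating_opens (pi x) (A_compact pb).
(* The states whose prescribed action avoids [U k]; continuity of [pi] makes this set Borel. In [N]
   below, some [U k] contains the actual action but not the prescribed one. *)
pose V k := (pi : S -> A) @^-1` (~` U k).
have bU k : borel (U k) by exact: open_borel.
have bV k : borel (V k).
  rewrite /V -preimage_setC; apply: (sigma_algebra_setC (@sigma_algebra_generated _ _)).
  by apply: open_borel; apply: open_comp => // y _; exact: cpi.
pose Pis := stopped (Pi x) (exit pb (X x)).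
have mZ := measurable_process_stopped sX mX.
have mPis : measurable_process Pis by exact: measurable_process_stopped.
pose N := \bigcup_k ([set p : R * Omega (bas x) | 0 <= p.1 /\ U k (Pis p.1 p.2)] `&`
                     [set p : R * Omega (bas x) | 0 <= p.1 /\ V k (Z x p.1 p.2)]).
have mN : measurable N.
  apply: bigcup_measurable => k _; apply: measurableI; [exact: mPis|exact: mZ].
have N0 s : Prob (bas x) [set w | N (s, w)] = 0%E.
  have [s0|s0] := ltP s 0.
    rewrite (_ : [set _ | _] = set0) ?measure0 //.
    by apply/seteqP; split => // w /= [k _ [[/= h _] _]]; move: s0; rewrite ltNge h.
  (* For the given process the control is pi(X) by definition, so the corresponding event is
     empty. *)
  have se : same_event pb (X x) (Pi x) (sp_path (pol_process pi x)) (Pi x)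
      [set w | N (s, w)] set0.
    exists (\bigcup_k ([set w | [set: S] (w s).1 /\ U k (w s).2] `&`
                       [set w | V k (w s).1 /\ [set: A] (w s).2])).
    split.
    - have [_ _] := @sigma_algebra_generated (R -> S * A)
        [set G | exists t B C, [/\ 0 <= t, borel B, borel C &
          G = [set w | B (w t).1 /\ C (w t).2]]].
      apply => k; apply: (sigma_algebra_setI (@sigma_algebra_generated _ _)).
        by apply: sub_gen_smallest; exists s, setT, (U k); split => //; exact: borel_setT.
      by apply: sub_gen_smallest; exists s, (V k), setT; split => //; exact: borel_setT.
    - by apply/seteqP; split => w [k _ [[/= h1 h2] [h3 h4]]]; exists k.
    - by apply/seteqP; split => // w [k _ [[/= _ h] [h' _]]]; apply: h'.
  by rewrite (same_event_prob (pol_law pi Dx) se) measure0.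
have := null_sections mN N0.
apply: filterS => w hw.
apply: (@filterS _ _ (ae_filter_ringOfSetsType (@lebesgue_measure R)) _ _ _ hw).
move=> s nN s0 st; apply: contrapT => neq; apply: nN.
have [k [Uk nUk]] := sepU _ _ neq.
exists k => //; split; split => //=.
- by rewrite /Pis /stopped min_l ?ltW.
- by rewrite stopped_before ?ltW.
Qed.

End PolicyFollows.

Section PolicyValue.
Context {R : realType} {S : topologicalType} {A : metricType R}.
Variables (pb : control_problem S A) (pi : markov_policy pb).
Hypothesis cpi : continuous (pi : S -> A).
Local Open Scope ereal_scope.
Local Notation D := (domain pb).
Local Notation bas y := (sp_basis (pol_process pi y)).
Local Notation Pi y := (ctl_path (pol_control pi y)).
Local Notation X y := (state pb y (pol_control pi y)).
Local Notation Z y := (stopped (X y) (exit pb (X y))).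
Local Notation mu := (@lebesgue_measure R).

Definition running_rate : S -> \bar R := EFin \o feedback_fun pb pi (running pb).
Definition exit_reward : S -> \bar R := EFin \o (terminal pb \_ (~` D)).

Lemma running_within : {within D `*` [set: A], continuous (fun p => running pb p.1 p.2)}.
Proof. exact/continuous_subspaceT/running_continuous. Qed.

Lemma borel_running_rate : borel_fun running_rate.
Proof. exact: borel_feedback_fun running_within. Qed.

Lemma borel_exit_reward : borel_fun exit_reward.
Proof.
apply: borel_notin_domain; [exact: domain_open|exact: terminal_continuous].
Qed.

Lemma running_rate_ge0 y : 0 <= running_rate y.
Proof.
by rewrite lee_fin /feedback_fun patchE; case: ifPn => // _; exact: running_ge0.
Qed.

Lemma exit_reward_ge0 y : 0 <= exit_reward y.
Proof. by rewrite lee_fin patchE; case: ifPn => // _; exact: terminal_ge0. Qed.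

Lemma state_right_continuous x : D x -> Defs.right_continuous (X x).
Proof. by move=> /(policy_stateP pi) [[]]. Qed.

(** Right-continuity of the paths of [Z], with the constant [M] as dominating function. *)
Lemma policy_semigroup_cvg (h : S -> R) (M : R) (s : R) y :
  {in D, continuous h} -> (forall y, 0 <= h y <= M)%R -> (0 <= s)%R ->
  policy_semigroup pi (next_grid n s) (EFin \o (h \_ D)) y @[n --> \oo] -->
  policy_semigroup pi s (EFin \o (h \_ D)) y.
Proof.
move=> ch hM s0.
have bh : borel_fun (EFin \o (h \_ D)).
  by apply: borel_domain_comp => //; exact: domain_open.
have h0 z : 0 <= (EFin \o (h \_ D)) z.
  by rewrite lee_fin patchE; case: ifPn => // _; have /andP[] := hM z.
have M0 : (0 <= M)%R by have /andP[h1 h2] := hM y; exact: (le_trans h1 h2).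
have hle z : (EFin \o (h \_ D)) z <= M%:E.
  by rewrite lee_fin patchE; case: ifPn => // _; have /andP[] := hM z.
have g0 n : (0 <= next_grid n s)%R by exact: (le_trans s0 (ltW (next_grid_gt n s))).
have [Dy|nDy] := pselect (D y); last first.
  rewrite /policy_semigroup asboolF //; exact: cvg_cst.
rewrite policy_semigroupE //.
under eq_fun do rewrite policy_semigroupE //.
have [] // := @dominated_convergence _ _ _ (Prob (bas y)) setT measurableT
  (fun n w => (EFin \o (h \_ D)) (Z y (next_grid n s) w))
  (fun w => (EFin \o (h \_ D)) (Z y s w)) (cst M%:E).
- by move=> n; exact: state_measurable_comp.
- exact: state_measurable_comp.
- apply: aeW => w _.
  have := right_continuous_in_domain (state_right_continuous Dy) ch s0.
  move=> /(_ w) /(cvg_comp _ _ (cvg_next_grid s0)) hc.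
  by apply: (cvg_EFin (F := \oo)) => //; apply: nearW.
- exact: finite_measure_integrable_cst.
- by apply: aeW => w n _; rewrite gee0_abs.
Qed.

(** For a bounded rate the semigroup is Borel in the state and right-continuous in time, hence
    jointly measurable; the running reward is an increasing limit of such rates. *)
Lemma measurable_policy_semigroup (x : S) :
  measurable_fun (`[0%R, +oo[%classic `*` setT : set (R * borel_space x))
    (fun p : R * borel_space x => policy_semigroup pi p.1 running_rate p.2).
Proof.
(* Truncation at height n supplies the bound that [policy_semigroup_cvg] asks for. *)
pose F n y a := Num.min (running pb y a) n%:R.
pose h n y := F n y (pi y).
have cF n : {within D `*` [set: A], continuous (fun p => F n p.1 p.2)}.
  apply: continuous_subspaceT => p.
  apply: (@continuous_min _ _ (fun p : S * A => running pb p.1 p.2) (cst n%:R)).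
    exact: running_continuous.
  exact: cvg_cst.
have ch n : {in D, continuous (h n)} by exact: feedback_integrand_continuous (cF n).
have hM n y : (0 <= h n y <= n%:R)%R.
  by rewrite /h /F le_min running_ge0 ler0n ge_min lexx orbT.
have bh n : borel_fun (EFin \o (h n \_ D)).
  by apply: borel_domain_comp => //; exact: domain_open.
have h0 n z : 0 <= (EFin \o (h n \_ D)) z.
  by rewrite lee_fin patchE; case: ifPn => // _; have /andP[] := hM n z.
have ndh z : nondecreasing_seq (fun n => (EFin \o (h n \_ D)) z).
  move=> n m nm; rewrite lee_fin !patchE; case: ifPn => // _.
  by rewrite /h /F le_min ge_min lexx ge_min ler_nat nm orbT.
have rE : running_rate = (fun z => limn (fun n => (EFin \o (h n \_ D)) z)).
  apply/funext => z; apply/esym/cvg_lim => //; apply: cvg_near_cst.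
  near=> n; congr (_%:E); rewrite /feedback_fun !patchE; case: ifPn => // _.
  by rewrite /h /F; apply/min_idPl; near: n; exact: nbhs_infty_ger.
have mI : measurable (`[0%R, +oo[%classic `*` [set: borel_space x] : set (R * borel_space x)).
  by apply: measurableX => //; exact: measurable_itv.
apply: (@emeasurable_fun_cvg _ _ _ _
  (fun n (p : R * borel_space x) => policy_semigroup pi p.1 (EFin \o (h n \_ D)) p.2)).
  move=> n.
  have := @measurable_right_continuous R _ (borel_space x)
    (fun s y => policy_semigroup pi s (EFin \o (h n \_ D)) y).
  have ms s : (0 <= s)%R -> measurable_fun (setT : set (borel_space x))
      (fun y => policy_semigroup pi s (EFin \o (h n \_ D)) y).
    by move=> s0; apply/borel_funP; exact: borel_policy_semigroup.
  have cs y s (s0 : (0 <= s)%R) := @policy_semigroup_cvg (h n) n%:R s y (ch n) (hM n) s0.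
  move=> /(_ ms cs) mm; apply: (eq_measurable_fun _ _ (measurable_funTS mm)).
  by move=> [s y]; rewrite inE /= in_itv /= andbT => -[s0 _]; rewrite s0.
move=> [s y] /=; rewrite in_itv /= andbT => -[s0 _].
rewrite rE policy_semigroup_lim //.
apply: ereal_nondecreasing_is_cvgn => n m nm; apply: le_policy_semigroup => // z.
exact: ndh.
Unshelve. all: by end_near. Qed.

End PolicyValue.

(** * Dynamic programming *)

Section DynamicProgramming.
Context {R : realType} {S : topologicalType} {A : metricType R}.
Variables (pb : control_problem S A) (pi : markov_policy pb).
Hypothesis cpi : continuous (pi : S -> A).
Local Open Scope ereal_scope.
Local Notation D := (domain pb).
Local Notation bas y := (sp_basis (pol_process pi y)).
Local Notation Pi y := (ctl_path (pol_control pi y)).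
Local Notation X y := (state pb y (pol_control pi y)).
Local Notation tau y := (exit pb (X y)).
Local Notation Z y := (stopped (X y) (tau y)).
Local Notation mu := (@lebesgue_measure R).
Local Notation f := (running_rate pi).
Local Notation g := (exit_reward pb).

Definition occupation_cost (y : S) : \bar R :=
  \int[mu]_(s in `[0%R, +oo[) policy_semigroup pi s f y.

(** Integer times suffice, the exit reward being nondecreasing in time along [Z]. *)
Definition final_reward (y : S) : \bar R :=
  limn (fun n => policy_semigroup pi n%:R g y).

Definition total_running x (w : Omega (bas x)) : \bar R :=
  \int[mu]_(s in `[0%R, +oo[) f (Z x s w).

Definition running_until x (t : R) (w : Omega (bas x)) : \bar R :=
  \int[mu]_(s in `[0%R, t[) f (Z x s w).

Lemma running_payoffE x (T : \bar R) : D x ->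
  {ae Prob (bas x), forall w,
    running_payoff pb (Pi x) (X x) (mine T (tau x w)) w =
    \int[mu]_(s in time_before T) f (Z x s w)}.
Proof.
move=> Dx; have [mX sX] := state_measurable pi Dx.
have mPi : measurable_process (Pi x) := policy_control_measurable Dx.
apply: filterS (policy_follows cpi Dx) => w fw.
rewrite /running_payoff.
rewrite (feedback_integral mX mPi cpi sX (@running_within _ _ _ pb) _ fw) ?ge_min ?lexx ?orbT //.
exact: (feedback_integral_stopped pb (state_right_continuous Dx)).
Qed.

Lemma payoffE x : D x -> {ae Prob (bas x), forall w,
  payoff pb (Pi x) (X x) w =
  total_running w + limn (fun n => g (Z x n%:R w))}.
Proof.
move=> Dx; apply: filterS (running_payoffE +oo Dx) => w.
rewrite min_r ?leey // time_beforey => h.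
rewrite /payoff h; congr (_ + _).
rewrite -(exit_reward_lim pb (state_right_continuous Dx) w (lexx 0%R)).
by congr (limn _); apply/funext => n; rewrite add0r.
Qed.

Lemma stopped_measurable_process x : D x -> measurable_process (Z x).
Proof.
move=> Dx; have [mX sX] := state_measurable pi Dx.
exact: measurable_process_stopped.
Qed.

Lemma measurable_state_integral x (I : set R) : D x -> measurable I ->
  I `<=` [set s | (0 <= s)%R] ->
  measurable_fun setT (fun w => \int[mu]_(s in I) f (Z x s w)).
Proof.
move=> Dx mI I0.
have mf := measurable_fun_process (stopped_measurable_process Dx) I0 mI
  (@measurableT _ (Omega (bas x))) (borel_running_rate cpi).
have mIT : measurable (I `*` [set: Omega (bas x)]) by exact: measurableX.
move/(measurable_restrictT _ mIT) : mf => mf.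
have f0 (p : measurableTypeR R * Omega (bas x)) :
    0 <= ((fun p => f (Z x p.1 p.2)) \_ (I `*` setT)) p.
  by rewrite patchE; case: ifPn => // _; exact: running_rate_ge0.
have := @measurable_fun_fubini_tonelli_G _ _ (measurableTypeR R) (Omega (bas x)) R mu _ mf f0.
apply: eq_measurable_fun => w _; rewrite /fubini_G [RHS]integral_mkcond.
apply: eq_integral => s _; rewrite !patchE.
congr (if _ then _ else _); apply/idP/idP; rewrite !inE //=; by case.
Qed.

Lemma exit_reward_nd x w : D x -> nondecreasing_seq (fun n : nat => g (Z x n%:R w)).
Proof.
move=> Dx n m nm; apply: (exit_reward_homo pb (state_right_continuous Dx)) => //.
by rewrite ler_nat.
Qed.

Lemma measurable_exit_reward x (t : R) : D x -> (0 <= t)%R ->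
  measurable_fun setT (fun w => g (Z x t w)).
Proof.
by move=> Dx t0; apply: state_measurable_comp => //; exact: borel_exit_reward.
Qed.

Lemma measurable_final x : D x ->
  measurable_fun setT (fun w => limn (fun n => g (Z x n%:R w))).
Proof.
move=> Dx; apply: (emeasurable_fun_cvg (fun n w => g (Z x n%:R w))).
  by move=> n; exact: measurable_exit_reward.
by move=> w _; apply: ereal_nondecreasing_is_cvgn; exact: exit_reward_nd.
Qed.

Lemma total_running_ge0 x w : 0 <= @total_running x w.
Proof. by apply: integral_ge0 => s _; exact: running_rate_ge0. Qed.

Lemma final_ge0 x (w : Omega (bas x)) : D x -> 0 <= limn (fun n => g (Z x n%:R w)).
Proof.
move=> Dx; apply: lime_ge; last by apply: nearW => n; exact: exit_reward_ge0.
by apply: ereal_nondecreasing_is_cvgn; exact: exit_reward_nd.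
Qed.

(** Tonelli for the running part, monotone convergence for the terminal part. Both terms on the
    right are semigroup expressions, hence Borel in the starting point and accessible to the Markov
    property. *)
Lemma integral_payoff x : D x ->
  \int[Prob (bas x)]_w payoff pb (Pi x) (X x) w = occupation_cost x + final_reward x.
Proof.
move=> Dx.
have [_ _ _ [_ intJ _]] := policy_stateP pi Dx.
have mT : measurable_fun setT (@total_running x).
  apply: (@measurable_state_integral x `[0%R, +oo[%classic Dx (measurable_itv _)).
  by move=> s /=; rewrite in_itv /= andbT.
transitivity (\int[Prob (bas x)]_w (@total_running x w + limn (fun n => g (Z x n%:R w)))).
  apply: ae_eq_integral => //.
  - exact: measurable_int intJ.
  - by apply: emeasurable_funD => //; exact: measurable_final.
  - by apply: filterS (payoffE Dx) => w h _.
- rewrite ge0_integralD //.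
  + congr (_ + _).
      rewrite /total_running fubini_restrict //.
      * apply: eq_integral => s; rewrite inE /= in_itv /= andbT => s0.
        by rewrite policy_semigroupE //; [move=> y; exact: running_rate_ge0|exact: (borel_running_rate cpi)].
      * by move=> s w _ _; exact: running_rate_ge0.
      * apply: (measurable_fun_process (stopped_measurable_process Dx)) => //.
          by move=> s /=; rewrite in_itv /= andbT.
        exact: (borel_running_rate cpi).
    rewrite monotone_convergence //.
    * congr (limn _); apply/funext => n; rewrite policy_semigroupE //.
        by move=> y; exact: exit_reward_ge0.
      exact: borel_exit_reward.
    * by move=> n; exact: measurable_exit_reward.
    * by move=> n w _; exact: exit_reward_ge0.
    * by move=> w _; exact: exit_reward_nd.
  + by move=> w _; exact: total_running_ge0.
  + by move=> w _; exact: final_ge0.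
  + exact: measurable_final.
Qed.

(** [fine] loses nothing, since the payoff is integrable. Outside D the running part vanishes and
    the absorbed point earns its terminal reward, so the formula may be evaluated at [Z] before and
    after the exit. *)
Lemma policy_valueE y : (policy_value pi y)%:E = occupation_cost y + final_reward y.
Proof.
have [Dy|nDy] := pselect (D y).
  have [_ _ _ [_ intJ _]] := policy_stateP pi Dy.
  rewrite /policy_value asboolT // -integral_payoff // fineK //.
  exact: integrable_fin_num intJ.
rewrite /policy_value asboolF // /occupation_cost /final_reward.
rewrite integral0_eq; last first.
  move=> s _; rewrite /policy_semigroup asboolF // /running_rate /= /feedback_fun patchE.
  by rewrite ifF //; apply/negbTE; rewrite notin_setE.
rewrite add0e /policy_semigroup asboolF // lim_cst //.
by rewrite /exit_reward /= patchE mem_set.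
Qed.

Lemma policy_value_ge0 y : (0 <= policy_value pi y)%R.
Proof.
have [Dy|nDy] := pselect (D y); last first.
  by rewrite /policy_value asboolF //; exact: terminal_ge0.
rewrite -lee_fin policy_valueE -integral_payoff //.
apply: integral_ge0 => w _; apply: adde_ge0.
  by apply: integral_ge0 => s _; rewrite lee_fin running_ge0.
by rewrite /terminal_payoff; case: ifP => // _; rewrite lee_fin terminal_ge0.
Qed.

Lemma borel_occupation_cost : borel_fun occupation_cost.
Proof.
apply: borel_fun_pointed => x; apply/(borel_funP x).
have mf : measurable_fun (`[0%R, +oo[%classic `*` setT : set (R * borel_space x))
    (fun p => policy_semigroup pi p.1 f p.2) := measurable_policy_semigroup cpi (x := x).
have mIT : measurable (`[0%R, +oo[%classic `*` setT : set (R * borel_space x)).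
  by apply: measurableX => //; exact: measurable_itv.
move/(measurable_restrictT _ mIT) : mf => mf.
have f0 (p : measurableTypeR R * borel_space x) :
    0 <= ((fun p => policy_semigroup pi p.1 f p.2) \_ (`[0%R, +oo[%classic `*` setT)) p.
  rewrite patchE; case: ifPn => // _; apply: policy_semigroup_ge0 => z.
  exact: running_rate_ge0.
have := @measurable_fun_fubini_tonelli_G _ _ (measurableTypeR R) (borel_space x) R mu _ mf f0.
apply: eq_measurable_fun => w _; rewrite /fubini_G [RHS]integral_mkcond.
apply: eq_integral => s _; rewrite !patchE.
congr (if _ then _ else _); apply/idP/idP; rewrite !inE //=; by case.
Qed.

Lemma policy_semigroup_exit_nd y :
  nondecreasing_seq (fun n : nat => policy_semigroup pi n%:R g y).
Proof.
move=> n m nm; have [Dy|nDy] := pselect (D y); last first.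
  by rewrite /policy_semigroup asboolF.
have bg := @borel_exit_reward _ _ _ pb.
have g0 z : 0 <= g z by exact: exit_reward_ge0.
rewrite !policy_semigroupE //.
apply: ge0_le_integral => //; try exact: measurable_exit_reward.
by move=> w _; exact: exit_reward_nd.
Qed.

Lemma borel_semigroup_exit (n : nat) : borel_fun (policy_semigroup pi n%:R g).
Proof.
apply: borel_policy_semigroup => //; last exact: borel_exit_reward.
by move=> z; exact: exit_reward_ge0.
Qed.

Lemma borel_final_reward : borel_fun final_reward.
Proof.
apply: borel_fun_pointed => x; apply/(borel_funP x).
apply: (@emeasurable_fun_cvg _ (borel_space x) R setT (fun n => policy_semigroup pi n%:R g)).
  by move=> n; apply/borel_funP; exact: borel_semigroup_exit.
move=> y _; apply: ereal_nondecreasing_is_cvgn; exact: policy_semigroup_exit_nd.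
Qed.

Lemma borel_policy_value : borel_fun (EFin \o policy_value pi).
Proof.
apply: borel_fun_pointed => x; apply/(borel_funP x).
rewrite (_ : EFin \o _ = fun y => occupation_cost y + final_reward y).
  apply: emeasurable_funD; apply/borel_funP.
    exact: borel_occupation_cost.
  exact: borel_final_reward.
by apply/funext => y; exact: policy_valueE.
Qed.

Lemma occupation_cost_ge0 y : 0 <= occupation_cost y.
Proof.
apply: integral_ge0 => s _; apply: policy_semigroup_ge0 => z.
exact: running_rate_ge0.
Qed.

Lemma final_reward_ge0 y : 0 <= final_reward y.
Proof.
apply: lime_ge; first by apply: ereal_nondecreasing_is_cvgn; exact: policy_semigroup_exit_nd.
apply: nearW => n; apply: policy_semigroup_ge0 => z; exact: exit_reward_ge0.
Qed.

(** Tonelli puts the time integral outside, the Markov property turns the semigroup at [Z t] into a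
    later value of [Z], and translation moves the interval to [t, +oo). *)
Lemma integral_occupation_cost x t E : D x -> (0 <= t)%R -> past (Z x) t E ->
  \int[Prob (bas x)]_(w in E) occupation_cost (Z x t w) =
  \int[Prob (bas x)]_(w in E) \int[mu]_(s in `[t, +oo[) f (Z x s w).
Proof.
move=> Dx t0 pE.
have mE : measurable E := state_past_measurable Dx pE.
have f0 z : 0 <= f z by exact: running_rate_ge0.
have bf := borel_running_rate cpi.
have mI : measurable (`[0%R, +oo[%classic : set R) by exact: measurable_itv.
rewrite /occupation_cost.
rewrite (@fubini_restrict _ _ _ _ `[0%R, +oo[%classic E
  (fun s w => policy_semigroup pi s f (Z x t w))) //.
- rewrite (_ : \int[Prob (bas x)]_(w in E) _ =
    \int[Prob (bas x)]_(w in E) \int[mu]_(s in `[0%R, +oo[) f (Z x (t + s)%R w)).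
    rewrite (@fubini_restrict _ _ _ _ `[0%R, +oo[%classic E
      (fun s w => f (Z x (t + s)%R w))) //.
      apply: eq_integral => s; rewrite inE /= in_itv /= andbT => s0.
      by rewrite state_markov_integral.
    move=> _ V mV.
    have mZ := stopped_measurable_process Dx.
    have mt : measurable_fun (setT : set (R * Omega (bas x))) (fun p => ((t + p.1)%R, p.2)).
      by apply: measurable_fun_pair => //; exact: measurable_funD.
    rewrite (_ : _ `&` _ = (`[0%R, +oo[%classic `*` E) `&`
       (fun p : R * Omega (bas x) => ((t + p.1)%R, p.2)) @^-1`
       [set p | (0 <= p.1)%R /\ (f @^-1` V) (Z x p.1 p.2)]).
      apply: measurableI; first exact: measurableX.
      rewrite -[U in measurable U]setTI; apply: mt => //; apply: mZ; exact: bf.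
    apply/seteqP; split => -[s w] /= [[]]; rewrite in_itv /= andbT => s0 Ew.
      by move=> h; split => //; split => //; exact: addr_ge0.
    by case.
  apply: eq_integral => w _.
  have mfZ : measurable_fun setT ((fun s => f (Z x s w)) \_ `[0%R, +oo[%classic : R -> \bar R).
    apply: (measurable_restrictT (fun s : R => f (Z x s w)) mI).1.
    have I0 : `[0%R, +oo[%classic `<=` [set s : R | (0 <= s)%R].
      by move=> s /=; rewrite in_itv /= andbT.
    exact: (measurable_fun_path (stopped_measurable_process Dx) w I0 mI bf).
  have p0 s : 0 <= ((fun s => f (Z x s w)) \_ `[0%R, +oo[%classic : R -> \bar R) s.
    by rewrite patchE; case: ifPn.
  have := ge0_integral_translation t mfZ p0.
  rewrite (_ : \int[mu]_(s in `[t, +oo[) _ = \int[mu]_(s in `[t, +oo[) f (Z x s w)).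
    move=> <-; apply: eq_integral => s; rewrite inE /= in_itv /= andbT => s0.
    by rewrite patchE mem_set //= in_itv /= andbT addr_ge0.
  apply: eq_integral => s; rewrite inE /= in_itv /= andbT => ts.
  by rewrite patchE mem_set //= in_itv /= andbT (le_trans t0).
- by move=> s w _ _; exact: policy_semigroup_ge0.
- have mf : measurable_fun (`[0%R, +oo[%classic `*` setT : set (R * borel_space x))
    (fun p => policy_semigroup pi p.1 f p.2) := measurable_policy_semigroup cpi (x := x).
  move=> _ V mV.
  have mZt : measurable_fun (setT : set (R * Omega (bas x)))
      (fun p => (p.1, Z x t p.2 : borel_space x)).
    apply: measurable_fun_pair => //; apply: measurableT_comp => // _ B mB.
    rewrite setTI; apply: measurable_process_at => //.
    exact: stopped_measurable_process.
  have mIT : measurable (`[0%R, +oo[%classic `*` setT : set (R * borel_space x)).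
    by apply: measurableX.
  have := mZt measurableT _ (mf mIT V mV).
  rewrite setTI => h.
  rewrite (_ : _ `&` _ = (`[0%R, +oo[%classic `*` E) `&`
     ((fun p : R * Omega (bas x) => (p.1, Z x t p.2 : borel_space x)) @^-1`
      ((`[0%R, +oo[%classic `*` setT) `&`
       (fun p : R * borel_space x => policy_semigroup pi p.1 f p.2) @^-1` V))).
    by apply: measurableI => //; exact: measurableX.
  apply/seteqP; split => -[s w] /= [[s0 Ew]]; first by [].
  by case.
Qed.

(** The Markov property produces the limit along the times t + n, which is the same terminal payoff
    as along the times n. *)
Lemma integral_final_reward x t E : D x -> (0 <= t)%R -> past (Z x) t E ->
  \int[Prob (bas x)]_(w in E) final_reward (Z x t w) =
  \int[Prob (bas x)]_(w in E) limn (fun n => g (Z x n%:R w)).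
Proof.
move=> Dx t0 pE.
have mE : measurable E := state_past_measurable Dx pE.
have bg := @borel_exit_reward _ _ _ pb.
have g0 z : 0 <= g z by exact: exit_reward_ge0.
rewrite /final_reward monotone_convergence //; first last.
- by move=> w _; exact: policy_semigroup_exit_nd.
- by move=> n w _; exact: policy_semigroup_ge0.
- move=> n; apply: measurable_funTS; apply: state_measurable_comp => //.
  exact: borel_semigroup_exit.
under [in LHS]eq_fun do rewrite -state_markov_integral //.
transitivity (\int[Prob (bas x)]_(w in E) limn (fun n => g (Z x (t + n%:R)%R w))).
  rewrite monotone_convergence //.
  - move=> n; apply: measurable_funTS; apply: measurable_exit_reward => //.
    exact: addr_ge0.
  - move=> w _ n m nm; apply: (exit_reward_homo pb (state_right_continuous Dx)).
      exact: addr_ge0.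
    by rewrite lerD2l ler_nat.
apply: eq_integral => w _.
rewrite (exit_reward_lim pb (state_right_continuous Dx)) //.
rewrite -(exit_reward_lim pb (state_right_continuous Dx) w (lexx 0%R)).
by congr (limn _); apply/funext => n; rewrite add0r.
Qed.

(** Cost until t plus expected remainder gives the total. It is written without subtraction, with a
    right-hand side free of t: this is the martingale property in a form that makes sense for
    infinite integrals. *)
Lemma dynamic_programming x t E : D x -> (0 <= t)%R -> past (Z x) t E ->
  \int[Prob (bas x)]_(w in E) (policy_value pi (Z x t w))%:E +
  \int[Prob (bas x)]_(w in E) running_until t w =
  \int[Prob (bas x)]_(w in E) total_running w +
  \int[Prob (bas x)]_(w in E) limn (fun n => g (Z x n%:R w)).
Proof.
move=> Dx t0 pE.
have mE : measurable E := state_past_measurable Dx pE.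
have mI b : measurable [set` Interval (BSide b t : itv_bound R) +oo%O].
  exact: measurable_itv.
under eq_integral do rewrite policy_valueE.
rewrite ge0_integralD //.
- rewrite integral_occupation_cost // integral_final_reward //.
  rewrite addeAC; congr (_ + _).
  rewrite -ge0_integralD //.
  + apply: eq_integral => w _; rewrite /total_running /running_until addeC.
    rewrite -ge0_integral_setU //.
    * congr (integral _ _ _); apply/seteqP; split => s /=; rewrite !in_itv /= ?andbT.
        by case=> [/andP[]|] // ts; exact: le_trans ts.
      by move=> s0; have [st|ts] := ltP s t; [left; rewrite s0|right].
    * have I0 : (`[0%R, t[%classic `|` `[t, +oo[%classic) `<=` [set s : R | (0 <= s)%R].
        move=> s /= [|]; rewrite in_itv /= ?andbT; first by case/andP.
        by move=> ts; exact: (le_trans t0 ts).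
      apply: (measurable_fun_path (stopped_measurable_process Dx) w I0).
        by apply: measurableU; exact: measurable_itv.
      exact: (borel_running_rate cpi).
    * by move=> s _; exact: running_rate_ge0.
    * apply/disj_setPS => s /= []; rewrite !in_itv /= andbT => /andP[_ st] ts.
      by move: st; rewrite ltNge ts.
  + by move=> w _; apply: integral_ge0 => s _; exact: running_rate_ge0.
  + apply: measurable_funTS; apply: measurable_state_integral => //.
    by move=> s /=; rewrite in_itv /= andbT => ts; exact: (le_trans t0 ts).
  + by move=> w _; apply: integral_ge0 => s _; exact: running_rate_ge0.
  + apply: measurable_funTS; apply: measurable_state_integral => //.
    by move=> s /=; rewrite in_itv /= => /andP[].
- by move=> w _; exact: occupation_cost_ge0.
- apply: measurable_funTS; apply: state_measurable_comp => //.
  exact: borel_occupation_cost.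
- by move=> w _; exact: final_reward_ge0.
- apply: measurable_funTS; apply: state_measurable_comp => //.
  exact: borel_final_reward.
Qed.


End DynamicProgramming.

(** * Measurability and regularity of integrals in time *)

Section AdaptedIntegral.
Context {R : realType} {T : pointedType}.
Variable Q : set (set T).
Hypothesis sQ : sigma_algebra setT Q.
Local Notation mu := (@lebesgue_measure R).

(** T is given [Q] itself as its measurable sets; joint measurability by right-continuity, then
    Tonelli, in that space produce events of [Q] rather than merely measurable ones. *)
Lemma adapted_time_integral (Y : R -> T -> R) (t : R) :
  (forall s, 0 <= s -> s < t -> forall B, measurable B -> Q (Y s @^-1` B)) ->
  (forall w s, 0 <= s -> Y u w @[u --> s^'+] --> Y s w) ->
  forall B, measurable B ->
    Q ((fun w => \int[mu]_(s in `[0%R, t[) (Y s w)%:E)%E @^-1` B).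
Proof.
move=> adY rcY.
pose T' : measurableType _ := g_sigma_algebraType Q.
have Qm (E : set T') : measurable E = Q E.
  by rewrite -[RHS](_ : <<s Q >> E = _) // sigma_algebra_id.
(* The cut at [t] is needed because [next_grid] can step beyond [t], where [Y] is not assumed to be
   known to [Q]. *)
pose f s (w : T') := (if s < t then Y s w else 0)%:E : \bar R.
have mf s : 0 <= s -> measurable_fun setT (f s).
  move=> s0; rewrite /f; have [st|ts] := ltP s t; last exact: measurable_cst.
  apply/measurable_EFinP => _ B mB; rewrite setTI Qm; exact: adY.
have cf (w : T') s : 0 <= s -> f (next_grid n s) w @[n --> \oo] --> f s w.
  move=> s0; have rc : f u w @[u --> s^'+] --> f s w.
    rewrite /f; have [st|ts] := ltP s t.
      apply: cvg_EFin; first by apply: nearW.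
      apply: cvg_trans (rcY w s s0); apply: near_eq_cvg; near=> u.
      by rewrite /= ifT //; near: u; exact: nbhs_right_lt.
    apply: cvg_near_cst; near=> u; rewrite ifF //; apply/negbTE; rewrite -leNgt.
    by apply: (le_trans ts); apply: ltW; near: u; exact: nbhs_right_gt.
  exact: (@cvg_comp _ _ _ (fun n => next_grid n s) (fun u => f u w) _ _ _ (cvg_next_grid s0) rc).
have mF := measurable_right_continuous mf cf.
set F := fun p : measurableTypeR R * T' => _ in mF.
have mI : measurable_fun setT (fun w : T' => \int[mu]_s F (s, w))%E.
  under eq_fun do rewrite integralE.
  apply: emeasurable_funB.
    have := @measurable_fun_fubini_tonelli_G _ _ (measurableTypeR R) T' R mu (F^\+)%E
      (measurable_funepos mF) (funepos_ge0 F).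
    apply: eq_measurable_fun => w _; apply: eq_integral => s _.
    by rewrite !funeposE.
  have := @measurable_fun_fubini_tonelli_G _ _ (measurableTypeR R) T' R mu (F^\-)%E
    (measurable_funeneg mF) (funeneg_ge0 F).
  apply: eq_measurable_fun => w _; apply: eq_integral => s _.
  by rewrite !funenegE.
move=> B mB; rewrite -Qm.
rewrite (_ : (fun w => _) = (fun w => \int[mu]_s F (s, w))%E).
  by have := mI measurableT B mB; rewrite setTI.
apply/funext => w; rewrite integral_mkcond; apply: eq_integral => s _.
rewrite patchE /F /f /=; case: ifPn.
  by rewrite inE /= in_itv /= => /andP[-> ->].
rewrite notin_setE /= in_itv /= => /negP; rewrite negb_and.
by case: (0 <= s) => //=; case: (s < t).
Unshelve. all: by end_near. Qed.

End AdaptedIntegral.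

Section PathIntegrals.
Context {R : realType}.
Local Notation mu := (@lebesgue_measure R).

(** An integral is the difference of those of the two parts, and [+oo - +oo] is infinite by
    convention; a finite result forces both parts to be finite. *)
Lemma integrable_of_fin_num d (T : measurableType d) (m : {measure set T -> \bar R})
    (D : set T) (f : T -> \bar R) : measurable D -> measurable_fun D f ->
  (\int[m]_(x in D) f x)%E \is a fin_num -> m.-integrable D f.
Proof.
move=> mD mf; rewrite integralE fin_numB => /andP[fp fn].
apply/integrableP; split => //.
rewrite -[X in integral _ _ X]/(abse \o f) fune_abse ge0_integralD //=.
- by rewrite lte_add_pinfty // ltey_eq ?fp ?fn.
- exact: measurable_funepos.
- exact: measurable_funeneg.
Qed.

Variable Y : R -> R.
Hypothesis intY : mu.-integrable `[0, 2[ (EFin \o Y).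
Let N t := fine (\int[mu]_(s in `[0%R, t[) (Y s)%:E)%E.

(** Absolute continuity of the integral: the integral of |Y| is small, uniformly, over sets of small
    measure. *)
Lemma time_integral_uniformly_continuous eta : 0 < eta -> exists2 del, 0 < del &
  forall s t, 0 <= s -> s <= t -> t <= 1 -> t - s < del -> `|N t - N s| < eta.
Proof.
move=> eta0.
have intT : mu.-integrable setT (EFin \o Y \_ `[0, 2[).
  by rewrite -restrict_EFin; apply/integrable_restrict => //=; rewrite setTI.
have [del [del0 hdel]] := integral_normr_continuous intT eta0.
exists del => // s t s0 st t1 ts.
have sub (i : interval R) : [set` i] `<=` `[0, 2[%classic ->
    mu.-integrable [set` i] (EFin \o Y).
  by move=> h; apply: integrableS intY.
have i0t : mu.-integrable `[0, t[ (EFin \o Y).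
  apply: sub => u /=; rewrite !in_itv /= => /andP[-> ut]; apply: (lt_trans ut); lra.
have i0s : mu.-integrable `[0, s[ (EFin \o Y).
  apply: sub => u /=; rewrite !in_itv /= => /andP[-> ut]; apply: (lt_trans ut); lra.
have ist : mu.-integrable `[s, t[ (EFin \o Y).
  apply: sub => u /=; rewrite !in_itv /= => /andP[su ut]; apply/andP; split; lra.
have UE : `[0, t[%classic = `[0, s[%classic `|` `[s, t[%classic.
  apply/seteqP; split => u /=; rewrite !in_itv /=.
    move=> /andP[-> ->]; rewrite andbT /=; have [] := ltP u s; by [left|right].
  by case=> /andP[h1 h2]; apply/andP; split; lra.
have -> : N t - N s = \int[mu]_(u in `[s, t[) Y u.
  rewrite /N /Rintegral UE integral_setU //=.
  - rewrite fineD; first by rewrite addrAC subrr add0r.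
      exact: integrable_fin_num i0s.
    exact: integrable_fin_num ist.
  - by rewrite -UE; exact: measurable_int i0t.
  - apply/disj_setPS => u /= []; rewrite !in_itv /= => /andP[_ h1] /andP[h2 _].
    by lra.
apply: le_lt_trans (le_normr_Rintegral _ ist) _ => //.
rewrite (_ : Rintegral _ _ _ = \int[mu]_(u in `[s, t[) `|(Y \_ `[0, 2[) u|).
  have lst : (lebesgue_measure (`[s, t[%classic : set R) < del%:E)%E.
    by rewrite lebesgue_measure_itv /= lte_fin; case: ifPn; rewrite ?lte_fin.
  exact: hdel.
apply: eq_Rintegral => u; rewrite inE /= in_itv /= => /andP[su ut].
rewrite patchE mem_set //= in_itv /=; apply/andP; split; lra.
Qed.

(** By right-continuity the integrand stays below -2e for a while, so the integral is at most -2e t;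
    the factor 2 leaves room for the strict inequality. *)
Lemma time_integral_initially_decreasing (e : R) :
  0 < e -> Y s @[s --> 0^'+] --> Y 0 -> Y 0 < - (2 * e) ->
  exists2 del, 0 < del & forall t, 0 < t -> t < del -> N t < - (e * t).
Proof.
move=> e0 rc Y0.
have [del /= del0 hdel] := rc _ (lt_nbhsl Y0).
exists (Num.min del 1); first by rewrite lt_min del0 ltr01.
move=> t t0; rewrite lt_min => /andP[tdel t1].
have it : mu.-integrable `[0, t[ (EFin \o Y).
  apply: integrableS intY => //.
  by move=> u /=; rewrite !in_itv /= => /andP[-> ut]; apply: (lt_trans ut); lra.
have l0t : lebesgue_measure (`[0, t[%classic : set R) = t%:E.
  by rewrite lebesgue_measure_itv /= lte_fin t0 sube0.
have ic : mu.-integrable `[0, t[ (EFin \o cst (- (2 * e)) : R -> \bar R).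
  apply: measurable_bounded_integrable.
  - by [].
  - have : (lebesgue_measure (`[0%R, t[%classic : set R) < +oo)%E.
      by rewrite l0t ltry.
    by [].
  - exact: measurable_cst.
  - exact: bounded_cst.
apply: (@le_lt_trans _ _ (- (2 * e) * t)); last by rewrite mulNr ltrN2; nra.
rewrite -lee_fin /N fineK; last exact: integrable_fin_num it.
apply: (@le_trans _ _ (\int[mu]_(s in `[0%R, t[) (EFin \o cst (- (2 * e))%R) s)%E).
  apply: le_integral => //.
  move=> u; rewrite inE /= in_itv /= => /andP[u0 ut]; rewrite lee_fin.
  move: u0; rewrite le_eqVlt => /predU1P[<-|u0]; first exact: ltW.
  apply/ltW/hdel => //=; rewrite sub0r normrN gtr0_norm //.
  exact: lt_trans tdel.
have -> : (\int[mu]_(s in `[0%R, t[) (EFin \o cst (- (2 * e))%R) s =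
    (- (2 * e))%R%:E * lebesgue_measure (`[0%R, t[%classic : set R))%E.
  exact: (integral_cst mu (measurable_itv _) (- (2 * e))%:E).
by rewrite l0t -EFinM.
Qed.

End PathIntegrals.

(** * The drift of the value of a policy *)

Section Generator.
Context {R : realType} {S : topologicalType} {A : metricType R}.
Variables (pb : control_problem S A) (pi : markov_policy pb).
Hypothesis cpi : continuous (pi : S -> A).
Local Notation D := (domain pb).
Local Notation bas y := (sp_basis (pol_process pi y)).
Local Notation Pi y := (ctl_path (pol_control pi y)).
Local Notation X y := (state pb y (pol_control pi y)).
Local Notation tau y := (exit pb (X y)).
Local Notation Z y := (stopped (X y) (tau y)).
Local Notation mu := (@lebesgue_measure R).
Local Notation v := (policy_value pi).
Local Open Scope ereal_scope.

Definition gen_rate (phi : S -> R) (y : S) (a : A) : R := gen pb a phi y.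

Lemma gen_rate_within phi : test pb phi ->
  {within D `*` [set: A], continuous (fun p => gen_rate phi p.1 p.2)}.
Proof. exact: test_gen_continuous. Qed.

Lemma state_start x w : D x -> Z x 0%R w = x.
Proof.
move=> Dx; have [_ X0 _ _] := policy_stateP pi Dx.
rewrite /stopped min_l ?X0 //; exact: first_exit_ge0.
Qed.

Lemma compensatedE x phi t : D x -> test pb phi -> (0 <= t)%R ->
  {ae Prob (bas x), forall w, compensated pb (Pi x) (X x) phi t w =
    (phi (Z x t w))%:E - \int[mu]_(s in `[0%R, t[)
       (feedback_fun pb pi (gen_rate phi) (Z x s w))%:E}.
Proof.
move=> Dx tphi t0; have [mX sX] := state_measurable pi Dx.
have mPi : measurable_process (Pi x) := policy_control_measurable Dx.
apply: filterS (policy_follows cpi Dx) => w fw; rewrite /compensated; congr (_ - _).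
rewrite -time_beforeE -(feedback_integral_stopped pb (state_right_continuous Dx)).
apply: (feedback_integral mX mPi cpi sX (gen_rate_within tphi) _ fw).
by rewrite ge_min lexx orbT.
Qed.

Lemma running_until_ge0 x t w : 0 <= @running_until _ _ _ pb pi x t w.
Proof. by apply: integral_ge0 => s _; exact: running_rate_ge0. Qed.

Lemma measurable_running_until x t : D x -> (0 <= t)%R ->
  measurable_fun setT (@running_until _ _ _ pb pi x t).
Proof.
move=> Dx t0; apply: (@measurable_state_integral _ _ _ _ _ cpi x `[0%R, t[%classic Dx).
  exact: measurable_itv.
by move=> s /=; rewrite in_itv /= => /andP[].
Qed.

Lemma measurable_value x t : D x -> (0 <= t)%R ->
  measurable_fun setT (fun w => (v (Z x t w))%:E).
Proof.
move=> Dx t0; apply: (state_measurable_comp (u := EFin \o v)) => //.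
exact: borel_policy_value.
Qed.

Lemma past_setT b (Y : R -> Omega b -> S) t : past Y t setT.
Proof. by apply: sigma_algebra_setT; exact: sigma_algebra_generated. Qed.

(** Dynamic programming on the sure event, compared at the times t and 0. Two nonnegative terms with
    a finite sum are finite, which is where integrability along [Z] comes from. *)
Lemma policy_value_split x t : D x -> (0 <= t)%R ->
  \int[Prob (bas x)]_w (v (Z x t w))%:E + \int[Prob (bas x)]_w running_until t w =
  (v x)%:E.
Proof.
move=> Dx t0.
rewrite (dynamic_programming cpi Dx t0 (@past_setT _ (Z x) t)).
rewrite -(dynamic_programming cpi Dx (lexx 0%R) (@past_setT _ (Z x) 0%R)).
under eq_integral do rewrite state_start //.
rewrite integral_cst // [U in _ * U]probability_setT mule1.
rewrite [U in _ + U]integral0_eq ?adde0 // => w _.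
rewrite /running_until set_itvE integral_set0 //.
Qed.

Lemma integrable_value x t : D x -> (0 <= t)%R ->
  (Prob (bas x)).-integrable setT (fun w => (v (Z x t w))%:E).
Proof.
move=> Dx t0; apply: integrable_of_fin_num => //; first exact: measurable_value.
have v0 : 0 <= \int[Prob (bas x)]_w (v (Z x t w))%:E.
  by apply: integral_ge0 => w _; rewrite lee_fin policy_value_ge0.
have r0 : 0 <= \int[Prob (bas x)]_w running_until t w.
  by apply: integral_ge0 => w _; exact: running_until_ge0.
have : \int[Prob (bas x)]_w (v (Z x t w))%:E + \int[Prob (bas x)]_w running_until t w
    \is a fin_num by rewrite policy_value_split.
by rewrite fin_numD => /andP[].
Qed.

Lemma integrable_running_until x t : D x -> (0 <= t)%R ->
  (Prob (bas x)).-integrable setT (@running_until _ _ _ pb pi x t).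
Proof.
move=> Dx t0; apply: integrable_of_fin_num => //; first exact: measurable_running_until.
have : \int[Prob (bas x)]_w (v (Z x t w))%:E + \int[Prob (bas x)]_w running_until t w
    \is a fin_num by rewrite policy_value_split.
by rewrite fin_numD => /andP[].
Qed.

Lemma compensated_martingale x phi : D x -> test pb phi ->
  martingale (compensated pb (Pi x) (X x) phi).
Proof. by move=> Dx tphi; have [_ _ M _] := policy_stateP pi Dx; exact: M. Qed.

Lemma integrable_compensated x phi t : D x -> test pb phi -> (0 <= t)%R ->
  (Prob (bas x)).-integrable setT (compensated pb (Pi x) (X x) phi t).
Proof. by move=> Dx /(compensated_martingale Dx)[_ + _]; apply. Qed.

Lemma path_measurable x (t : R) w (F : S -> A -> R) : D x ->
  {within D `*` [set: A], continuous (fun p => F p.1 p.2)} ->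
  measurable_fun (`[0%R, t[%classic : set R) (fun s => (feedback_fun pb pi F (Z x s w))%:E).
Proof.
move=> Dx cF.
have I0 : `[0%R, t[%classic `<=` [set s : R | (0 <= s)%R].
  by move=> s /=; rewrite in_itv /= => /andP[].
have bF := borel_feedback_fun cpi cF.
exact: (measurable_fun_path (stopped_measurable_process Dx) w I0 (measurable_itv _) bF).
Qed.

(** The compensated process is integrable, hence almost surely finite, and so is the pathwise
    integral inside it. *)
Lemma path_integrable_gen x phi t : D x -> test pb phi -> (0 <= t)%R ->
  {ae Prob (bas x), forall w, mu.-integrable `[0%R, t[
    (fun s => (feedback_fun pb pi (gen_rate phi) (Z x s w))%:E)}.
Proof.
move=> Dx tphi t0.
have := integrable_ae measurableT (integrable_compensated Dx tphi t0).
apply: filterS2 (compensatedE Dx tphi t0) => w -> /(_ I).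
rewrite fin_numB => /andP[_ fi].
apply: integrable_of_fin_num => //.
exact: path_measurable (gen_rate_within tphi).
Qed.

Lemma path_integrable_running x t : D x -> (0 <= t)%R ->
  {ae Prob (bas x), forall w, mu.-integrable `[0%R, t[
    (fun s => (feedback_fun pb pi (running pb) (Z x s w))%:E)}.
Proof.
move=> Dx t0.
have := integrable_ae measurableT (integrable_running_until Dx t0).
apply: filterS => w /(_ I) fi.
apply: integrable_of_fin_num => //.
exact: path_measurable (@running_within _ _ _ pb).
Qed.

Definition drift (phi : S -> R) (y : S) (a : A) : R := (gen_rate phi y a + running pb y a)%R.

Lemma drift_within phi : test pb phi ->
  {within D `*` [set: A], continuous (fun p => drift phi p.1 p.2)}.
Proof.
move=> tphi p; apply: (@continuousD _ _ (subspace (D `*` [set: A]))).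
  exact: gen_rate_within.
exact: running_within.
Qed.

Lemma feedback_driftE phi y : (feedback_fun pb pi (drift phi) y)%:E =
  (feedback_fun pb pi (gen_rate phi) y)%:E + (feedback_fun pb pi (running pb) y)%:E.
Proof. by rewrite /feedback_fun !patchE; case: ifPn => // _; rewrite addr0. Qed.

(** When [phi] is the value of the policy, this is the dynamic programming process minus the
    martingale of the dynamics, so the drift integral inherits the martingale property. *)
Lemma drift_integral x phi t : D x -> test pb phi -> (0 <= t)%R ->
  {ae Prob (bas x), forall w,
    \int[mu]_(s in `[0%R, t[) (feedback_fun pb pi (drift phi) (Z x s w))%:E =
    (phi (Z x t w))%:E + running_until t w - compensated pb (Pi x) (X x) phi t w}.
Proof.
move=> Dx tphi t0.
apply: filterS3 (compensatedE Dx tphi t0) (path_integrable_gen Dx tphi t0)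
  (path_integrable_running Dx t0) => w -> ig ir.
under eq_integral do rewrite feedback_driftE.
rewrite integralD //.
set a := \int[mu]_(s in _) (feedback_fun pb pi (gen_rate phi) _)%:E.
set r := \int[mu]_(s in _) (feedback_fun pb pi (running pb) _)%:E.
have fa : a \is a fin_num by exact: integrable_fin_num ig.
have fr : r \is a fin_num by exact: integrable_fin_num ir.
rewrite -[running_until t w]/r -(fineK fa) -(fineK fr) -!EFinB -!EFinD.
by congr (_%:E); ring.
Qed.

Lemma past_incr b (Y : R -> Omega b -> S) s t : (s <= t)%R -> past Y s `<=` past Y t.
Proof.
move=> st; apply: smallest_sub; first exact: sigma_algebra_generated.
move=> _ [r [B [r0 rs bB ->]]]; apply: sub_gen_smallest.
by exists r, B; split => //; exact: le_trans st.
Qed.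

(* The dynamics is a martingale for the given filtration, dynamic programming holds on
   the past of the stopped process: both are available on the intersection. *)
Definition known x (t : R) : set (set (Omega (bas x))) :=
  @Filt _ (bas x) t `&` past (Z x) t.

Lemma known_sigma x t : (0 <= t)%R -> sigma_algebra setT (@known x t).
Proof.
move=> t0; have sF := @Filt_sigma _ (bas x) t t0.
have sP : sigma_algebra setT (past (Z x) t) by exact: sigma_algebra_generated.
split.
- by split; [case: sF|case: sP].
- by move=> E [FE pE]; split; [case: sF => _ + _; apply|case: sP => _ + _; apply].
- move=> E FpE; split; [case: sF => _ _; apply|case: sP => _ _; apply] => n;
    by have [] := FpE n.
Qed.

Lemma known_incr x s t : (0 <= s)%R -> (s <= t)%R -> @known x s `<=` @known x t.
Proof.
move=> s0 st E [FE pE]; split; first exact: Filt_mono FE.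
exact: past_incr pE.
Qed.

(** The stopped process samples [X] at a random time, but after the exit the cut-off value is 0. It
    is thus decided by the event s < tau and by [X s], which are known to the filtration, and by
    [Z s] for the past. *)
Lemma known_state x s t (h : S -> R) : D x -> (0 <= s)%R -> (s <= t)%R ->
  {in D, continuous h} ->
  forall B, measurable B -> @known x t ((fun w => (h \_ D) (Z x s w)) @^-1` B).
Proof.
move=> Dx s0 st ch.
have bh : borel_fun (EFin \o (h \_ D)).
  by apply: borel_domain_comp => //; exact: domain_open.
have t0 := le_trans s0 st.
have bB B : measurable B -> borel ((h \_ D) @^-1` B).
  move=> mB; rewrite (_ : _ @^-1` _ = (EFin \o (h \_ D)) @^-1` (EFin @` B)).
    by apply: bh; exact: measurable_image_EFin.
  apply/seteqP; split => y /=; first by move=> By; exists ((h \_ D) y).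
  by move=> [r Br [<-]].
have [[adX rX [tau0 sX]] _ _ _] := policy_stateP pi Dx.
have [_ {}adX] := adX.
have oD := domain_open pb.
have bD : borel D by exact: open_borel.
have bDC : borel (~` D) by apply: (sigma_algebra_setC (@sigma_algebra_generated _ _)).
have Kbefore : @known x t [set w | (s%:E < tau x w)].
  split.
    rewrite (_ : [set _ | _] = ~` [set w | tau x w <= s%:E]).
      apply: sigma_algebra_setC; first exact: Filt_sigma.
      apply: (Filt_mono s0 st); exact: sX.
    by apply/seteqP; split => w /=; rewrite ltNge => /negP.
  rewrite (_ : [set _ | _] = Z x s @^-1` D).
    by apply: sub_gen_smallest; exists s, D; split.
  by apply/seteqP; split => w /= /(stopped_in oD rX w s0).
have Kin B : measurable B ->
    @known x t ([set w | s%:E < tau x w] `&` X x s @^-1` ((h \_ D) @^-1` B)).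
  move=> mB; split.
    apply: sigma_algebra_setI; [exact: Filt_sigma|by have [] := Kbefore|].
    by apply: (Filt_mono s0 st); apply: adX => //; exact: bB.
  rewrite (_ : _ `&` _ = Z x s @^-1` (D `&` (h \_ D) @^-1` B)).
    apply: sub_gen_smallest; exists s, (D `&` (h \_ D) @^-1` B); split => //.
    apply: (sigma_algebra_setI (@sigma_algebra_generated _ _)) => //; exact: bB.
  apply/seteqP; split => w /= [h1 h2].
    by rewrite stopped_before ?ltW //; split => //; exact: before_exit.
  have st' := (stopped_in oD rX w s0).1 h1; split => //.
  by move: h2; rewrite stopped_before ?ltW.
(* Exited paths carry the value 0. If 0 is not in B they are all excluded and [Kin] applies;
   otherwise the complement of B is treated in this way. *)
move=> B mB; have [B0|B0] := pselect (B 0%R); last first.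
  rewrite (_ : _ @^-1` _ = [set w | s%:E < tau x w] `&` X x s @^-1` ((h \_ D) @^-1` B)).
    exact: Kin.
  apply/seteqP; split => w /= h1.
    have [DZ|nDZ] := pselect (D (Z x s w)); last first.
      by move: h1; rewrite patchE ifF // ; apply/negbTE; rewrite notin_setE.
    have st' := (stopped_in oD rX w s0).1 DZ; split => //.
    by move: h1; rewrite stopped_before ?ltW.
  by move: h1 => [h1 h2]; rewrite stopped_before ?ltW.
rewrite (_ : _ @^-1` _ = ~` ([set w | s%:E < tau x w] `&` X x s @^-1` ((h \_ D) @^-1` (~` B)))).
  by apply: sigma_algebra_setC; [exact: known_sigma|apply: Kin; exact: measurableC].
apply/seteqP; split => w /= h1.
  by move=> [h2 h3]; apply: h3; move: h1; rewrite stopped_before ?ltW.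
apply: contrapT => h2; apply: h1.
have [DZ|nDZ] := pselect (D (Z x s w)); last first.
  by exfalso; apply: h2; rewrite patchE ifF // ; apply/negbTE; rewrite notin_setE.
have st' := (stopped_in oD rX w s0).1 DZ; split => //.
by move: h2; rewrite stopped_before ?ltW.
Qed.

Lemma feedback_drift_continuous phi : test pb phi ->
  {in D, continuous (fun y => drift phi y (pi y))}.
Proof. by move=> tphi; exact: feedback_integrand_continuous (drift_within tphi). Qed.

Lemma policy_drift_ge0 x : test pb v -> D x -> (0 <= drift v x (pi x))%R.
Proof.
move=> tv Dx; rewrite leNgt; apply/negP => Gx.
pose G := feedback_fun pb pi (drift v).
have GxE : G x = drift v x (pi x) by rewrite /G /feedback_fun patchE mem_set.
(* A third, so that the initial slope -3e lies strictly below the -2e required at the start. *)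
pose e := (- G x / 3)%R.
have e0 : (0 < e)%R by rewrite /e GxE divr_gt0 // oppr_gt0.
have rX : Defs.right_continuous (X x) := state_right_continuous Dx.
pose I t w := \int[mu]_(s in `[0%R, t[) (G (Z x s w))%:E.
(* The pathwise integral may fail to be finite on a null set, while the martingale argument needs
   real values; the two agree almost surely at each time. *)
pose N t w := fine (I t w).
have cG := feedback_drift_continuous tv.
have rcG w s : (0 <= s)%R -> G (Z x u w) @[u --> s^'+] --> G (Z x s w).
  by move=> s0; exact: (right_continuous_in_domain rX cG s0).
have KI t : (0 <= t)%R -> forall B, measurable B -> @known x t (I t @^-1` B).
  move=> t0 B mB.
  have adG s : (0 <= s)%R -> (s < t)%R -> forall B, measurable B ->
      @known x t ((fun w => G (Z x s w)) @^-1` B).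
    by move=> s0 st C mC; exact: (known_state Dx s0 (ltW st) cG).
  exact: (@adapted_time_integral R (Omega (bas x)) (@known x t) (known_sigma x t0)
    (fun s w => G (Z x s w)) t adG rcG B mB).
have mK t : (0 <= t)%R -> @known x t `<=` measurable.
  by move=> t0 E [/(Filt_measurable t0)].
have mI t : (0 <= t)%R -> measurable_fun setT (I t).
  by move=> t0 _ B mB; rewrite setTI; apply: (mK t t0); exact: KI.
have Iae t (t0 : (0 <= t)%R) := drift_integral Dx tv t0.
have intR t : (0 <= t)%R -> (Prob (bas x)).-integrable setT (fun w =>
    (v (Z x t w))%:E + running_until t w - compensated pb (Pi x) (X x) v t w).
  move=> t0; apply: integrableB => //; last exact: integrable_compensated.
  by apply: integrableD => //; [exact: integrable_value|exact: integrable_running_until].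
have intI t : (0 <= t)%R -> (Prob (bas x)).-integrable setT (I t).
  move=> t0; apply/integrableP; split; first exact: mI.
  have /integrableP[mR] := intR t t0; apply: le_lt_trans.
  rewrite le_eqVlt; apply/orP; left; apply/eqP.
  apply: ge0_ae_eq_integral => //.
  - by apply: measurableT_comp => //; exact: mI.
  - exact: measurableT_comp.
  - by apply: filterS (Iae t t0) => w /= h _; rewrite -h.
have NI t : (0 <= t)%R -> {ae Prob (bas x), forall w, (N t w)%:E = I t w}.
  move=> t0; have := integrable_ae measurableT (intI t t0).
  by apply: filterS => w /(_ Logic.I) fI; rewrite /N fineK.
have mN t : (0 <= t)%R -> measurable_fun setT (EFin \o N t).
  by move=> t0; apply/measurable_EFinP; apply: measurableT_comp => //; exact: mI.
have NE t E : (0 <= t)%R -> measurable E ->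
    \int[Prob (bas x)]_(w in E) (N t w)%:E = \int[Prob (bas x)]_(w in E) I t w.
  move=> t0 mE; apply: ae_eq_integral => //.
  - exact/measurable_funTS/mN.
  - exact/measurable_funTS/mI.
  - by apply: filterS (NI t t0) => w h _.
(* For an event of the past, only the compensated term on the right still depends on t, and that
   term is a martingale. *)
have IE t E : (0 <= t)%R -> measurable E -> past (Z x) t E ->
    \int[Prob (bas x)]_(w in E) I t w =
    (\int[Prob (bas x)]_(w in E) total_running w +
     \int[Prob (bas x)]_(w in E) limn (fun n => exit_reward pb (Z x n%:R w))) -
    \int[Prob (bas x)]_(w in E) compensated pb (Pi x) (X x) v t w.
  move=> t0 mE pE; rewrite -(dynamic_programming cpi Dx t0 pE).
  have iv := integrableS measurableT mE (@subsetT _ _) (integrable_value Dx t0).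
  have ir := integrableS measurableT mE (@subsetT _ _) (integrable_running_until Dx t0).
  have ic := integrableS measurableT mE (@subsetT _ _) (integrable_compensated Dx tv t0).
  rewrite -integralD // -integralB //; last exact: integrableD.
  apply: ae_eq_integral => //.
  - exact/measurable_funTS/mI.
  - by apply: measurable_funTS; exact: measurable_int (intR t t0).
  - by apply: filterS (Iae t t0) => w h _.
apply: (@not_ae_initially_decreasing _ _ _ (Prob (bas x)) (@known x) N e e0).
- exact: known_sigma.
- exact: mK.
- exact: known_incr.
- move=> t t0 B mB.
  have := KI t t0 _ (fine_measurable measurableT measurableT mB).
  by rewrite setTI.
- move=> t t0; apply/integrableP; split; first exact: mN.
  have /integrableP[_] := intI t t0; apply: le_lt_trans.
  rewrite le_eqVlt; apply/orP; left; apply/eqP.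
  apply: ge0_ae_eq_integral => //.
  - by apply: measurableT_comp => //; exact: mN.
  - by apply: measurableT_comp => //; exact: mI.
  - by apply: filterS (NI t t0) => w h _; congr (abse _).
- move=> s t E s0 st [FE pE]; have t0 := le_trans s0 st.
  have mE := Filt_measurable s0 FE.
  have pEt := past_incr st pE.
  rewrite (NE t E t0 mE) (NE s E s0 mE) (IE t E t0 mE pEt) (IE s E s0 mE pE).
  have [_ _ mart] := compensated_martingale Dx tv.
  have m : \int[Prob (bas x)]_(w in E) compensated pb (Pi x) (X x) v t w =
      \int[Prob (bas x)]_(w in E) compensated pb (Pi x) (X x) v s w.
    exact (mart s t E s0 st FE).
  by rewrite m.
- by move=> w; rewrite /N /I set_itvE integral_set0.
(* A horizon beyond the interval [0, 1] on which the paths are examined. *)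
have t20 : (0 <= 2 :> R)%R by [].
apply: filterS3 (path_integrable_gen Dx tv t20) (path_integrable_running Dx t20)
  (Iae 2%R t20) => w ig ir _.
have iG : mu.-integrable `[0%R, 2%R[ (EFin \o (fun s => G (Z x s w))).
  apply: eq_integrable (integrableD _ ig ir) => //.
  by move=> s _; rewrite /= -feedback_driftE.
split.
  by move=> eta eta0; exact: (time_integral_uniformly_continuous iG eta0).
apply: (time_integral_initially_decreasing iG e0); first exact: rcG.
rewrite state_start // /e; lra.
Qed.

End Generator.

(** * Policy improvement and optimality *)

Section Expectations.
Context {R : realType}.
Local Open Scope ereal_scope.

(** Replacing [g] by max(f, g), almost surely the same function, makes the inequality hold
    everywhere. *)
Lemma ae_le_integral d (T : measurableType d) (m : {measure set T -> \bar R})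
    (f g : T -> \bar R) :
  m.-integrable setT f -> m.-integrable setT g ->
  {ae m, forall w, f w <= g w} -> \int[m]_w f w <= \int[m]_w g w.
Proof.
move=> intf intg fg.
have mf := measurable_int m intf; have mg := measurable_int m intg.
have mfg : measurable_fun setT (fun w => maxe (f w) (g w)) by exact: measurable_maxe.
have eg : ae_eq m setT (fun w => maxe (f w) (g w)) g.
  by apply: filterS fg => w h _; apply/max_idPr.
rewrite -(ae_eq_integral _ _ measurableT mfg mg eg); apply: le_integral => //.
  apply/integrableP; split => //.
  have /integrableP[_] := intg; apply: le_lt_trans.
  rewrite le_eqVlt; apply/orP; left; apply/eqP; apply: ge0_ae_eq_integral => //.
  - exact: measurableT_comp.
  - exact: measurableT_comp.
  - by apply: filterS eg => w h _; rewrite /= h.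
by move=> w _; rewrite le_max lexx.
Qed.

Lemma cvg_L1_integral (b : stochastic_basis R) (Y : R -> Omega b -> \bar R) Z :
  cvg_L1 Y Z -> \int[Prob b]_w Y t w @[t --> +oo%R] --> \int[Prob b]_w Z w.
Proof.
move=> [intY intZ cv].
have fZ : \int[Prob b]_w Z w \is a fin_num by exact: integrable_fin_num intZ.
rewrite -(fineK fZ); apply/fine_cvgP; split.
  by apply: filterS intY => t it; exact: integrable_fin_num it.
apply/cvgrPdist_lt => e e0.
have [fcv rcv] := (fine_cvgP _ _).1 cv.
have h3 := (cvgrPdist_lt _ _).1 rcv e e0.
near=> t.
have it : (Prob b).-integrable setT (Y t) by near: t.
have ft : \int[Prob b]_w `|Y t w - Z w| \is a fin_num by near: t.
have he : (`|fine (\int[Prob b]_w `|Y t w - Z w|)%E| < e)%R.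
  rewrite -normrN -sub0r; near: t; exact: h3.
have fY : \int[Prob b]_w Y t w \is a fin_num by exact: integrable_fin_num it.
rewrite distrC -lte_fin; apply: (@le_lt_trans _ _ (\int[Prob b]_w `|Y t w - Z w|)).
  have -> : `|fine (\int[Prob b]_w Y t w) - fine (\int[Prob b]_w Z w)|%R%:E =
      `|\int[Prob b]_w Y t w - \int[Prob b]_w Z w|.
    by rewrite -[in RHS](fineK fY) -[in RHS](fineK fZ).
  rewrite -integralB //; apply: le_abse_integral => //.
  by have /(measurable_int _) := integrableB measurableT it intZ.
by rewrite -(fineK ft) lte_fin; apply: le_lt_trans he; exact: ler_norm.
Unshelve. all: by end_near. Qed.

End Expectations.

Section Improvement.
Context {R : realType} {S : topologicalType} {A : metricType R}.
Variables (pb : control_problem S A).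
Local Notation D := (domain pb).
Local Open Scope ereal_scope.

Lemma compensated0 (b : stochastic_basis R) (X : R -> Omega b -> S)
    (Pi : R -> Omega b -> A) x phi w :
  X 0%R w = x -> compensated pb Pi X phi 0 w = (phi x)%:E.
Proof.
move=> X0; rewrite /compensated /stopped min_l; last exact: first_exit_ge0.
rewrite /= X0 (_ : time_before _ = set0) ?integral_set0 ?sube0 //.
rewrite time_beforeE; apply/seteqP; split => s //=; rewrite in_itv /=.
by move=> /andP[s0]; rewrite ltNge s0.
Qed.

Lemma integral_compensated x (c : control A) (X : R -> Omega (ctl_basis c) -> S) phi t :
  is_state pb x X -> test pb phi -> (0 <= t)%R ->
  \int[Prob (ctl_basis c)]_w compensated pb (ctl_path c) X phi t w = (phi x)%:E.
Proof.
move=> [_ X0 M _] tphi t0; have [_ _ mart] := M phi tphi.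
have FT : @Filt _ (ctl_basis c) 0%R setT.
  exact: (sigma_algebra_setT (@Filt_sigma _ (ctl_basis c) 0%R (lexx 0%R))).
rewrite (mart 0%R t setT (lexx 0%R) t0 FT).
rewrite (eq_integral (cst (phi x)%:E)); last first.
  by move=> w _; exact: compensated0.
by rewrite integral_cst // [U in _ * U]probability_setT mule1.
Qed.

(** The assumed limit of the gap concerns the given process, the drift estimate the state process;
    expectations are moved between them by [transfer]. At a fixed time the expected gap is at most
    V^pi'(x) - V^pi(x), and its limit is nonnegative. *)
Lemma policy_improvement (pi pi' : markov_policy pb) x :
  continuous (pi : S -> A) -> continuous (pi' : S -> A) ->
  improvable pi -> improvement pi pi' -> D x ->
  (exists Z : Omega (sp_basis (pol_process pi' x)) -> R,
     {ae Prob (sp_basis (pol_process pi' x)), forall w, (0 <= Z w)%R} /\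
     cvg_L1 (fun t w =>
       (policy_value pi' (stopped_path pb (pol_process pi' x) t w)
        - policy_value pi (stopped_path pb (pol_process pi' x) t w))%:E)
       (EFin \o Z)) ->
  (policy_value pi x <= policy_value pi' x)%R.
Proof.
move=> cpi cpi' tv imp Dx [Z [Z0 cvZ]].
have [_ iZ _] := cvZ; have [intY _ _] := cvZ.
pose P := Prob (sp_basis (pol_process pi' x)).
pose Xs := state pb x (pol_control pi' x).
pose Zs := stopped Xs (exit pb Xs).
have st := policy_stateP pi' Dx.
have [mX sX] := state_measurable pi' Dx; have [mX' sX'] := policy_measurable pi' Dx.
have law : same_law pb Xs (ctl_path (pol_control pi' x))
    (sp_path (pol_process pi' x)) (ctl_path (pol_control pi' x)) := pol_law pi' Dx.
have transfer (q : markov_policy pb) t : continuous (q : S -> A) -> (0 <= t)%R ->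
    \int[P]_w (policy_value q (Zs t w))%:E =
    \int[P]_w (policy_value q (stopped_path pb (pol_process pi' x) t w))%:E.
  move=> cq t0.
  apply: (integral_same_event mX sX mX' sX' law measurableT measurableT
    (same_event_setT _ _ _ _ _) t0 _ (borel_policy_value cq)).
  by move=> y; rewrite lee_fin policy_value_ge0.
have mv (q : markov_policy pb) t : continuous (q : S -> A) -> (0 <= t)%R ->
    measurable_fun setT (fun w => (policy_value q (stopped_path pb (pol_process pi' x) t w))%:E).
  move=> cq t0; apply: (policy_measurable_comp (u := EFin \o policy_value q)) => //.
  exact: borel_policy_value.
have drift0 y : (0 <= feedback_fun pb pi' (drift pb (policy_value pi)) y)%R.
  rewrite /feedback_fun patchE; case: ifPn => // yD; have Dy := set_mem yD.
  apply: (le_trans (policy_drift_ge0 cpi tv Dy)).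
  have := imp y Dy; rewrite -lee_fin => ->.
  by apply: ereal_sup_ubound; exists (pi y).
have key t : (0 <= t)%R -> P.-integrable setT (fun w =>
    (policy_value pi' (stopped_path pb (pol_process pi' x) t w)
        - policy_value pi (stopped_path pb (pol_process pi' x) t w))%:E) ->
  \int[P]_w (policy_value pi' (stopped_path pb (pol_process pi' x) t w)
        - policy_value pi (stopped_path pb (pol_process pi' x) t w))%:E <=
  (policy_value pi' x - policy_value pi x)%:E.
  move=> t0 id'.
  have iv'Z := integrable_value cpi' Dx t0.
  have iru := integrable_running_until cpi' Dx t0.
  have iv' : P.-integrable setT
      (fun w => (policy_value pi' (stopped_path pb (pol_process pi' x) t w))%:E).
    apply: integrable_of_fin_num => //; first exact: mv.
    by rewrite -transfer //; exact: integrable_fin_num iv'Z.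
  (* Integrability of V^pi along the process of pi' is not given: V^pi is recovered as V^pi' minus
     the gap, which is integrable for large t. *)
  have iv : P.-integrable setT
      (fun w => (policy_value pi (stopped_path pb (pol_process pi' x) t w))%:E).
    apply: eq_integrable (integrableB _ iv' id') => // w _.
    by rewrite /= -EFinB; congr (_%:E); ring.
  have ivZ : P.-integrable setT (fun w => (policy_value pi (Zs t w))%:E).
    apply: integrable_of_fin_num => //.
      apply: (state_measurable_comp (u := EFin \o policy_value pi)) => //.
      exact: borel_policy_value.
    by rewrite transfer //; exact: integrable_fin_num iv.
  have fv := integrable_fin_num measurableT ivZ.
  have fr := integrable_fin_num measurableT iru.
  have fv' := integrable_fin_num measurableT iv'Z.
  have ic : P.-integrable setT (compensated pb (ctl_path (pol_control pi' x)) Xs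
      (policy_value pi) t) := integrable_compensated pi' Dx tv t0.
  have le1 : (policy_value pi x)%:E <=
      \int[P]_w (policy_value pi (Zs t w))%:E + \int[P]_w running_until t w.
    rewrite -(integral_compensated st tv t0) -integralD //.
    apply: ae_le_integral.
    - exact: ic.
    - exact: integrableD.
    have fc := integrable_ae measurableT ic.
    apply: filterS2 (drift_integral cpi' Dx tv t0) fc => w dE /(_ Logic.I) fw.
    have : 0 <= \int[lebesgue_measure]_(s in `[0%R, t[)
       (feedback_fun pb pi' (drift pb (policy_value pi)) (Zs s w))%:E.
      by apply: integral_ge0 => s _; rewrite lee_fin.
    by rewrite dE sube_ge0 // fw.
  have -> : \int[P]_w (policy_value pi' (stopped_path pb (pol_process pi' x) t w)
        - policy_value pi (stopped_path pb (pol_process pi' x) t w))%:E =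
      \int[P]_w (policy_value pi' (Zs t w))%:E - \int[P]_w (policy_value pi (Zs t w))%:E.
    by rewrite !transfer // -integralB.
  have le2 := policy_value_split cpi' Dx t0.
  move: le1 le2 fv fv' fr; rewrite -/P -/Xs -/Zs.
  move: (\int[P]_w (policy_value pi (Zs t w))%:E) (\int[P]_w (policy_value pi' (Zs t w))%:E)
    (\int[P]_w running_until t w) => [a| |] [a'| |] [r| |] //.
  by rewrite !lee_fin => + [<-] _ _ _; lra.
have Zge : 0 <= \int[P]_w (EFin \o Z) w.
  rewrite -(integral0 P setT); apply: ae_le_integral => //.
  exact: integrable0.
rewrite -subr_ge0 -lee_fin; apply: (le_trans Zge).
have cv := cvg_L1_integral cvZ.
rewrite -(cvg_lim _ cv) //; apply: lime_le; first by apply/cvg_ex; eexists; exact: cv.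
near=> t; apply: key; first by near: t; exact: nbhs_pinfty_ge.
by near: t.
Unshelve. all: by end_near. Qed.

End Improvement.

Section ArbitraryControl.
Context {R : realType} {S : topologicalType} {A : metricType R}.
Variables (pb : control_problem S A) (x : S) (c : control A).
Variable X : R -> Omega (ctl_basis c) -> S.
Hypothesis mPi : measurable_process (ctl_path c).
Hypothesis stX : is_state pb x X.
Local Notation D := (domain pb).
Local Notation P := (Prob (ctl_basis c)).
Local Notation Pi := (ctl_path c).
Local Notation tau := (exit pb X).
Local Notation Z := (stopped X tau).
Local Notation mu := (@lebesgue_measure R).
Local Open Scope ereal_scope.

Definition running_to (t : R) (w : Omega (ctl_basis c)) : \bar R :=
  running_payoff pb Pi X (mine t%:E (tau w)) w.

(** The passage through max(F, 0) allows F to be very negative; e >= 0 is what lets the possibly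
    shorter interval be replaced by one of length t. *)
Lemma time_integral_le (F : R -> R) (T : \bar R) (e t : R) : (0 <= e)%R -> (0 <= t)%R ->
  (T <= t%:E) -> mu.-integrable (time_before T) (EFin \o F) ->
  (forall s, time_before T s -> (F s <= e)%R) ->
  \int[mu]_(s in time_before T) (F s)%:E <= (e * t)%:E.
Proof.
move=> e0 t0 Tt iF Fe.
have mT := measurable_time_before T.
apply: (@le_trans _ _ (\int[mu]_(s in time_before T) (maxe (F s)%:E 0))).
  apply: le_integral => //; last by move=> s _; rewrite le_max lexx.
  have := integrable_funepos _ iF; move=> /(_ mT).
  by apply: eq_integrable => // s _; rewrite funeposE.
apply: (@le_trans _ _ (\int[mu]_(s in time_before T) (cst e%:E s))).
  apply: ge0_le_integral => //.
  - by move=> s _; rewrite le_max lexx orbT.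
  - by apply: measurable_maxe => //; exact: measurable_int iF.
  - by move=> s Ts; rewrite ge_max !lee_fin e0 Fe.
rewrite integral_cst // EFinM lee_wpmul2l ?lee_fin //.
apply: (@le_trans _ _ (mu (`[0%R, t[%classic))).
  apply: le_measure; rewrite ?inE //.
  move=> s [s0 sT] /=; rewrite in_itv /= s0 -lte_fin; exact: lt_le_trans Tt.
by rewrite lebesgue_measure_itv /= lte_fin; case: ifPn => _; rewrite ?sube0 ?lee_fin.
Qed.

(** The drift under any action is at most e, so its integral until min(t, tau) is at most e t.
    Replacing [phi] by a smaller [u] leaves on the left a function that need not change with e. *)
Lemma compensated_ge (phi u : S -> R) e t : (0 <= e)%R -> (0 <= t)%R ->
  test pb phi ->
  (forall y a, D y -> (gen pb a phi y + running pb y a <= e)%R) ->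
  (forall y, (u y <= phi y)%R) ->
  P.-integrable setT (running_to t) ->
  {ae P, forall w, (u (Z t w))%:E + running_to t w <=
    compensated pb Pi X phi t w + (e * t)%:E}.
Proof.
move=> e0 t0 tphi He uphi iK.
have [[mX rX sX] X0 M _] := stX; have [_ icomp _] := M phi tphi.
have [mX' _] := mX.
apply: filterS2 (integrable_ae measurableT (icomp t t0))
  (integrable_ae measurableT iK) => w /(_ Logic.I) fC /(_ Logic.I) fK.
move: fC fK; rewrite /compensated /running_to /running_payoff.
set T := mine _ _ => fC fK.
have Ttau : T <= tau w by rewrite /T ge_min lexx orbT.
have Tt : T <= t%:E by rewrite /T ge_min lexx.
have mT := measurable_time_before T.
have mint (F : S -> A -> R) : {within D `*` [set: A], continuous (fun p => F p.1 p.2)} ->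
    measurable_fun (time_before T) (fun s => (F (X s w) (Pi s w))%:E).
  by move=> cF; apply/measurable_EFinP; exact: (measurable_path_integrand mX' mPi).
have mg := mint _ (gen_rate_within tphi).
have mf := mint _ (@running_within _ _ _ pb).
move: fC; rewrite fin_numB => /andP[_ fG].
have ig : mu.-integrable (time_before T) (fun s => (gen pb (Pi s w) phi (X s w))%:E).
  by apply: integrable_of_fin_num.
have ir : mu.-integrable (time_before T) (fun s => (running pb (X s w) (Pi s w))%:E).
  by apply: integrable_of_fin_num.
have := integrableD _ ig ir; move=> /(_ mT) igr.
have le1 : \int[mu]_(s in time_before T)
    (gen pb (Pi s w) phi (X s w) + running pb (X s w) (Pi s w))%:E <= (e * t)%:E.
  apply: time_integral_le => //.
  move=> s [s0 sT]; apply: He; apply: before_exit => //; exact: lt_le_trans Ttau.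
move: le1; under eq_integral do rewrite EFinD.
rewrite integralD //; move: fG fK.
move: (\int[mu]_(s in _) _) (\int[mu]_(s in _) _) => [G| |] [K| |] // _ _.
by rewrite -!EFinB -!EFinD !lee_fin => h; have := uphi (Z t w); lra.
Qed.

Lemma value_bound (phi u : S -> R) e t : (0 <= e)%R -> (0 <= t)%R ->
  test pb phi ->
  (forall y a, D y -> (gen pb a phi y + running pb y a <= e)%R) ->
  (forall y, (u y <= phi y)%R) ->
  P.-integrable setT (running_to t) ->
  P.-integrable setT (fun w => (u (Z t w))%:E) ->
  \int[P]_w (u (Z t w))%:E + \int[P]_w running_to t w <= (phi x + e * t)%:E.
Proof.
move=> e0 t0 tphi He uphi iK iu.
have [_ _ M _] := stX; have [_ icomp _] := M phi tphi.
have ic : P.-integrable setT (cst (e * t)%:E : Omega (ctl_basis c) -> \bar R).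
  exact: finite_measure_integrable_cst.
rewrite EFinD -(integral_compensated stX tphi t0).
have -> : (e * t)%:E = \int[P]_w (cst (e * t)%:E w).
  by rewrite integral_cst // [U in _ * U]probability_setT mule1.
rewrite -!integralD //; last exact: icomp.
apply: ae_le_integral.
- exact: integrableD.
- by apply: integrableD => //; exact: icomp.
- exact: compensated_ge.
Qed.

End ArbitraryControl.

Section Optimality.
Context {R : realType} {S : topologicalType} {A : metricType R}.
Variable pb : control_problem S A.
Local Notation D := (domain pb).
Local Open Scope ereal_scope.

Lemma terminal_payoff_fin b (X : R -> Omega b -> S) w :
  terminal_payoff pb X w \is a fin_num.
Proof. by rewrite /terminal_payoff; case: ifP. Qed.

(** [u] is fixed and carries the limit in t, whereas [phi] may be chosen anew for each e at a fixed
    t. *)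
Lemma control_value_le x (c : control A) (u : S -> R) (L : \bar R) :
  admissible pb x c ->
  cvg_L1 (fun t w => (u (stopped (state pb x c) (exit pb (state pb x c)) t w))%:E)
    (terminal_payoff pb (state pb x c)) ->
  (forall e : R, (0 < e)%R -> exists phi, [/\ test pb phi,
    forall y a, D y -> (gen pb a phi y + running pb y a <= e)%R,
    forall y, (u y <= phi y)%R & (phi x)%:E <= L]) ->
  control_value pb x c <= L.
Proof.
move=> ax cu H; have st := stateP ax; have [_ _ _ cJ] := st.
have mPi : measurable_process (ctl_path c) by case: ax => -[].
set X := state pb x c in cu st cJ *.
pose P := Prob (ctl_basis c).
pose T := terminal_payoff pb X.
pose a t := \int[P]_w (u (stopped X (exit pb X) t w))%:E.
pose k t := \int[P]_w (running_to pb X t w + T w).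
have [ia iT _] := cu; have [iJ iP _] := cJ.
have fT : \int[P]_w T w \is a fin_num := integrable_fin_num measurableT iT.
have fJ : \int[P]_w payoff pb (ctl_path c) X w \is a fin_num :=
  integrable_fin_num measurableT iP.
have cva : a t @[t --> +oo%R] --> \int[P]_w T w := cvg_L1_integral cu.
have cvk : k t @[t --> +oo%R] --> \int[P]_w payoff pb (ctl_path c) X w :=
  cvg_L1_integral cJ.
(* Admissibility gives the L1 limit of running plus terminal payoff; the terminal payoff is also the
   limit of [u] along [Z], so one copy has to be subtracted. *)
have cvs : a t + k t - \int[P]_w T w @[t --> +oo%R] --> control_value pb x c.
  have -> : control_value pb x c =
      \int[P]_w T w + \int[P]_w payoff pb (ctl_path c) X w - \int[P]_w T w.
    by rewrite addeAC subee // add0e.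
  apply: cvgeB; first by rewrite fin_num_adde_defl // fin_numN.
    by apply: cvgeD => //; rewrite fin_num_adde_defl.
  exact: cvg_cst.
rewrite -(cvg_lim _ cvs) //; apply: lime_le; first by apply/cvg_ex; eexists; exact: cvs.
near=> t.
have t0 : (0 <= t)%R by near: t; exact: nbhs_pinfty_ge.
have iat : P.-integrable setT (fun w => (u (stopped X (exit pb X) t w))%:E) by near: t.
have ikt : P.-integrable setT (fun w => running_to pb X t w + T w) by near: t.
have iK : P.-integrable setT (running_to pb X t).
  apply: eq_integrable (integrableB measurableT ikt iT) => // w _ /=.
  by rewrite addeK //; exact: terminal_payoff_fin.
have -> : a t + k t - \int[P]_w T w = a t + \int[P]_w running_to pb X t w.
  by rewrite /k integralD // addeA addeK.
apply/lee_addgt0Pr => e e0.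
(* The time t is fixed before the error: with e/(t+1) in place of e, the accumulated error over
   [0, t] is at most e, also when t = 0. *)
have et0 : (0 < e / (t + 1))%R by rewrite divr_gt0 // ltr_wpDl.
have [phi [tphi hphi uphi phiL]] := H _ et0.
apply: (le_trans (value_bound mPi st (ltW et0) t0 tphi hphi uphi iK iat)).
rewrite EFinD leeD // lee_fin -mulrA ger_pMr //.
by rewrite mulrC ler_pdivrMr ?mul1r ?lerDl // ltr_wpDl.
Unshelve. all: by end_near. Qed.

End Optimality.

(** * Starting points outside the domain *)

Section OutsideDomain.
Context {R : realType} {S : topologicalType} {A : metricType R}.
Variable pb : control_problem S A.
Local Notation D := (domain pb).
Local Open Scope ereal_scope.

Lemma exit_outside b (X : R -> Omega b -> S) x w : ~ D x -> X 0%R w = x ->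
  exit pb X w = 0.
Proof. by move=> nD X0; apply: first_exit0; rewrite X0. Qed.

Lemma stopped_outside b (X : R -> Omega b -> S) x w (T : topologicalType)
    (Y : R -> Omega b -> T) t : ~ D x -> X 0%R w = x -> (0 <= t)%R ->
  stopped Y (exit pb X) t w = Y 0%R w.
Proof. by move=> nD X0 t0; rewrite /stopped (exit_outside nD X0) min_r ?lee_fin. Qed.

Lemma payoff_outside b (X : R -> Omega b -> S) (Pi : R -> Omega b -> A) x w :
  ~ D x -> X 0%R w = x -> payoff pb Pi X w = (terminal pb x)%:E.
Proof.
move=> nD X0; rewrite /payoff /running_payoff /terminal_payoff (exit_outside nD X0).
by rewrite ltry X0 time_beforeE set_itvE integral_set0 add0e.
Qed.

Lemma control_value_outside x (c : control A) : ~ D x -> admissible pb x c ->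
  control_value pb x c = (terminal pb x)%:E.
Proof.
move=> nD /stateP[_ X0 _ _]; rewrite /control_value.
under eq_integral do rewrite (payoff_outside _ nD) //.
by rewrite integral_cst // [U in _ * U]probability_setT mule1.
Qed.

Lemma constant_preimage (b : stochastic_basis R) T (y : T) (B : set T) t :
  (0 <= t)%R -> @Filt _ b t [set w | B y].
Proof.
move=> t0; have sF := @Filt_sigma _ b t t0; have [By|nBy] := pselect (B y).
  by rewrite (_ : [set _ | _] = setT); [exact: (sigma_algebra_setT sF)|apply/seteqP; split].
by rewrite (_ : [set _ | _] = set0); [case: sF|apply/seteqP; split].
Qed.

Lemma constant_adapted (b : stochastic_basis R) (T : topologicalType) (y : T) :
  adapted_process (fun (_ : R) (_ : Omega b) => y).
Proof.
split=> [B bB|t t0 B bB]; last exact: constant_preimage.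
have [By|nBy] := pselect (B y).
  rewrite (_ : [set _ | _] = `[0%R, +oo[%classic `*` setT).
    by apply: measurableX.
  by apply/seteqP; split => -[s w] /=; rewrite in_itv /= andbT; case.
by rewrite (_ : [set _ | _] = set0) //; apply/seteqP; split => // p [].
Qed.

Lemma constant_martingale (b : stochastic_basis R) (M : R -> Omega b -> \bar R) (r : R) :
  (forall t w, (0 <= t)%R -> M t w = r%:E) -> martingale M.
Proof.
move=> Mr; split.
- move=> t t0 B mB; rewrite (_ : _ @^-1` _ = [set w | B r%:E]).
    exact: constant_preimage.
  by apply/seteqP; split => w /=; rewrite Mr.
- move=> t t0; apply: (eq_integrable measurableT (EFin \o cst r)).
    by move=> w _; rewrite Mr.
  exact: finite_measure_integrable_cst.
- move=> s t E s0 st _; apply: eq_integral => w _; rewrite !Mr //; exact: le_trans st.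
Qed.

(** At negative times a stopped path is arbitrary, so two constant stopped pairs agree only for t >=
    0; path events see nothing else. *)
Lemma path_sigma_algebra_ge0 (G : set (R -> S * A)) : path_sigma_algebra G ->
  forall p q, (forall t, (0 <= t)%R -> p t = q t) -> G p <-> G q.
Proof.
suff : @path_sigma_algebra R S A `<=` [set G : set (R -> S * A) |
    forall p q, (forall t, (0 <= t)%R -> p t = q t) -> G p <-> G q] by exact.
apply: smallest_sub; first split => //.
- by move=> E IH p q pq; split => -[_ nE]; split => // /(IH p q pq).
- by move=> E IH p q pq; split => -[n _ En]; exists n => //; apply/(IH n p q pq).
- by move=> _ [t [B [C [t0 _ _ ->]]]] p q pq /=; rewrite pq.
Qed.

(** The exit is at time 0, so every compensated process is constant and every stopped state equals x
    at all times t >= 0. Such a control keeps the supremum defining the value from being taken over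
    the empty set, where it is -oo. *)
Lemma admissible_outside (b : stochastic_basis R) x (a : A) : ~ D x ->
  admissible pb x (Control (fun (_ : R) (_ : Omega b) => a)).
Proof.
move=> nD; split; first exact: constant_adapted.
exists (fun _ _ => x); split; last first.
  move=> X' [_ X'0 _ _] G pG; congr (Prob _ _); apply/funext => w; apply/propext.
  apply: (path_sigma_algebra_ge0 pG) => t t0; rewrite /stopped_pair.
  by congr (_, _); rewrite (stopped_outside _ nD (X'0 w) t0) X'0.
have E w : exit pb (fun (_ : R) (_ : Omega b) => x) w = 0.
  by rewrite (@exit_outside _ _ x).
split.
- split.
  + exact: constant_adapted.
  + by move=> w t t0; exact: cvg_cst.
  + split=> [w|t t0]; first by rewrite E.
    rewrite (_ : [set _ | _] = setT); first exact: (sigma_algebra_setT (@Filt_sigma _ b t t0)).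
    by apply/seteqP; split => w //= _; rewrite E lee_fin.
- by [].
- move=> phi tphi; apply: (@constant_martingale _ _ (phi x)) => t w t0.
  rewrite /compensated E min_r ?lee_fin // time_beforeE set_itvE integral_set0.
  by rewrite sube0.
have iT : (Prob b).-integrable setT (EFin \o cst (terminal pb x)).
  exact: finite_measure_integrable_cst.
have JE w : payoff pb (fun (_ : R) (_ : Omega b) => a) (fun _ _ => x) w = (terminal pb x)%:E.
  exact: payoff_outside.
have KE t w : (0 <= t)%R -> running_payoff pb (fun (_ : R) (_ : Omega b) => a) (fun _ _ => x)
    (mine t%:E (exit pb (fun (_ : R) (_ : Omega b) => x) w)) w
    + terminal_payoff pb (fun (_ : R) (_ : Omega b) => x) w = (terminal pb x)%:E.
  by move=> t0; rewrite -[RHS](JE w) /payoff E min_r ?lee_fin.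
have near0 : \forall t \near +oo%R, (0 <= t :> R)%R by exact: nbhs_pinfty_ge.
split.
- by apply: filterS near0 => t t0; apply: eq_integrable iT => // w _; rewrite KE.
- by apply: eq_integrable iT => // w _; rewrite JE.
apply: cvg_near_cst; apply: filterS near0 => t t0; rewrite integral0_eq // => w _.
by rewrite JE KE // subee // abse0.
Qed.

Lemma value_outside x (b : stochastic_basis R) (a : A) : ~ D x ->
  value pb x = (terminal pb x)%:E.
Proof.
move=> nD; rewrite /value (_ : [set _ | _] = [set (terminal pb x)%:E]) ?ereal_sup1 //.
apply/seteqP; split => v /=; first by move=> [c [ac ->]]; exact: control_value_outside.
move=> ->; exists (Control (fun (_ : R) (_ : Omega b) => a)).
have ac := admissible_outside b a nD; split => //.
by rewrite control_value_outside.
Qed.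

End OutsideDomain.

Theorem theorem2 (R : realType) (S : topologicalType) (A : metricType R)
  (pb : control_problem S A)
  (* pia pi0 is the sequence chosen by the algorithm started at pi0 *)
  (pia : markov_policy pb -> nat -> markov_policy pb)
  (Istar : markov_policy pb -> Prop)
  (Istar_nonempty : exists pi, Istar pi)
  (Istar_improvable : forall pi, Istar pi -> improvable pi)
  (pia_produces : forall pi0, Istar pi0 -> pia_sequence pi0 (pia pi0))
  (hyp1 : forall pi0, Istar pi0 -> forall n,
     continuous (pia pi0 n : S -> A) /\ Istar (pia pi0 n))
  (hyp2 : forall pi0, Istar pi0 -> forall n x, domain pb x ->
     let X := pol_process (pia pi0 n.+1) x in
     exists Z : Omega (sp_basis X) -> R,
       {ae Prob (sp_basis X), forall w, 0 <= Z w} /\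
       cvg_L1 (fun t w =>
           (policy_value (pia pi0 n.+1) (stopped_path pb X t w)
            - policy_value (pia pi0 n) (stopped_path pb X t w))%:E)
         (EFin \o Z))
  (pi0 : markov_policy pb) (pi0_Istar : Istar pi0)
  (hyp3 : forall x, domain pb x -> value pb x \is a fin_num)
  (nk : nat -> nat) (nk_incr : {homo nk : i j / (i < j)%N})
  (hyp4 : {uniform domain pb,
     (fun k x =>
        gen pb (pia pi0 (nk k).+1 x) (policy_value (pia pi0 (nk k))) x
        + running pb x (pia pi0 (nk k).+1 x)) @ \oo --> (cst 0 : S -> R)})
  (hyp5 : forall x (c : control A), admissible pb x c -> forall n,
     cvg_L1 (fun t w => (policy_value (pia pi0 n)
         (stopped (state pb x c) (exit pb (state pb x c)) t w))%:E)
       (terminal_payoff pb (state pb x c))) :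
  forall x : S,
    nondecreasing_seq (fun n => policy_value (pia pi0 n) x) /\
    (policy_value (pia pi0 n) x)%:E @[n --> \oo] --> value pb x.
Proof.
have [_ step] := pia_produces _ pi0_Istar.
have cts n : continuous (pia pi0 n : S -> A) by have [] := hyp1 _ pi0_Istar n.
have tv n : improvable (pia pi0 n) by have [] := step n.
have imp n : improvement (pia pi0 n) (pia pi0 n.+1) by have [] := step n.
pose v n := policy_value (pia pi0 n).
have nd x : nondecreasing_seq (fun n => v n x).
  apply/nondecreasing_seqP => n; have [Dx|nDx] := pselect (domain pb x).
    exact: (policy_improvement (cts n) (cts n.+1) (tv n) (imp n) Dx (hyp2 _ pi0_Istar n x Dx)).
  by rewrite /v /policy_value asboolF.
move=> x; split; first exact: nd.
have [Dx|nDx] := pselect (domain pb x); last first.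
  (* Any stochastic basis and any action would do; these are at hand. *)
  rewrite (value_outside (sp_basis (const_process pb (pi0 x) x)) (pi0 x) nDx).
  by apply: cvg_near_cst; apply: nearW => n; rewrite /policy_value asboolF.
have ndE : nondecreasing_seq (fun n => (v n x)%:E).
  by move=> n m nm; rewrite lee_fin; exact: nd.
have -> : value pb x = ereal_sup (range (fun n => (v n x)%:E)).
  apply/le_anti/andP; split; last first.
    apply: ge_ereal_sup => _ [n _ <-]; apply: ereal_sup_ubound.
    exists (pol_control (pia pi0 n) x); split; first exact: pol_admissible.
    have [_ _ _ [_ iJ _]] := policy_stateP (pia pi0 n) Dx.
    rewrite /v /policy_value asboolT // fineK //; exact: integrable_fin_num iJ.
  apply: ge_ereal_sup => _ [c [ac ->]].
  (* The fixed lower function is the value of the initial policy, below all later ones by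
     monotonicity. *)
  apply: (control_value_le ac (hyp5 _ _ ac 0%N)) => e e0.
  have /hyp4 [k _ hk] : nbhs (cst 0 : {uniform` domain pb -> R})
      [set h : S -> R | forall y, domain pb y -> `|h y| < e].
    apply/uniform_nbhs; exists [set p : R * R | ball p.1 e p.2]; split.
      exact: entourage_ball (PosNum e0).
    by move=> h hb y Dy; have := hb y Dy; rewrite /ball /= sub0r normrN.
  exists (v (nk k)); split.
  - exact: tv.
  (* The improvement attains the supremum over actions, so the uniform bound on its drift bounds the
     drift under every action. *)
  - move=> y a Dy; have := hk k (leqnn k) y Dy.
    move=> /(le_lt_trans (ler_norm _)) /ltW; apply: le_trans.
    rewrite -lee_fin (imp (nk k) y Dy); apply: ereal_sup_ubound; by exists a.
  - by move=> y; exact: nd.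
  - by apply: ereal_sup_ubound; exists (nk k).
exact: ereal_nondecreasing_cvgn.
Qed.
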